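(* Let $\kappa>0$ and $a\in\mathbb{R}$, and let $x_0\approx 0.83356$ be the unique positive solution of $x\operatorname{artanh}(x)=1$. In $\mathbb{S}^2(\kappa)\times\mathbb{R}$ the family of tubes $\mathcal{T}_a=\{T_a(H):H\in(0,\infty)\}$ of pitch $a$ produces a foliation if and only if $$|a|\ \ge\ \sqrt{\frac{1-x_0^2}{x_0^2\,\kappa}}.$$ Moreover, if $\mathcal{T}_a$ produces a foliation, then $\mathcal{T}_a$ can be extended by adding the minimal spherical helicoid $\Sigma_a(0,0)$ and the vertically translated family $\mathcal{T}_a':=\mathcal{T}_a+(0,0,\pi|a|)$ with opposite orientation, and the extended family $$\overline{\mathcal{T}_a}:=\mathcal{T}_a\cup\{\Sigma_a(0,0)\}\cup\mathcal{T}_a'=\{T_a(H):H\in(-\infty,\infty)\}$$ (where $T_a(0)=\Sigma_a(0,0)$ and, for $H<0$, $T_a(H)$ is the translate of $T_a(-H)$ by $(0,0,\pi|a|)$ with reversed orientation) foliates $\mathbb{S}^2(\kappa)\times\mathbb{R}$ without the two geodesics arising as the limits $H\to\pm\infty$.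
   Context: Coordinates: on $\mathbb{S}^2(\kappa)\times\mathbb{R}$ (with $\mathbb{S}^2(\kappa)$ the round sphere of curvature $\kappa>0$), away from the two fibers over the poles of $\mathbb{S}^2(\kappa)$, use $(r,\theta,z)\in(0,\pi/\sqrt\kappa)\times\mathbb{R}/2\pi\mathbb{Z}\times\mathbb{R}$ with metric $dr^2+\mathrm{sn}_\kappa^2(r)\,d\theta^2+dz^2$, where $\mathrm{sn}_\kappa(r)=\frac{1}{\sqrt\kappa}\sin(\sqrt\kappa\,r)$ and $\mathrm{cs}_\kappa(r)=\cos(\sqrt\kappa\,r)$. The screw motion group of pitch $a$ is $G_a=\{(r,\theta,z)\mapsto(r,\theta+s,z+as): s\in\mathbb{R}\}$. Tubes: for $H>0$ put $J=-2H/\kappa$. For $\sigma\in\mathbb{R}$ let $r(\sigma)\in(0,\pi/\sqrt\kappa)$ be the unique solution of $\frac{2H}{\kappa}(\mathrm{cs}_\kappa(r)-1)+\mathrm{sn}_\kappa(r)\sin\sigma=J$, and let $$h_a(\sigma)=\int_{\pi/2}^{\sigma}\frac{\sqrt{\mathrm{sn}_\kappa^2(r(u))+a^2}}{2H\,\mathrm{sn}_\kappa(r(u))-\mathrm{cs}_\kappa(r(u))\sin u}\,\sin u\,du .$$ The curve $\sigma\mapsto(r(\sigma),h_a(\sigma))$ is a simple closed curve (period $2\pi$) in the orbit space with coordinates $(r,h)$, and the tube $T_a(H)$ is the surface $\{(r(\sigma),s,h_a(\sigma)+as):\sigma,s\in\mathbb{R}\}$, which is $G_a$-invariant and has constant mean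 curvature $H$. $\Sigma_a(0,0)$ denotes the minimal $G_a$-invariant spherical helicoid, i.e. the surface swept out under $G_a$ by a horizontal geodesic perpendicular to the fiber over $r=0$; here it is vertically positioned as the limit of $T_a(H)$ as $H\to0$ (its generating lines have heights $h=\pm\frac{\pi}{2}|a|$). As $H\to\infty$ the tubes $T_a(H)$ converge to the geodesic $s\mapsto(\frac{\pi}{2\sqrt\kappa},s,as)$; as $H\to-\infty$ the limit is the translate of this geodesic by $(0,0,\pi|a|)$. A family of surfaces ''produces a foliation'' if its members are (embedded, pairwise disjoint) leaves of a foliation of an open subset of the ambient space, the limit geodesic removed. *)

(* Defs.v *)
From mathcomp Require Import all_boot all_order all_algebra.
From mathcomp Require Import all_classical all_reals all_analysis.

Set Implicit Arguments.
Unset Strict Implicit.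
Unset Printing Implicit Defensive.

Import Order.TTheory GRing.Theory Num.Theory.
Import numFieldNormedType.Exports.

Local Open Scope classical_set_scope.
Local Open Scope ring_scope.

(* Inverse hyperbolic tangent; only meaningful on ]-1, 1[. *)
Definition artanh {R : realType} (x : R) : R := ln ((1 + x) / (1 - x)) / 2.

(* Oriented integral: the sign changes when the bounds are exchanged. *)
Definition oriented_integral {R : realType} (f : R -> R) (u v : R) : R :=
  if u <= v then Rintegral lebesgue_measure `[u, v] f
  else - Rintegral lebesgue_measure `[v, u] f.

Notation space R := ((R * R * R) * R)%type.

Section Foliations.
Variable R : realType.
Local Notation ambient := (space R).

(* The sphere has radius 1 / sqrt kappa in R^3. *)
Definition S2xR (kappa : R) : set ambient :=
  [set p | p.1.1.1 ^+ 2 + p.1.1.2 ^+ 2 + p.1.2 ^+ 2 = kappa^-1].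

(* An oriented surface is a parametrised surface: the coordinates (u, v)
   induce the orientation, so that precomposing with (u, v) |-> (- u, v)
   reverses it. *)
Definition surface : Type := R -> R -> ambient.

Definition support_of (S : surface) : set ambient :=
  [set p | exists u v, p = S u v].

Definition reverse (S : surface) : surface := fun u v => S (- u) v.

Definition translate (t : R) (S : surface) : surface :=
  fun u v => ((S u v).1, (S u v).2 + t).

Definition du (S : surface) (u v : R) : ambient := derive1 (fun x => S x v) u.
Definition dv (S : surface) (u v : R) : ambient := derive1 (fun y => S u y) v.

Definition immersion (S : surface) : Prop :=
  [/\ forall u v, derivable (fun x => S x v) u 1 /\
                  derivable (fun y => S u y) v 1,
      continuous (fun w : R * R => du S w.1 w.2),
      continuous (fun w : R * R => dv S w.1 w.2)
    & forall u v (c d : R), c *: du S u v + d *: dv S u v = 0 ->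
        c = 0 /\ d = 0].

(* [phi] restricts to a homeomorphism from the open subset [V] of [M] onto
   R^2 x R; its plaques are the sets where the last coordinate is constant. *)
Definition chart (M V : set ambient) (phi : ambient -> (R * R) * R) : Prop :=
  [/\ V `<=` M,
      open (V : set (subspace M)),
      {within V, continuous phi}
    & exists psi : (R * R) * R -> ambient,
        [/\ continuous psi,
            forall p, V p -> psi (phi p) = p,
            forall y, V (psi y)
          & forall y, phi (psi y) = y]].

Definition plaque (V : set ambient) (phi : ambient -> (R * R) * R)
    (p : ambient) : set ambient :=
  V `&` [set q | (phi q).2 = (phi p).2].

Definition embedded_in (M : set ambient) (S : surface) : Prop :=
  immersion S /\
  forall p, support_of S p ->
    exists V phi, [/\ chart M V phi, V p & support_of S `&` V = plaque V phi p].

(* [F] is the set of leaves of a foliation of [U], an open subset of [M]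
   (being a union of domains of charts).  The leaves are C^1, the foliated
   charts only continuous: in the limiting case of the pitch condition, the
   tubes approach the spherical helicoid in such a way that the holonomy is
   not C^1. *)
Definition foliates (M U : set ambient) (F : set surface) : Prop :=
  [/\ forall S, F S -> embedded_in M S /\ connected (support_of S),
      trivIset F support_of,
      \bigcup_(S in F) support_of S = U
    & forall p, U p -> exists V phi,
        [/\ chart M V phi, V p, V `<=` U &
            forall S q, F S -> (support_of S `&` V) q ->
              connected_component (support_of S `&` V) q = plaque V phi q]].

Definition produces_foliation (M : set ambient) (F : set surface)
    (gamma : set ambient) : Prop :=
  exists W : set ambient,
    [/\ W `<=` M, open (W : set (subspace M)), gamma `<=` W
      & foliates M (W `\` gamma) F].

End Foliations.

Section Tubes.
Variables (R : realType) (kappa a : R).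

Definition sn (r : R) : R := sin (Num.sqrt kappa * r) / Num.sqrt kappa.
Definition cs (r : R) : R := cos (Num.sqrt kappa * r).

(* Polar coordinates.  A negative r is allowed: (- r, theta, z) denotes the
   same point as (r, theta + pi, z). *)
Definition cyl (r theta z : R) : space R :=
  ((sn r * cos theta, sn r * sin theta, cs r / Num.sqrt kappa), z).

Definition tube_radius (H sigma : R) : R :=
  get [set r : R | 0 < r < pi / Num.sqrt kappa /\
    2 * H / kappa * (cs r - 1) + sn r * sin sigma = - (2 * H / kappa)].

Definition tube_height (H sigma : R) : R :=
  oriented_integral (fun u =>
    Num.sqrt (sn (tube_radius H u) ^+ 2 + a ^+ 2) /
    (2 * H * sn (tube_radius H u) - cs (tube_radius H u) * sin u) * sin u)
  (pi / 2) sigma.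

(* Meaningful for 0 < H only. *)
Definition tube (H : R) : surface R := fun sigma s =>
  cyl (tube_radius H sigma) s (tube_height H sigma + a * s).

(* The screw motions sweep the complete horizontal geodesic
   t |-> (- t, 0, pi |a| / 2), which crosses both fibers over the poles; its
   part with t > 0 also generates the lines at height - pi |a| / 2.  The
   orientation is the limit of that of [tube H] as H tends to 0. *)
Definition helicoid : surface R := fun t s =>
  cyl (- t) s (pi / 2 * `|a| + a * s).

Definition ext_tube (H : R) : surface R :=
  if 0 < H then tube H
  else if H == 0 then helicoid
  else reverse (translate (pi * `|a|) (tube (- H))).

Definition tubes : set (surface R) := [set tube H | H in [set H | 0 < H]].

Definition opposite_tubes : set (surface R) :=
  [set reverse (translate (pi * `|a|) S) | S in tubes].

Definition extended_tubes : set (surface R) :=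
  tubes `|` [set helicoid] `|` opposite_tubes.

Definition limit_geodesic : set (space R) :=
  range (fun s => cyl (pi / (2 * Num.sqrt kappa)) s (a * s)).

Definition opposite_limit_geodesic : set (space R) :=
  range (fun s => cyl (pi / (2 * Num.sqrt kappa)) s (a * s + pi * `|a|)).

End Tubes.

(* Main.v *)
Require Import Defs.
From mathcomp Require Import all_boot all_order all_algebra.
From mathcomp Require Import all_classical all_reals all_analysis.
From mathcomp Require Import ring lra.
Set Implicit Arguments.
Unset Strict Implicit.
Unset Printing Implicit Defensive.
Import Order.TTheory GRing.Theory Num.Theory.
Import numFieldNormedType.Exports.
Local Open Scope classical_set_scope.
Local Open Scope ring_scope.

(** Put k = sqrt kappa, h = 2H/k and t = - cot (k r).  The equation for r(sigma)
    reads t = sin sigma / h, and the height integral is elementary.  In terms of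
    t and of the helical angle z/a - theta, the tube T_a(H) becomes the graph
    z/a - theta = +- beta(h, t) over |t| <= 1/h, where
      d beta / d h = (y artanh y - 1) / (positive),
    with e = (1 + a^2 kappa)^(-1/2), Y^2 = (1 - t^2 h^2) / (1 + (1 - e^2) t^2)
    and y = e Y / sqrt (1 + h^2).  As h > 0 varies, y takes values below e, and
    comes arbitrarily close to e for t = 0 and h -> 0.  So if e <= x0, then
    beta is strictly decreasing in h and the tubes are pairwise disjoint; if
    e > x0, then at t = 0 the function beta first increases and then decreases,
    and two tubes meet.  The pitch condition says e <= x0.

    Since beta(-h, t) = pi - beta(h, t), the same formula describes the whole
    extended family, h = 0 being the helicoid.  Away from the equator the leaves
    are straightened by a norm preserving homeomorphism of the gnomonic plane;
    near the equator h itself, as an implicit function of t and beta, is the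
    transverse coordinate. *)

(** * Derivatives, continuity and artanh *)

(** In the limiting case e = x0 the derivative of beta in h vanishes on the helicoid, at h = t = 0,
    so no inverse function theorem applies there. Disjointness, the inverse maps and their
    continuity are therefore obtained from strict monotonicity, intermediate values and compactness.
    Two kinds of charts are needed because each fails where the other works. The two sheets +- beta
    of a leaf meet along its edge |t| = 1 / |h|, where (t, beta) is not a coordinate system, and t
    is infinite at the poles. The gnomonic plane handles both: a signed coordinate w with w^2 + h^2
    = 1 / t^2 passes from one sheet to the other as it crosses 0. The equator t = 0 is the line at
    infinity of that plane; but there no leaf has an edge, and beta stays strictly between 0 and pi,
    the two excluded values being those of the limit geodesics. *)

Section Calculus.
Variable R : realType.
Implicit Types (f g : R -> R) (x c d : R).

Lemma der_cst x c : is_derive x (1 : R) (fun=> c) 0.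
Proof. exact: is_derive_cst. Qed.

Lemma der_id x : is_derive x (1 : R) (fun y => y) 1.
Proof. exact: is_derive_id. Qed.

Lemma derD x f g c d : is_derive x (1 : R) f c -> is_derive x (1 : R) g d ->
  is_derive x (1 : R) (fun y => f y + g y) (c + d).
Proof. exact: is_deriveD. Qed.

Lemma derN x f c : is_derive x (1 : R) f c ->
  is_derive x (1 : R) (fun y => - f y) (- c).
Proof. exact: is_deriveN. Qed.

Lemma derM x f g c d : is_derive x (1 : R) f c -> is_derive x (1 : R) g d ->
  is_derive x (1 : R) (fun y => f y * g y) (c * g x + f x * d).
Proof.
move=> hf hg; have h := is_deriveM hf hg.
have -> : c * g x + f x * d = f x *: d + g x *: c.
  by rewrite addrC; congr (_ + _); rewrite /GRing.scale/= mulrC.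
exact: h.
Qed.

Lemma derX x f c n : is_derive x (1 : R) f c ->
  is_derive x (1 : R) (fun y => f y ^+ n) (n%:R * f x ^+ n.-1 * c).
Proof. by move=> hf; have h := is_deriveX n hf; rewrite -exprfctE; exact: h. Qed.

Lemma derV x f c : f x != 0 -> is_derive x (1 : R) f c ->
  is_derive x (1 : R) (fun y => (f y)^-1) (- c / f x ^+ 2).
Proof.
move=> fx hf; have h := is_deriveV fx hf.
have -> : - c / f x ^+ 2 = - (f x) ^- 2 *: c.
  by rewrite /GRing.scale/= mulNr mulrC mulNr.
exact: h.
Qed.

Lemma der_comp x f g c d :
  is_derive (g x) (1 : R) f c -> is_derive x (1 : R) g d ->
  is_derive x (1 : R) (fun y => f (g y)) (c * d).
Proof. exact: is_derive1_comp. Qed.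

Lemma der_sqrt x f c : 0 < f x -> is_derive x (1 : R) f c ->
  is_derive x (1 : R) (fun y => Num.sqrt (f y)) ((2 * Num.sqrt (f x))^-1 * c).
Proof. by move=> fx; apply: (der_comp (f := Num.sqrt)); exact: is_derive1_sqrt. Qed.

Lemma der_atan x f c : is_derive x (1 : R) f c ->
  is_derive x (1 : R) (fun y => atan (f y)) ((1 + f x ^+ 2)^-1 * c).
Proof. by apply: (der_comp (f := atan)); exact: is_derive1_atan. Qed.

Lemma der_acos x f c : -1 < f x < 1 -> is_derive x (1 : R) f c ->
  is_derive x (1 : R) (fun y => acos (f y)) (- (Num.sqrt (1 - f x ^+ 2))^-1 * c).
Proof. by move=> fx; apply: (der_comp (f := acos)); exact: is_derive1_acos. Qed.

Lemma der_cos x f c : is_derive x (1 : R) f c ->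
  is_derive x (1 : R) (fun y => cos (f y)) (- sin (f x) * c).
Proof. by apply: (der_comp (f := cos)); exact: is_derive_cos. Qed.

Lemma der_sin x f c : is_derive x (1 : R) f c ->
  is_derive x (1 : R) (fun y => sin (f y)) (cos (f x) * c).
Proof. by apply: (der_comp (f := sin)); exact: is_derive_sin. Qed.

Lemma der_ln x f c : 0 < f x -> is_derive x (1 : R) f c ->
  is_derive x (1 : R) (fun y => ln (f y)) ((f x)^-1 * c).
Proof. by move=> fx; apply: (der_comp (f := (@ln R))); exact: is_derive1_ln. Qed.

Lemma is_derive1_artanh x : -1 < x < 1 ->
  is_derive x (1 : R) (@artanh R) (1 - x ^+ 2)^-1.
Proof.
move=> /andP[x1 x2]; rewrite /artanh.
have p1 : 0 < 1 + x by lra.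
have p2 : 0 < 1 - x by lra.
eapply is_derive_eq.
  eapply derM; last exact: der_cst.
  eapply der_ln; first exact: divr_gt0.
  eapply derM; first by eapply derD; [exact: der_cst|exact: der_id].
  eapply derV; first by rewrite gt_eqF.
  by eapply derD; [exact: der_cst|eapply derN; exact: der_id].
by cbv beta; field; nra.
Qed.

Lemma der_artanh x f c : -1 < f x < 1 -> is_derive x (1 : R) f c ->
  is_derive x (1 : R) (fun y => artanh (f y)) ((1 - f x ^+ 2)^-1 * c).
Proof. by move=> fx; apply: (der_comp (f := artanh)); exact: is_derive1_artanh. Qed.

Lemma is_derive1_continuous x f c :
  is_derive x (1 : R) f c -> {for x, continuous f}.
Proof.
by move=> [d _]; apply: differentiable_continuous; apply/derivable1_diffP.
Qed.

(** Positivity is asked inside the interval only: in several uses the derivative vanishes at an end,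
    as it does at h = 0 in the limiting case of the pitch condition. *)
Lemma derive_lt f (df : R -> R) (a b : R) : a < b ->
  (forall x, a <= x <= b -> {for x, continuous f}) ->
  (forall x, a < x < b -> is_derive x (1 : R) f (df x)) ->
  (forall x, a < x < b -> 0 < df x) -> f a < f b.
Proof.
move=> ab cf hf df0.
have hd (z : R) : z \in `]a, b[ -> is_derive z (1 : R) f (df z).
  by rewrite in_itv/=; exact: hf.
have hc : {within `[a, b], continuous f}.
  by apply: continuous_in_subspaceT => z; rewrite inE/= in_itv/=; exact: cf.
have [z zab e] := MVT ab hd hc.
rewrite -subr_gt0 e mulr_gt0 ?subr_gt0// df0//.
Qed.

End Calculus.

(* Both tactics leave the side conditions (nonzero denominators, arguments in
   the domain).  Bare functions are eta-expanded first, since unification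
   contracts [fun y => f y] to [f]. *)
Ltac der :=
  first [eapply der_id | eapply der_cst |
  lazymatch goal with
  | |- is_derive _ _ (fun y => _ + _) _ => eapply derD; [der|der]
  | |- is_derive _ _ (fun y => - _) _ => eapply derN; der
  | |- is_derive _ _ (fun y => _ * _) _ => eapply derM; [der|der]
  | |- is_derive _ _ (fun y => _ ^+ _) _ => eapply derX; der
  | |- is_derive _ _ (fun y => _^-1) _ => eapply derV; [|der]
  | |- is_derive _ _ (fun y => Num.sqrt _) _ => eapply der_sqrt; [|der]
  | |- is_derive _ _ (fun y => atan _) _ => eapply der_atan; der
  | |- is_derive _ _ (fun y => acos _) _ => eapply der_acos; [|der]
  | |- is_derive _ _ (fun y => cos _) _ => eapply der_cos; der
  | |- is_derive _ _ (fun y => sin _) _ => eapply der_sin; der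
  | |- is_derive _ _ (fun y => ln _) _ => eapply der_ln; [|der]
  | |- is_derive _ _ (fun y => artanh _) _ => eapply der_artanh; [|der]
  | |- is_derive _ _ (fun y => _) _ => idtac
  | |- is_derive ?x ?v ?f ?d => change (is_derive x v (fun y => f y) d); der
  | _ => idtac
  end].

Section Continuity.
Variables (R : realType) (T : topologicalType).
Implicit Types (f g : T -> R) (x : T).

Lemma cts_id (U : topologicalType) (x : U) : continuous_at x (fun y => y).
Proof. exact: cvg_id. Qed.

Lemma cts_cst (U V : topologicalType) (x : U) (c : V) :
  continuous_at x (fun=> c).
Proof. exact: cvg_cst. Qed.

Lemma ctsD x f g : continuous_at x f -> continuous_at x g ->
  continuous_at x (fun y => f y + g y).
Proof. exact: cvgD. Qed.

Lemma cts_pair (U V W : topologicalType) (x : U) (f : U -> V) (g : U -> W) :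
  continuous_at x f -> continuous_at x g ->
  continuous_at x (fun y => (f y, g y)).
Proof. exact: cvg_pair. Qed.

Lemma ctsN x f : continuous_at x f -> continuous_at x (fun y => - f y).
Proof. exact: cvgN. Qed.

Lemma ctsM x f g : continuous_at x f -> continuous_at x g ->
  continuous_at x (fun y => f y * g y).
Proof. exact: cvgM. Qed.

Lemma ctsX x f n : continuous_at x f -> continuous_at x (fun y => f y ^+ n).
Proof.
move=> hf; elim: n => [|n IH]; first exact: cvg_cst.
have -> : (fun y => f y ^+ n.+1) = (fun y => f y * f y ^+ n).
  by apply/funext => y; rewrite exprS.
exact: ctsM.
Qed.

Lemma ctsV x f : f x != 0 -> continuous_at x f ->
  continuous_at x (fun y => (f y)^-1).
Proof. exact: cvgV. Qed.

Lemma cts_comp x (h : R -> R) f : continuous_at (f x) h -> continuous_at x f ->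
  continuous_at x (fun y => h (f y)).
Proof. by move=> hh hf; apply: (@continuous_comp _ _ _ f h). Qed.

Lemma cts_sqrt x f : continuous_at x f ->
  continuous_at x (fun y => Num.sqrt (f y)).
Proof. by apply: (cts_comp (h := Num.sqrt)); exact: sqrt_continuous. Qed.

Lemma cts_atan x f : continuous_at x f -> continuous_at x (fun y => atan (f y)).
Proof. by apply: (cts_comp (h := atan)); exact: continuous_atan. Qed.

Lemma cts_cos x f : continuous_at x f -> continuous_at x (fun y => cos (f y)).
Proof. by apply: (cts_comp (h := cos)); exact: continuous_cos. Qed.

Lemma cts_sin x f : continuous_at x f -> continuous_at x (fun y => sin (f y)).
Proof. by apply: (cts_comp (h := sin)); exact: continuous_sin. Qed.

Lemma cts_acos x f : -1 < f x < 1 -> continuous_at x f ->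
  continuous_at x (fun y => acos (f y)).
Proof. by move=> fx; apply: (cts_comp (h := acos)); exact: continuous_acos. Qed.

Lemma cts_artanh x f : -1 < f x < 1 -> continuous_at x f ->
  continuous_at x (fun y => artanh (f y)).
Proof.
move=> fx; apply: (cts_comp (h := artanh)).
exact: is_derive1_continuous (is_derive1_artanh fx).
Qed.

End Continuity.

Ltac cts :=
  first [assumption | exact: cts_id | exact: cts_cst |
  lazymatch goal with
  | |- continuous_at _ (fun y => _ + _) => apply: ctsD; cts
  | |- continuous_at _ (fun y => - _) => apply: ctsN; cts
  | |- continuous_at _ (fun y => _ * _) => apply: ctsM; cts
  | |- continuous_at _ (fun y => _ ^+ _) => apply: ctsX; cts
  | |- continuous_at _ (fun y => _^-1) => apply: ctsV; [|cts]
  | |- continuous_at _ (fun y => Num.sqrt _) => apply: cts_sqrt; cts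
  | |- continuous_at _ (fun y => atan _) => apply: cts_atan; cts
  | |- continuous_at _ (fun y => acos _) => apply: cts_acos; [|cts]
  | |- continuous_at _ (fun y => cos _) => apply: cts_cos; cts
  | |- continuous_at _ (fun y => sin _) => apply: cts_sin; cts
  | |- continuous_at _ (fun y => artanh _) => apply: cts_artanh; [|cts]
  | |- continuous_at _ (fun y => y.1) => exact: cvg_fst
  | |- continuous_at _ (fun y => y.2) => exact: cvg_snd
  | |- continuous_at _ (fun y => _.1) =>
      apply: (continuous_comp (g := fst)); [cts|exact: cvg_fst]
  | |- continuous_at _ (fun y => _.2) =>
      apply: (continuous_comp (g := snd)); [cts|exact: cvg_snd]
  | |- continuous_at _ (fun y => (_, _)) => apply: cts_pair; cts
  | |- continuous_at _ (fun y => _) => idtac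
  | |- continuous_at ?x ?f => change (continuous_at x (fun y => f y)); cts
  | _ => idtac
  end].

Section ArtanhRoot.
Variable R : realType.
Implicit Types x y : R.

Lemma artanh0 : artanh 0 = 0 :> R.
Proof. by rewrite /artanh subr0 addr0 divr1 ln1 mul0r. Qed.

Lemma artanhN x : -1 < x < 1 -> artanh (- x) = - artanh x.
Proof.
move=> /andP[x1 x2]; rewrite /artanh opprK -mulNr -lnV ?invf_div//.
by rewrite posrE divr_gt0//; lra.
Qed.

Lemma artanh_ge0 x : 0 <= x < 1 -> 0 <= artanh x.
Proof.
move=> /andP[x1 x2]; rewrite /artanh divr_ge0// ln_ge0//.
by rewrite ler_pdivlMr; lra.
Qed.

Lemma artanh_gt0 x : 0 < x < 1 -> 0 < artanh x.
Proof.
move=> /andP[x1 x2]; rewrite /artanh divr_gt0// ln_gt0//.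
by rewrite ltr_pdivlMr; lra.
Qed.

(** Both terms of the derivative artanh z + z / (1 - z^2) are positive on ]0, 1[. This makes x0
    unique and turns comparisons of y artanh y with 1 into comparisons of y with x0. *)
Lemma mul_artanh_lt x y : 0 <= x -> x < y -> y < 1 ->
  x * artanh x < y * artanh y.
Proof.
move=> x0 xy y1; pose f (z : R) := z * artanh z.
have h (z : R) : -1 < z < 1 ->
    is_derive z (1 : R) f (1 * artanh z + z * ((1 - z ^+ 2)^-1 * 1)).
  by move=> z1; rewrite /f; der.
apply: (derive_lt (f := f) xy) => [z zI|z zI|z zI].
- by apply: is_derive1_continuous; apply: h; lra.
- by apply: h; lra.
have z1 : 0 < z < 1 by lra.
have := artanh_gt0 z1.
have : 0 < (1 - z ^+ 2)^-1 by rewrite invr_gt0; nra.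
nra.
Qed.

End ArtanhRoot.

(** * Location of the root of x artanh x = 1 *)

Section RootLocation.
Variable R : realType.

(** The derivative of the difference is x^8 / (1 - x^2), the remainder of the geometric series of 1
    / (1 - x^2). *)
Lemma artanh_gt_taylor (u : R) : 0 < u < 1 ->
  u + u ^+ 3 / 3 + u ^+ 5 / 5 + u ^+ 7 / 7 < artanh u.
Proof.
move=> /andP[u0 u1].
pose f (x : R) := artanh x - (x + x ^+ 3 / 3 + x ^+ 5 / 5 + x ^+ 7 / 7).
pose df (x : R) := x ^+ 8 / (1 - x ^+ 2).
have hf (x : R) : -1 < x < 1 -> is_derive x (1 : R) f (df x).
  move=> x1; rewrite /f; eapply is_derive_eq; first by der.
  by rewrite /df; field; nra.
have f0 : f 0 = 0 by rewrite /f artanh0; ring.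
suff : f 0 < f u by rewrite f0 /f subr_gt0.
apply: (derive_lt (df := df) u0) => x xI.
- have x1 : -1 < x < 1 by lra.
  exact: is_derive1_continuous (hf x x1).
- by apply: hf; lra.
- by rewrite /df divr_gt0 ?exprn_gt0//; [lra|nra].
Qed.

(** The remainder x^6 / (1 - x^2) of the geometric series is at most c x^6 up to u, because 1 / (1 -
    x^2) is increasing. *)
Lemma artanh_lt_taylor (u c : R) : 0 < u < 1 -> (1 - u ^+ 2)^-1 = c ->
  artanh u < u + u ^+ 3 / 3 + u ^+ 5 / 5 + c * u ^+ 7 / 7.
Proof.
move=> /andP[u0 u1] uc.
pose f (x : R) := x + x ^+ 3 / 3 + x ^+ 5 / 5 + c * x ^+ 7 / 7 - artanh x.
pose df (x : R) := x ^+ 6 * (c - (1 - x ^+ 2)^-1).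
have hf (x : R) : -1 < x < 1 -> is_derive x (1 : R) f (df x).
  move=> x1; rewrite /f; eapply is_derive_eq; first by der.
  by rewrite /df; field; nra.
have f0 : f 0 = 0 by rewrite /f artanh0; ring.
suff : f 0 < f u by rewrite f0 /f subr_gt0.
apply: (derive_lt (df := df) u0) => x xI.
- have x1 : -1 < x < 1 by lra.
  exact: is_derive1_continuous (hf x x1).
- by apply: hf; lra.
- rewrite /df mulr_gt0 ?exprn_gt0//; first lra.
  by rewrite -uc subr_gt0 ltf_pV2 ?posrE; nra.
Qed.

(* (27 / 20) ^ 8 is within 0.15% of (1 + x0) / (1 - x0), so that the logarithm
   of the remaining factor is controlled by ln y <= y - 1. *)
Lemma ln_27_20 : ln (27 / 20) = 2 * artanh (7 / 47) :> R.
Proof.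
rewrite /artanh; have -> : (1 + 7 / 47) / (1 - 7 / 47) = 27 / 20 :> R by field.
lra.
Qed.

Lemma ln_le_subr1 (x : R) : 0 < x -> ln x <= x - 1.
Proof. by move=> x0; rewrite -{1}(subrKC 1 x) le_ln1Dx//; lra. Qed.

Lemma ln_ge_1subV (x : R) : 0 < x -> 1 - x^-1 <= ln x.
Proof.
move=> x0; rewrite -[X in ln X]invrK lnV ?posrE ?invr_gt0//.
by have := @ln_le_subr1 x^-1; rewrite invr_gt0 => /(_ x0); lra.
Qed.

(** [lo] and [hi] are the ends of the interval of radius 5 / 10^6 around 0.83356 that the theorem
    announces. *)
Let lo : R := 833 / 10 ^+ 3 + 555 / 10 ^+ 6.
Let hi : R := 833 / 10 ^+ 3 + 565 / 10 ^+ 6.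

Lemma artanh_ln_27_20 (x q : R) : 0 < q -> -1 < x < 1 ->
  (1 + x) / (1 - x) = (27 / 20) ^+ 8 * q ->
  artanh x = (8 * (2 * artanh (7 / 47)) + ln q) / 2.
Proof.
move=> q0 x1 e; have p : 0 < 27 / 20 :> R by lra.
have -> : artanh x = ln ((27 / 20) ^+ 8 * q) / 2 by rewrite /artanh e.
by rewrite -ln_27_20 lnM ?posrE ?exprn_gt0 ?lnXn//; congr (_ / _); ring.
Qed.

Lemma mul_artanh_lo : lo * artanh lo < 1.
Proof.
pose q := (1 + lo) / (1 - lo) / (27 / 20) ^+ 8.
have l1 : -1 < lo < 1 by rewrite /lo; lra.
have q0 : 0 < q by rewrite /q; apply: divr_gt0; [apply: divr_gt0|]; lra.
have ql : q <= 998 / 10 ^+ 3 + 52 / 10 ^+ 5.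
  by rewrite /q ler_pdivrMr ?exprn_gt0 ?ler_pdivrMr /lo; lra.
have e : (1 + lo) / (1 - lo) = (27 / 20) ^+ 8 * q.
  by rewrite /q [RHS]mulrC divfK// expf_neq0//; lra.
have h : (1 - (7 / 47) ^+ 2)^-1 = 2209 / 2160 :> R by field.
have u1 : 0 < (7 / 47 : R) < 1 by lra.
have := ln_le_subr1 q0; have := artanh_lt_taylor u1 h.
by rewrite (artanh_ln_27_20 q0 l1 e) /lo; lra.
Qed.

Lemma mul_artanh_hi : 1 < hi * artanh hi.
Proof.
pose q := (1 + hi) / (1 - hi) / (27 / 20) ^+ 8.
have l1 : -1 < hi < 1 by rewrite /hi; lra.
have q0 : 0 < q by rewrite /q; apply: divr_gt0; [apply: divr_gt0|]; lra.
have ql : q^-1 <= 1 + 15 / 10 ^+ 4.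
  by rewrite /q invf_div invf_div mulrA ler_pdivrMr /hi; lra.
have e : (1 + hi) / (1 - hi) = (27 / 20) ^+ 8 * q.
  by rewrite /q [RHS]mulrC divfK// expf_neq0//; lra.
have u1 : 0 < (7 / 47 : R) < 1 by lra.
have := ln_ge_1subV q0; have := artanh_gt_taylor u1.
by rewrite (artanh_ln_27_20 q0 l1 e) /hi; lra.
Qed.

Lemma artanh_root : exists x0 : R,
  [/\ 0 < x0 < 1, x0 * artanh x0 = 1, lo <= x0 & x0 <= hi].
Proof.
have lohi : lo <= hi by rewrite /lo /hi; lra.
have cf : {within `[lo, hi], continuous (fun x : R => x * artanh x)}.
  apply: continuous_in_subspaceT => z; rewrite inE/= in_itv/= => zI.
  have z1 : -1 < z < 1 by move: zI; rewrite /lo /hi; lra.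
  apply: ctsM; first exact: cts_id.
  exact: is_derive1_continuous (is_derive1_artanh z1).
have [|x] := IVT (f := fun x : R => x * artanh x) (v := 1) lohi cf.
  have := mul_artanh_lo; have := mul_artanh_hi.
  by rewrite ge_min le_max => h1 h2; rewrite (ltW h1) (ltW h2) orbT.
rewrite in_itv/= => /andP[l h] e; exists x; split=> //.
by move: l h; rewrite /lo /hi; lra.
Qed.

End RootLocation.

(** * The height integral and its monotonicity *)

(* An elementary primitive of the height integrand: with al^2 + e^2 = 1, the
   height of the tube is a multiple of [profile al e h y] at
   y = cos sigma / sqrt (h^2 + al^2 sin^2 sigma). *)
Definition profile {R : realType} (al e h y : R) : R :=
  al * atan (al * y) +
  h * e / Num.sqrt (1 + h ^+ 2) * artanh (h * e / Num.sqrt (1 + h ^+ 2) * y).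

Section Profile.
Variables (R : realType) (al e : R).
Hypotheses (al_ge0 : 0 <= al) (e_gt0 : 0 < e) (al_e : al ^+ 2 + e ^+ 2 = 1 :> R).

Lemma sqrt1D_gt0 (h : R) : 0 < Num.sqrt (1 + h ^+ 2).
Proof. by rewrite sqrtr_gt0; nra. Qed.

Lemma sqr_sqrt1D (h : R) : Num.sqrt (1 + h ^+ 2) ^+ 2 = 1 + h ^+ 2.
Proof. by rewrite sqr_sqrtr//; nra. Qed.

(** The value y = 1 / h belongs to sigma = 0, a point of the tube over the equator. The derivative
    is computed on [profile] and not on [leaf_angle], which divides by al, because the necessity of
    the pitch condition includes a = 0. *)
Lemma derive_profile_top (h : R) : 0 < h ->
  is_derive h (1 : R) (fun h => profile al e h h^-1)
   ((e / Num.sqrt (1 + h ^+ 2) * artanh (e / Num.sqrt (1 + h ^+ 2)) - 1)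
      / (1 + h ^+ 2)).
Proof.
move=> h0.
pose f (x : R) := al * atan (al * x^-1) +
   x * e / Num.sqrt (1 + x ^+ 2) * artanh (e / Num.sqrt (1 + x ^+ 2)).
have N0 := sqrt1D_gt0 h; have N2 := sqr_sqrt1D h.
set N := Num.sqrt _ in N0 N2 *.
have a2 : al ^+ 2 = 1 - e ^+ 2 by rewrite -al_e addrK.
have eN : e / N < 1.
  rewrite ltr_pdivrMr// mul1r -ltr_sqr ?nnegrE 1?ltW//.
  by have := exprn_gt0 2 h0; have := sqr_ge0 al; lra.
have eN0 : 0 < e / N by rewrite divr_gt0.
suff hf : is_derive h (1 : R) f ((e / N * artanh (e / N) - 1) / (1 + h ^+ 2)).
  apply: near_eq_is_derive hf.
  near=> x; rewrite /f /profile; congr (_ + _ * artanh _).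
  have x0 : 0 < x by near: x; exact: lt_nbhsr.
  by field; rewrite !gt_eqF// sqrt1D_gt0.
rewrite /f; eapply is_derive_eq.
  by der; rewrite -/N ?gt_eqF//; first [lra|nra].
cbv beta; rewrite -/N.
(* With artanh and N as atoms, the identity is rational modulo N^2 = 1 + h^2 and al^2 = 1 - e^2. The
   later derivatives are checked in the same way. *)
move: (artanh _) => A.
have h2 := exprn_gt0 2 h0; have al2 := sqr_ge0 al.
by field: N2 a2; apply/and5P; split; rewrite gt_eqF//; lra.
Unshelve. all: end_near. Qed.
Lemma sqr_lt1 (x : R) : x ^+ 2 < 1 -> -1 < x < 1.
Proof. by move=> x1;
  rewrite -ltr_norml -ltr_sqr ?nnegrE// real_normK ?num_real ?expr1n. Qed.

Lemma sqrt_ellipse_gt0 (h s : R) : 0 < h ->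
  0 < Num.sqrt (h ^+ 2 + al ^+ 2 * sin s ^+ 2).
Proof.
move=> h0; rewrite sqrtr_gt0 ltr_wpDr ?exprn_gt0//.
by rewrite mulr_ge0 ?sqr_ge0.
Qed.

(** The difference factors into positive terms: this puts the argument of artanh in ]-1, 1[ and
    supplies the nonzero denominator in [derive_profile_section]. *)
Lemma profile_section_identity (h s : R) : 0 < h ->
  (Num.sqrt (1 + h ^+ 2) * Num.sqrt (h ^+ 2 + al ^+ 2 * sin s ^+ 2)) ^+ 2
    - (h * e * cos s) ^+ 2 = (h ^+ 2 + al ^+ 2) * (h ^+ 2 + sin s ^+ 2).
Proof.
move=> h0; have N2 := sqr_sqrt1D h.
have Q0 : 0 <= h ^+ 2 + al ^+ 2 * sin s ^+ 2.
  by apply: addr_ge0; [exact: sqr_ge0|apply: mulr_ge0; exact: sqr_ge0].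
have q2 := sqr_sqrtr Q0.
set q := Num.sqrt (_ + _ * _) in q2 *; set N := Num.sqrt _ in N2 *.
have a2 : al ^+ 2 = 1 - e ^+ 2 by rewrite -al_e addrK.
have c2 : cos s ^+ 2 = 1 - sin s ^+ 2 by rewrite -(cos2Dsin2 s) addrK.
by ring: N2 q2 c2 a2.
Qed.

Lemma profile_section_itv (h s : R) : 0 < h ->
  -1 < h * e / Num.sqrt (1 + h ^+ 2) *
    (cos s / Num.sqrt (h ^+ 2 + al ^+ 2 * sin s ^+ 2)) < 1.
Proof.
move=> h0; have q0 := sqrt_ellipse_gt0 s h0; have N0 := sqrt1D_gt0 h.
have := profile_section_identity s h0.
set q := Num.sqrt (_ + _ * _) in q0 *; set N := Num.sqrt _ in N0 * => D.
apply: sqr_lt1.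
have -> : (h * e / N * (cos s / q)) ^+ 2 = (h * e * cos s) ^+ 2 / (N * q) ^+ 2.
  by field; rewrite !gt_eqF.
rewrite ltr_pdivrMr ?exprn_gt0 ?mulr_gt0// mul1r -subr_gt0 D mulr_gt0//.
  by rewrite ltr_wpDr ?sqr_ge0 ?exprn_gt0.
by rewrite ltr_wpDr ?sqr_ge0 ?exprn_gt0.
Qed.

(** Up to the constant factor - [slant] / sqrt kappa, the right-hand side is the height integrand
    once the radius has been eliminated. *)
Lemma derive_profile_section (h s : R) : 0 < h ->
  is_derive s (1 : R)
   (fun s => profile al e h (cos s / Num.sqrt (h ^+ 2 + al ^+ 2 * sin s ^+ 2)))
   (- (Num.sqrt (h ^+ 2 + al ^+ 2 * sin s ^+ 2) / (h ^+ 2 + sin s ^+ 2)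
       * sin s)).
Proof.
move=> h0; rewrite /profile.
have h2 := exprn_gt0 2 h0; have al2 := sqr_ge0 al.
have S2 := sqr_ge0 (sin s); have c2 := cos2Dsin2 s.
have Q0 : 0 < h ^+ 2 + al ^+ 2 * sin s ^+ 2 by nra.
have q0 := sqrt_ellipse_gt0 s h0; have q2 := sqr_sqrtr (ltW Q0).
have N0 := sqrt1D_gt0 h; have N2 := sqr_sqrt1D h.
set q := Num.sqrt (_ + _ * _) in q0 q2 *.
set N := Num.sqrt _ in N0 N2 *.
have a2 : al ^+ 2 = 1 - e ^+ 2 by rewrite -al_e addrK.
have c2' : cos s ^+ 2 = 1 - sin s ^+ 2 by rewrite -c2 addrK.
have := profile_section_itv s h0; have := profile_section_identity s h0.
rewrite -/q -/N => D y1.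
have D0 : 0 < (h ^+ 2 + al ^+ 2) * (h ^+ 2 + sin s ^+ 2).
  by rewrite mulr_gt0//; lra.
eapply is_derive_eq; first by der; rewrite -/q -/N ?gt_eqF.
cbv beta; rewrite -/q -/N.
move: (artanh _) => A.
field: N2 q2 c2' a2; apply/and5P; split; rewrite ?D gt_eqF//; first lra.
by have := sqr_ge0 (al * cos s); have := exprn_gt0 2 q0; lra.
Qed.

(** Converts the arctangent of [profile] into the arccosine of [leaf_angle]. *)
Lemma acos_Vsqrt1D (x : R) : 0 <= x -> acos (Num.sqrt (1 + x ^+ 2))^-1 = atan x.
Proof.
move=> x0; rewrite -cos_atan cosK// in_itv/=.
have -> : 0 <= atan x by rewrite -atan0 le_atan.
by have := atan_ltpi2 x; have := pi_ge0 R; lra.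
Qed.

Lemma atan_lt (x : R) : 0 < x -> atan x < x.
Proof.
move=> x0; pose f (y : R) := y - atan y.
have hf (y : R) : is_derive y (1 : R) f (1 - (1 + y ^+ 2)^-1 * 1).
  by rewrite /f; der.
have f0 : f 0 = 0 by rewrite /f atan0 subrr.
rewrite -subr_gt0 -/(f x) -f0; apply: (derive_lt x0) => [y _|y yI].
- exact: is_derive1_continuous (hf y).
- have y2 : 0 < y ^+ 2 by rewrite exprn_gt0//; lra.
  by rewrite mulr1 subr_gt0 invf_lt1; lra.
Qed.

Lemma profileN (h y : R) : h * e / Num.sqrt (1 + h ^+ 2) * y < 1 ->
  -1 < h * e / Num.sqrt (1 + h ^+ 2) * y ->
  profile al e h (- y) = - profile al e h y.
Proof.
move=> y1 y2; rewrite /profile !mulrN atanN artanhN ?y1 ?y2//; ring.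
Qed.

End Profile.

(** The quantity Y of the overview, with al^2 for 1 - e^2. It vanishes on the edge |t h| = 1, and
    beyond it too, since the square root of a negative number is 0. *)
Definition tilt {R : realType} (al h t : R) : R :=
  Num.sqrt (1 - (t * h) ^+ 2) / Num.sqrt (1 + al ^+ 2 * t ^+ 2).

Definition angle_shift {R : realType} (al e h t : R) : R :=
  h * e / Num.sqrt (1 + h ^+ 2) / al *
  artanh (e / Num.sqrt (1 + h ^+ 2) * tilt al h t).

(* [leaf_angle al e h t] is the helical angle |z / a - theta| at which the leaf
   of label h meets the parallel of slope t = - cot (sqrt kappa r); the leaf
   reaches the slopes with |t h| <= 1 only.  It equals [profile / al], but is
   written with [acos] so as to cover h <= 0 too. *)
Definition leaf_angle {R : realType} (al e h t : R) : R :=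
  acos (h * Num.sqrt (1 + al ^+ 2 * t ^+ 2) / Num.sqrt (h ^+ 2 + al ^+ 2)) +
  angle_shift al e h t.

Section LeafAngle.
Variables (R : realType) (al e : R).
Hypotheses (al_gt0 : 0 < al) (e_gt0 : 0 < e) (al_e : al ^+ 2 + e ^+ 2 = 1 :> R).
Implicit Types h t : R.

Let al2_gt0 : 0 < al ^+ 2. Proof. exact: exprn_gt0. Qed.
Let a2 : al ^+ 2 = 1 - e ^+ 2 :> R. Proof. by rewrite -al_e addrK. Qed.
Let e_lt1 : e < 1. Proof. by have := al_e; have := e_gt0; have := al2_gt0; nra. Qed.

Lemma sqrt_1Dal2t2_gt0 t : 0 < Num.sqrt (1 + al ^+ 2 * t ^+ 2).
Proof. by rewrite sqrtr_gt0; have := sqr_ge0 t; have := al2_gt0; nra. Qed.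

Lemma sqr_sqrt_1Dal2t2 t : Num.sqrt (1 + al ^+ 2 * t ^+ 2) ^+ 2 = 1 + al ^+ 2 * t ^+ 2.
Proof. by rewrite sqr_sqrtr//; have := sqr_ge0 t; have := al2_gt0; nra. Qed.

Lemma sqrt_sqrDal2_gt0 h : 0 < Num.sqrt (h ^+ 2 + al ^+ 2).
Proof. by rewrite sqrtr_gt0; have := sqr_ge0 h; have := al2_gt0; lra. Qed.

Lemma sqr_sqrt_sqrDal2 h : Num.sqrt (h ^+ 2 + al ^+ 2) ^+ 2 = h ^+ 2 + al ^+ 2.
Proof. by rewrite sqr_sqrtr//; have := sqr_ge0 h; have := al2_gt0; lra. Qed.

Lemma tilt_ge0 h t : 0 <= tilt al h t.
Proof. by rewrite divr_ge0// sqrtr_ge0. Qed.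

Lemma tilt_le1 h t : tilt al h t <= 1.
Proof.
rewrite ler_pdivrMr ?sqrt_1Dal2t2_gt0// mul1r ler_wsqrtr//.
by have := sqr_ge0 (t * h); have := sqr_ge0 t; have := al2_gt0; nra.
Qed.

Lemma modulus_gt0 h : 0 < e / Num.sqrt (1 + h ^+ 2).
Proof. by rewrite divr_gt0// sqrt1D_gt0. Qed.

Lemma modulus_le h : e / Num.sqrt (1 + h ^+ 2) <= e.
Proof.
rewrite ler_pdivrMr ?sqrt1D_gt0// ler_peMr ?(ltW e_gt0)//.
by rewrite -{1}[1]sqrtr1 ler_wsqrtr//; have := sqr_ge0 h; lra.
Qed.

Lemma modulus_lt h : h != 0 -> e / Num.sqrt (1 + h ^+ 2) < e.
Proof.
move=> h0; rewrite ltr_pdivrMr ?sqrt1D_gt0// ltr_pMr//.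
have h2 : 0 < h ^+ 2 by rewrite exprn_even_gt0.
by rewrite -{1}[1]sqrtr1 ltr_sqrt//; lra.
Qed.

Lemma modulus_tilt_ge0 h t : 0 <= e / Num.sqrt (1 + h ^+ 2) * tilt al h t.
Proof. by rewrite mulr_ge0 ?tilt_ge0// ltW ?modulus_gt0. Qed.

Lemma modulus_tilt_lt1 h t : e / Num.sqrt (1 + h ^+ 2) * tilt al h t < 1.
Proof.
have := tilt_ge0 h t; have := tilt_le1 h t; have := e_lt1.
have := modulus_gt0 h; have := modulus_le h; nra.
Qed.

Lemma modulus_tilt_itv h t :
  -1 < e / Num.sqrt (1 + h ^+ 2) * tilt al h t < 1.
Proof.
by rewrite modulus_tilt_lt1 andbT (lt_le_trans _ (modulus_tilt_ge0 h t)).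
Qed.

(** The argument of the arccosine is thus in [-1, 1] exactly when |t h| <= 1, and reaches an end
    exactly on the edge. *)
Lemma sqr_acos_arg h t :
  1 - (h * Num.sqrt (1 + al ^+ 2 * t ^+ 2) / Num.sqrt (h ^+ 2 + al ^+ 2)) ^+ 2 =
  al ^+ 2 * (1 - (t * h) ^+ 2) / (h ^+ 2 + al ^+ 2).
Proof.
have p0 := sqrt_1Dal2t2_gt0 t; have p2 := sqr_sqrt_1Dal2t2 t.
have r0 := sqrt_sqrDal2_gt0 h; have r2 := sqr_sqrt_sqrDal2 h.
have h2 := sqr_ge0 h.
rewrite -[in RHS]r2; move: (Num.sqrt (_ + _ * _)) p0 p2 => p p0 p2.
move: (Num.sqrt _) r0 r2 => r r0 r2.
by field: p2 r2; rewrite gt_eqF.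
Qed.

Lemma acos_arg_le1 h t : (t * h) ^+ 2 <= 1 ->
  -1 <= h * Num.sqrt (1 + al ^+ 2 * t ^+ 2) / Num.sqrt (h ^+ 2 + al ^+ 2) <= 1.
Proof.
move=> th; rewrite -ler_norml -ler_sqr ?nnegrE// real_normK ?num_real// expr1n.
rewrite -subr_ge0 sqr_acos_arg; apply: divr_ge0; have := sqr_ge0 h; have :=
  al2_gt0; nra.
Qed.

Lemma acos_arg_lt1 h t : (t * h) ^+ 2 < 1 ->
  -1 < h * Num.sqrt (1 + al ^+ 2 * t ^+ 2) / Num.sqrt (h ^+ 2 + al ^+ 2) < 1.
Proof.
move=> th; rewrite -ltr_norml -ltr_sqr ?nnegrE// real_normK ?num_real// expr1n.
rewrite -subr_gt0 sqr_acos_arg; apply: divr_gt0; have := sqr_ge0 h; have :=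
  al2_gt0; nra.
Qed.

(* With y <= e < 1, the sign of this derivative is where x artanh x = 1 comes
   from. *)
Lemma derive_leaf_angle h t : (t * h) ^+ 2 < 1 ->
  let y := e / Num.sqrt (1 + h ^+ 2) * tilt al h t in
  is_derive h (1 : R) (leaf_angle al e ^~ t)
    ((y * artanh y - 1) / (al * (1 + h ^+ 2) * tilt al h t)).
Proof.
move=> th y.
have p0 := sqrt_1Dal2t2_gt0 t; have p2 := sqr_sqrt_1Dal2t2 t.
have r0 := sqrt_sqrDal2_gt0 h; have r2 := sqr_sqrt_sqrDal2 h.
have N0 := sqrt1D_gt0 h; have N2 := sqr_sqrt1D h.
have s0 : 0 < 1 - (t * h) ^+ 2 by lra.
have k0 := s0; rewrite -sqrtr_gt0 in k0; have k2 := sqr_sqrtr (ltW s0).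
have h2 := sqr_ge0 h; have b2 := al2_gt0; have X1 := acos_arg_lt1 th.
have y1 := modulus_tilt_itv h t.
have v : Num.sqrt (1 - (h * Num.sqrt (1 + al ^+ 2 * t ^+ 2) /
    Num.sqrt (h ^+ 2 + al ^+ 2)) ^+ 2) =
  al * Num.sqrt (1 - (t * h) ^+ 2) / Num.sqrt (h ^+ 2 + al ^+ 2).
  rewrite sqr_acos_arg sqrtrM ?mulr_ge0 ?ltW// sqrtrM ?ltW// sqrtr_sqr gtr0_norm//.
  by rewrite sqrtrV//; lra.
rewrite /leaf_angle /angle_shift; rewrite /y {y} /tilt in y1 *.
eapply is_derive_eq.
  by der; rewrite ?gt_eqF//; lra.
cbv beta; rewrite v.
move: (artanh _) => A.
move: (Num.sqrt (1 + al ^+ 2 * _)) p0 p2 {X1 v y1} => p p0 p2.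
move: (Num.sqrt (_ + al ^+ 2)) r0 r2 => r r0 r2.
move: (Num.sqrt (1 + h ^+ 2)) N0 N2 => N N0 N2.
move: (Num.sqrt _) k0 k2 => k k0 k2.
(* This is the numerator of 1 - y^2, the denominator brought in by the derivative of artanh. *)
have D : (N * p) ^+ 2 - (e * k) ^+ 2 = (h ^+ 2 + al ^+ 2) * (1 + t ^+ 2).
  by ring: N2 p2 k2 a2.
have D0 : 0 < (h ^+ 2 + al ^+ 2) * (1 + t ^+ 2).
  by rewrite mulr_gt0//; have := sqr_ge0 t; lra.
by field: N2 r2 p2 k2 a2; rewrite D !gt_eqF//; lra.
Qed.

Lemma leaf_angle0 t : leaf_angle al e 0 t = pi / 2.
Proof. by rewrite /leaf_angle /angle_shift !mul0r acos0 addr0. Qed.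

(** The arccosine is reflected and the artanh term is odd in h. Geometrically this is the vertical
    translation by pi |a| that exchanges the two families. *)
Lemma leaf_angleN h t : (t * h) ^+ 2 <= 1 ->
  leaf_angle al e (- h) t = pi - leaf_angle al e h t.
Proof.
move=> th; rewrite /leaf_angle /angle_shift /tilt mulrN !sqrrN !mulNr.
by rewrite acosN ?acos_arg_le1//; ring.
Qed.

Lemma angle_shift_ge0 h t : 0 <= h -> 0 <= angle_shift al e h t.
Proof.
move=> h0; rewrite /angle_shift mulr_ge0 ?artanh_ge0 ?modulus_tilt_ge0//.
- by rewrite !mulr_ge0 ?invr_ge0 ?sqrtr_ge0 // ltW.
- exact: modulus_tilt_lt1.
Qed.

(** The two sheets +- beta of the tube close up on its edge: artanh vanishes there, and the argument
    of the arccosine, being +- 1 and nonnegative, is 1. *)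
Lemma leaf_angle_edge h t : 0 < h -> (t * h) ^+ 2 = 1 -> leaf_angle al e h t = 0.
Proof.
move=> h0 th.
rewrite /leaf_angle /angle_shift /tilt th subrr sqrtr0 mul0r mulr0 artanh0 mulr0.
rewrite addr0 -[RHS]acos1; congr acos.
have := sqr_acos_arg h t; rewrite th subrr mulr0 mul0r => /eqP.
rewrite subr_eq0 eq_sym sqrf_eq1 => /orP[/eqP//|/eqP X].
have : 0 <= h * Num.sqrt (1 + al ^+ 2 * t ^+ 2) / Num.sqrt (h ^+ 2 + al ^+ 2).
  by rewrite !mulr_ge0 ?invr_ge0 ?sqrtr_ge0 // ltW.
by rewrite X ler0N1.
Qed.

Lemma leaf_angle_gt0 h t : 0 <= h -> (t * h) ^+ 2 < 1 -> 0 < leaf_angle al e h t.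
Proof.
move=> h0 th; rewrite /leaf_angle ltr_pwDl ?angle_shift_ge0// acos_gt0//.
by have /andP[/ltW -> ->] := acos_arg_lt1 th.
Qed.

Hypothesis e_artanh : e * artanh e <= 1.

(** The inequality is strict even when e artanh e = 1, because h > 0 makes the modulus e / sqrt (1 +
    h^2) smaller than e. *)
Lemma modulus_tilt_artanh h t (y : R) : 0 < h ->
  y = e / Num.sqrt (1 + h ^+ 2) * tilt al h t -> y * artanh y < 1.
Proof.
move=> h0 ->; apply: lt_le_trans e_artanh.
apply: mul_artanh_lt => //; first exact: modulus_tilt_ge0.
rewrite (le_lt_trans _ (modulus_lt (lt0r_neq0 h0)))//.
by rewrite ler_piMr ?tilt_le1// ltW ?modulus_gt0.
Qed.

Lemma leaf_angle_decr_ge0 h1 h2 t : 0 <= h1 -> h1 < h2 -> (t * h2) ^+ 2 <= 1 ->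
  leaf_angle al e h2 t < leaf_angle al e h1 t.
Proof.
move=> h10 h12; rewrite le_eqVlt => /orP[/eqP th|th].
  (* On the edge the arccosine has no derivative, but there beta is 0, while it is positive for the
     smaller label h1. *)
  rewrite leaf_angle_edge//; last exact: le_lt_trans h12.
  apply: leaf_angle_gt0 => //; rewrite -th !exprMn.
  have t0 : 0 < t ^+ 2.
    rewrite exprn_even_gt0//; apply: contra_eq_neq th => ->.
    by rewrite mul0r expr0n eq_sym oner_eq0.
  by rewrite ltr_pM2l// ltr_sqr ?nnegrE//; exact/ltW/(le_lt_trans h10).
rewrite -ltrN2.
have thx x : h1 <= x <= h2 -> (t * x) ^+ 2 < 1.
  move=> /andP[x1 x2]; apply: le_lt_trans th; rewrite !exprMn ler_wpM2l ?sqr_ge0//.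
  by rewrite ler_sqr ?nnegrE//; [exact: le_trans x1|lra].
pose y x := e / Num.sqrt (1 + x ^+ 2) * tilt al x t.
apply: (derive_lt (f := fun x => - leaf_angle al e x t) (df := fun x =>
   - ((y x * artanh (y x) - 1) / (al * (1 + x ^+ 2) * tilt al x t))) h12).
- by move=> x /thx tx; apply: ctsN;
    exact: is_derive1_continuous (derive_leaf_angle tx).
- by move=> x xI; apply: derN; apply: derive_leaf_angle; apply: thx; lra.
- move=> x xI; rewrite -mulNr opprB divr_gt0//.
    by rewrite subr_gt0; apply: modulus_tilt_artanh (erefl _); lra.
  have tx : (t * x) ^+ 2 < 1 by apply: thx; lra.
  rewrite !mulr_gt0 ?invr_gt0 ?sqrt_1Dal2t2_gt0//; first by have := sqr_ge0 x; lra.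
  by rewrite sqrtr_gt0; lra.
Qed.

(** Reduced to nonnegative labels by [leaf_angleN]; labels of opposite signs are separated by the
    helicoid, on which beta = pi / 2. *)
Lemma leaf_angle_decr h1 h2 t : (t * h1) ^+ 2 <= 1 -> (t * h2) ^+ 2 <= 1 ->
  h1 < h2 -> leaf_angle al e h2 t < leaf_angle al e h1 t.
Proof.
move=> th1 th2 h12; have [h10|h10] := leP 0 h1; first exact: leaf_angle_decr_ge0.
have N1 : leaf_angle al e (- h1) t = pi - leaf_angle al e h1 t.
  exact: leaf_angleN.
have [h20|h20] := leP h2 0.
  have N2 : leaf_angle al e (- h2) t = pi - leaf_angle al e h2 t.
    exact: leaf_angleN.
  have : leaf_angle al e (- h1) t < leaf_angle al e (- h2) t.
    by apply: leaf_angle_decr_ge0; rewrite ?mulrN ?sqrrN//; lra.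
  lra.
have : leaf_angle al e h2 t < leaf_angle al e 0 t.
  by apply: leaf_angle_decr_ge0; rewrite ?lexx.
have : leaf_angle al e (- h1) t < leaf_angle al e 0 t.
  by apply: leaf_angle_decr_ge0; rewrite ?lexx ?mulrN ?sqrrN//; lra.
rewrite leaf_angle0; lra.
Qed.

Lemma leaf_angle_inj h1 h2 t : (t * h1) ^+ 2 <= 1 -> (t * h2) ^+ 2 <= 1 ->
  leaf_angle al e h1 t = leaf_angle al e h2 t -> h1 = h2.
Proof.
move=> th1 th2 E; have [h|h|//] := ltgtP h1 h2.
- by have := leaf_angle_decr th1 th2 h; rewrite E ltxx.
- by have := leaf_angle_decr th2 th1 h; rewrite E ltxx.
Qed.

Lemma leaf_angle_itv_ge0 h t : 0 <= h -> (t * h) ^+ 2 <= 1 ->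
  0 <= leaf_angle al e h t <= pi / 2.
Proof.
move=> h0 th; apply/andP; split.
  by rewrite addr_ge0 ?angle_shift_ge0// acos_ge0// acos_arg_le1.
have [->|hN0] := eqVneq h 0; first by rewrite leaf_angle0.
rewrite ltW// -(leaf_angle0 t) leaf_angle_decr_ge0//.
by rewrite lt_def hN0.
Qed.

Lemma leaf_angle_itv h t : (t * h) ^+ 2 <= 1 -> 0 <= leaf_angle al e h t <= pi.
Proof.
move=> th; have := pi_ge0 R; have [h0|h0] := leP 0 h.
  by have := leaf_angle_itv_ge0 h0 th; lra.
have := @leaf_angle_itv_ge0 (- h) t; rewrite mulrN sqrrN leaf_angleN//.
by rewrite oppr_ge0 (ltW h0) => /(_ isT th); lra.
Qed.

Lemma leaf_angle_itvo h t : (t * h) ^+ 2 < 1 -> 0 < leaf_angle al e h t < pi.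
Proof.
move=> th; have := pi_gt0 R; have [h0|h0] := leP 0 h.
  by have := leaf_angle_itv_ge0 h0 (ltW th); have := leaf_angle_gt0 h0 th; lra.
have N : leaf_angle al e (- h) t = pi - leaf_angle al e h t.
  exact: leaf_angleN (ltW th).
have h0' : 0 <= - h by lra.
have th' : (t * - h) ^+ 2 < 1 by rewrite mulrN sqrrN.
by have := leaf_angle_itv_ge0 h0' (ltW th'); have := leaf_angle_gt0 h0' th'; lra.
Qed.

End LeafAngle.

(** * Every admissible helical angle is attained by some leaf *)

Section LeafAngleCovering.
Variables (R : realType) (al e : R).
Hypotheses (al_gt0 : 0 < al) (e_gt0 : 0 < e) (al_e : al ^+ 2 + e ^+ 2 = 1 :> R).
Implicit Types h t : R.

Lemma sqrt_sin_acos_arg h t : (t * h) ^+ 2 <= 1 ->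
  Num.sqrt (1 - (h * Num.sqrt (1 + al ^+ 2 * t ^+ 2) /
    Num.sqrt (h ^+ 2 + al ^+ 2)) ^+ 2) =
  al * Num.sqrt (1 - (t * h) ^+ 2) / Num.sqrt (h ^+ 2 + al ^+ 2).
Proof.
move=> th; rewrite sqr_acos_arg//.
have a2 : 0 < al ^+ 2 by exact: exprn_gt0.
have h2 := sqr_ge0 h.
rewrite sqrtrM ?mulr_ge0 ?subr_ge0// ?ltW//.
rewrite sqrtrM ?ltW// sqrtr_sqr gtr0_norm//.
by rewrite sqrtrV//; lra.
Qed.

(** The right-hand side is free of the arccosine, hence continuous in h across the edge. It serves
    for the intermediate value argument and for [plane_map]. *)
Lemma cos_leaf_angle h t : (t * h) ^+ 2 <= 1 ->
  cos (leaf_angle al e h t) =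
  (h * Num.sqrt (1 + al ^+ 2 * t ^+ 2) * cos (angle_shift al e h t)
   - al * Num.sqrt (1 - (t * h) ^+ 2) * sin (angle_shift al e h t))
  / Num.sqrt (h ^+ 2 + al ^+ 2).
Proof.
move=> th; rewrite /leaf_angle cosD.
have X := acos_arg_le1 al_gt0 th.
by rewrite acosK ?in_itv// sin_acos// sqrt_sin_acos_arg//; ring.
Qed.

Lemma sin_leaf_angle h t : (t * h) ^+ 2 <= 1 ->
  sin (leaf_angle al e h t) =
  (al * Num.sqrt (1 - (t * h) ^+ 2) * cos (angle_shift al e h t)
   + h * Num.sqrt (1 + al ^+ 2 * t ^+ 2) * sin (angle_shift al e h t))
  / Num.sqrt (h ^+ 2 + al ^+ 2).
Proof.
move=> th; rewrite /leaf_angle sinD.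
have X := acos_arg_le1 al_gt0 th.
by rewrite acosK ?in_itv// sin_acos// sqrt_sin_acos_arg//; ring.
Qed.

Lemma cts_angle_shift (T : topologicalType) (x : T) (f g : T -> R) :
  continuous_at x f -> continuous_at x g ->
  continuous_at x (fun y => angle_shift al e (f y) (g y)).
Proof.
move=> cf cg; rewrite /angle_shift.
have N0 := lt0r_neq0 (sqrt1D_gt0 (f x)).
apply: ctsM; first by cts.
apply: cts_artanh; first exact: modulus_tilt_itv.
apply: ctsM; first by cts.
by rewrite /tilt; cts; apply: lt0r_neq0; exact: sqrt_1Dal2t2_gt0.
Qed.

Lemma cts_leaf_angle (T : topologicalType) (x : T) (f g : T -> R) :
  continuous_at x f -> continuous_at x g -> (g x * f x) ^+ 2 < 1 ->
  continuous_at x (fun y => leaf_angle al e (f y) (g y)).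
Proof.
move=> cf cg gf; rewrite /leaf_angle; apply: ctsD; last exact: cts_angle_shift.
apply: cts_acos; first exact: acos_arg_lt1.
by cts; apply: lt0r_neq0; exact: sqrt_sqrDal2_gt0.
Qed.

(** The link between the height integral and [leaf_angle]. The absolute value appears because the
    sign of cos s only selects one of the sheets +- beta. *)
Lemma profile_leaf_angle h s : 0 < h ->
  al * leaf_angle al e h (sin s / h) =
  profile al e h (`|cos s| / Num.sqrt (h ^+ 2 + al ^+ 2 * sin s ^+ 2)).
Proof.
move=> h0; have h2 : 0 < h ^+ 2 by exact: exprn_gt0.
have a2 : 0 < al ^+ 2 by exact: exprn_gt0.
have q0 := sqrt_ellipse_gt0 al s h0.
have q2 : Num.sqrt (h ^+ 2 + al ^+ 2 * sin s ^+ 2) ^+ 2 =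
    h ^+ 2 + al ^+ 2 * sin s ^+ 2.
  by rewrite sqr_sqrtr// ltW//; rewrite -sqrtr_gt0.
set q := Num.sqrt (_ + _ * _) in q0 q2 *.
have r0 := sqrt_sqrDal2_gt0 al_gt0 h; have r2 := sqr_sqrt_sqrDal2 al_gt0 h.
have pE : Num.sqrt (1 + al ^+ 2 * (sin s / h) ^+ 2) = q / h.
  rewrite -[RHS]ger0_norm; last by rewrite divr_ge0 ?ltW.
  rewrite -sqrtr_sqr; congr Num.sqrt.
  by field: q2; rewrite gt_eqF.
have cE : Num.sqrt (1 - (sin s / h * h) ^+ 2) = `|cos s|.
  by rewrite divfK ?gt_eqF// -cos2sin2 sqrtr_sqr.
rewrite /leaf_angle /angle_shift /tilt pE cE /profile mulrDr; congr (_ + _).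
  congr (_ * _); rewrite -acos_Vsqrt1D; last first.
    by rewrite !mulr_ge0 ?invr_ge0// ltW.
  congr acos; set r := Num.sqrt (_ + al ^+ 2) in r0 r2 *.
  suff -> : Num.sqrt (1 + (al * (`|cos s| / q)) ^+ 2) = r / q.
    by field; rewrite !gt_eqF.
  rewrite -[RHS]ger0_norm; last by rewrite divr_ge0 ?ltW.
  rewrite -[RHS]sqrtr_sqr; congr Num.sqrt.
  rewrite !(expr_div_n, exprMn) real_normK ?num_real// cos2sin2 r2.
  by field: q2; rewrite gt_eqF.
have N0 := sqrt1D_gt0 h.
have -> : e / Num.sqrt (1 + h ^+ 2) * (`|cos s| / (q / h)) =
          h * e / Num.sqrt (1 + h ^+ 2) * (`|cos s| / q).
  by field; rewrite !gt_eqF.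
by move: (artanh _) => A; field; rewrite !gt_eqF.
Qed.

Lemma acos_arg_top h : 0 < h ->
  acos (h * Num.sqrt (1 + al ^+ 2 * 0 ^+ 2) / Num.sqrt (h ^+ 2 + al ^+ 2)) =
  atan (al / h).
Proof.
move=> h0; rewrite -acos_Vsqrt1D; last by rewrite divr_ge0 ?ltW.
congr acos; rewrite expr0n/= mulr0 addr0 sqrtr1 mulr1.
have r0 := sqrt_sqrDal2_gt0 al_gt0 h; have r2 := sqr_sqrt_sqrDal2 al_gt0 h.
set r := Num.sqrt _ in r0 r2 *.
have -> : Num.sqrt (1 + (al / h) ^+ 2) = r / h.
  rewrite -[RHS]ger0_norm; last by rewrite divr_ge0 ?ltW.
  by rewrite -sqrtr_sqr; congr Num.sqrt; field: r2; rewrite gt_eqF.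
by rewrite invf_div.
Qed.

Lemma artanh_le (x : R) : 0 <= x < 1 -> artanh x <= x / (1 - x).
Proof.
move=> x1; have p : 0 < (1 + x) / (1 - x) by rewrite divr_gt0; lra.
rewrite /artanh ler_pdivrMr// (le_trans (ln_le_subr1 p))//.
by rewrite le_eqVlt; apply/orP; left; apply/eqP; field; lra.
Qed.

(** No leaf has an edge on the equator, so small values of beta must come from large h. The constant
    collects atan x < x and artanh x <= x / (1 - x) <= x / (1 - e) for x <= e. *)
Lemma leaf_angle_top_le h : 0 < h ->
  leaf_angle al e h 0 <= (al + e / (al * (1 - e))) / h.
Proof.
move=> h0; rewrite /leaf_angle acos_arg_top//.
have e1 : e < 1.
  by have := al_e; have := e_gt0; have := exprn_gt0 2 al_gt0; nra.
have N0 := sqrt1D_gt0 h; have N2 := sqr_sqrt1D h.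
have hN : h < Num.sqrt (1 + h ^+ 2).
  by rewrite -ltr_sqr ?nnegrE ?ltW//; lra.
rewrite mulrDl; apply: lerD.
  by apply: ltW; apply: atan_lt; rewrite divr_gt0.
rewrite /angle_shift; set N := Num.sqrt _ in N0 N2 hN *.
have -> : e / N * tilt al h 0 = e / N.
  by rewrite /tilt mul0r expr0n/= subr0 mulr0 addr0 sqrtr1 divr1 mulr1.
have g0 : 0 < e / N by rewrite divr_gt0.
have g1 : e / N <= e.
  by rewrite ler_pdivrMr// ler_peMr ?(ltW e_gt0)//; nra.
have A : artanh (e / N) <= e / N / (1 - e).
  apply: le_trans (artanh_le _) _; first lra.
  by rewrite ler_pM2l// lef_pV2 ?posrE; lra.
have k0 : 0 < h * e / N / al by rewrite !divr_gt0// mulr_gt0.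
apply: le_trans (ler_wpM2l (ltW k0) A) _.
have -> : h * e / N / al * (e / N / (1 - e)) =
    (e / (al * (1 - e)) / h) * (e * (h / N) ^+ 2).
  by field; rewrite !gt_eqF//; lra.
rewrite ger_pMr; last by rewrite !divr_gt0// mulr_gt0//; lra.
have hN1 : h / N < 1 by rewrite ltr_pdivrMr ?mul1r.
have hN0 : 0 < h / N by rewrite divr_gt0.
have : (h / N) ^+ 2 < 1 by nra.
by have := sqr_ge0 (h / N); have := e_gt0; nra.
Qed.

Hypothesis e_artanh : e * artanh e <= 1.

(** The second condition excludes the limit geodesics, which lie over the equator at the angles 0
    and pi. By the symmetry h -> - h it is enough to reach c >= 0, between h = 0, where the cosine
    is 0, and a label M where it is at least c. *)
Lemma leaf_angle_onto t c : -1 <= c <= 1 -> t != 0 \/ -1 < c < 1 ->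
  exists2 h, (t * h) ^+ 2 <= 1 & cos (leaf_angle al e h t) = c.
Proof.
wlog c0 : c / 0 <= c => [H c1 tc|].
  have [/H|c0] := leP 0 c; first exact.
  have c0' : 0 <= - c by lra.
  have c1' : -1 <= - c <= 1 by lra.
  have tc' : t != 0 \/ -1 < - c < 1 by case: tc => ?; [left|right; lra].
  have [h th hc] := H _ c0' c1' tc'.
  exists (- h); first by rewrite mulrN sqrrN.
  by rewrite leaf_angleN// addrC cosDpi cosN hc opprK.
move=> c1 tc.
pose f x := (x * Num.sqrt (1 + al ^+ 2 * t ^+ 2) * cos (angle_shift al e x t)
   - al * Num.sqrt (1 - (t * x) ^+ 2) * sin (angle_shift al e x t))
  / Num.sqrt (x ^+ 2 + al ^+ 2).
have [M [M0 tM cM]] :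
    exists M, [/\ 0 < M, (t * M) ^+ 2 <= 1 & c <= cos (leaf_angle al e M t)].
  have [t0|t0] := eqVneq t 0.
    have c2 : -1 <= c < 1 by case: tc; [rewrite t0 eqxx|lra].
    have h1 := acos_gt0 c2.
    have e1 : e < 1.
      by have := al_e; have := e_gt0; have := exprn_gt0 2 al_gt0; nra.
    pose K := al + e / (al * (1 - e)).
    have K0 : 0 < K by rewrite addr_gt0// divr_gt0// mulr_gt0//; lra.
    (* At this label the bound of [leaf_angle_top_le] is exactly acos c. *)
    exists (K / acos c); rewrite t0 mul0r expr0n/= ler01 divr_gt0//; split=> //.
    rewrite -{1}(acosK (x := c)) ?in_itv//.
    have th : (0 * (K / acos c)) ^+ 2 <= 1 by rewrite mul0r expr0n/= ler01.
    have h3 := leaf_angle_itv al_gt0 e_gt0 al_e e_artanh th.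
    have h4 : 0 <= acos c <= pi by rewrite acos_ge0 ?acos_lepi.
    rewrite leNgt; apply/negP; rewrite ltr_cos ?in_itv//= => h2.
    have := @leaf_angle_top_le (K / acos c).
    rewrite divr_gt0// => /(_ isT).
    have -> : (al + e / (al * (1 - e))) / (K / acos c) = acos c.
      by rewrite -/K; field; rewrite !gt_eqF.
    by rewrite leNgt h2.
  (* Off the equator the label whose edge has slope t will do: its angle is 0 and the cosine is
     1. *)
  exists `|t|^-1; rewrite invr_gt0 normr_gt0 t0.
  have th : (t * `|t|^-1) ^+ 2 = 1.
    by rewrite exprMn exprVn real_normK ?num_real// divff// expf_neq0.
  rewrite th leaf_angle_edge ?cos0 ?invr_gt0 ?normr_gt0//; split=> //; lra.
have thx x : 0 <= x <= M -> (t * x) ^+ 2 <= 1.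
  move=> /andP[x0 xM]; apply: le_trans tM; rewrite !exprMn ler_wpM2l ?sqr_ge0//.
  by rewrite ler_sqr ?nnegrE// ltW.
have cf : {within `[0, M], continuous f}.
  apply: continuous_in_subspaceT => x _; apply: ctsM; last first.
    by cts; apply: lt0r_neq0; exact: sqrt_sqrDal2_gt0.
  apply: ctsD; [apply: ctsM; [by cts|]|apply: ctsN; apply: ctsM; [by cts|]].
    by apply: cts_cos; apply: cts_angle_shift; [exact: cts_id|exact: cts_cst].
  by apply: cts_sin; apply: cts_angle_shift; [exact: cts_id|exact: cts_cst].
have fE x : 0 <= x <= M -> f x = cos (leaf_angle al e x t).
  by move=> /thx tx; rewrite cos_leaf_angle.
have f0 : f 0 = 0 by rewrite fE ?leaf_angle0 ?cos_pihalf// lexx ltW.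
have fM : f M = cos (leaf_angle al e M t) by rewrite fE// lexx ltW.
have [|x] := IVT (f := f) (v := c) (ltW M0) cf.
  by rewrite f0 fM ge_min le_max c0 cM orbT.
rewrite in_itv/= => xM <-; exists x; [exact: thx|by rewrite fE].
Qed.

End LeafAngleCovering.

(** * Oriented integrals and screw surfaces *)

Section PairDerivative.
Variables (R : realType) (V W : normedModType R).

Lemma der_pair (x : R) (f : R -> V) (g : R -> W) (df : V) (dg : W) :
  is_derive x (1 : R) f df -> is_derive x (1 : R) g dg ->
  is_derive x (1 : R) (fun y => (f y, g y)) (df, dg).
Proof.
move=> [hf hdf] [hg hdg].
have cf : (h^-1 *: ((f \o shift x) (h *: 1) - f x)) @[h --> 0^'] --> df.
  by rewrite -hdf; exact: hf.
have cg : (h^-1 *: ((g \o shift x) (h *: 1) - g x)) @[h --> 0^'] --> dg.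
  by rewrite -hdg; exact: hg.
have c : (h^-1 *: (((fun y => (f y, g y)) \o shift x) (h *: 1) -
          (f x, g x) : V * W)) @[h --> 0^'] --> (df, dg).
  exact: (cvg_pair cf cg).
split; last by apply/cvg_lim => //; exact: norm_hausdorff.
by apply/cvg_ex; exists (df, dg).
Qed.

Lemma is_derive1_derivable (x : R) (f : R -> V) (df : V) :
  is_derive x (1 : R) f df -> derivable f x 1.
Proof. by case. Qed.

Lemma is_derive1_val (x : R) (f : R -> V) (df : V) :
  is_derive x (1 : R) f df -> derive1 f x = df.
Proof. by move=> h; rewrite derive1E derive_val. Qed.

End PairDerivative.

Section OrientedIntegral.
Variable R : realType.

Lemma Rintegral_derive (F f : R -> R) (a b : R) : a <= b ->
  (forall x, is_derive x (1 : R) F (f x)) -> continuous f ->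
  Rintegral lebesgue_measure `[a, b] f = F b - F a.
Proof.
rewrite le_eqVlt => /predU1P[-> _ _|ab hF cf].
  by rewrite set_itv1 Rintegral_set1 subrr.
have cF x : {for x, continuous F} by exact: is_derive1_continuous (hF x).
rewrite /Rintegral (continuous_FTC2 (F := F) ab).
- by rewrite -EFinB.
- exact: continuous_subspaceT.
- split=> [x _||]; first exact: is_derive1_derivable (hF x).
    by apply: cvg_at_right_filter; exact: cF.
  by apply: cvg_at_left_filter; exact: cF.
- by move=> x _; exact: is_derive1_val (hF x).
Qed.

Lemma oriented_integral_derive (F f : R -> R) (a b : R) :
  (forall x, is_derive x (1 : R) F (f x)) -> continuous f ->
  oriented_integral f a b = F b - F a.
Proof.
move=> hF cf; rewrite /oriented_integral; case: leP => [ab|/ltW ba].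
  exact: Rintegral_derive.
by rewrite (Rintegral_derive ba hF cf) opprB.
Qed.

End OrientedIntegral.

(** The surface swept by the screw motions from a profile curve: P is the signed distance to the
    axis of the sphere, Q the altitude on the sphere and E the height. *)
Definition screw {R : realType} (a : R) (P Q E : R -> R) : surface R :=
  fun u v => ((P u * cos v, P u * sin v, Q u), E u + a * v).

Section Screw.
Variables (R : realType) (a : R) (P Q E P' Q' E' : R -> R).
Hypotheses (hP : forall u, is_derive u (1 : R) P (P' u))
           (hQ : forall u, is_derive u (1 : R) Q (Q' u))
           (hE : forall u, is_derive u (1 : R) E (E' u)).

Lemma screw_du u v : is_derive u (1 : R) (fun x => screw a P Q E x v)
  ((P' u * cos v, P' u * sin v, Q' u), E' u).
Proof.
have hm (c : R) : is_derive u (1 : R) (fun x => P x * c) (P' u * c).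
  by have := derM (hP u) (der_cst u c); rewrite mulr0 addr0.
have hD : is_derive u (1 : R) (fun x => E x + a * v) (E' u).
  by have := derD (hE u) (der_cst u (a * v)); rewrite addr0.
exact: der_pair (der_pair (der_pair (hm _) (hm _)) (hQ u)) hD.
Qed.

Lemma screw_dv u v : is_derive v (1 : R) (fun y => screw a P Q E u y)
  ((- (P u * sin v), P u * cos v, 0), a).
Proof.
have h1 : is_derive v (1 : R) (fun y => P u * cos y) (- (P u * sin v)).
  have := derM (der_cst v (P u)) (is_derive_cos v).
  by rewrite mul0r add0r mulrN.
have h2 : is_derive v (1 : R) (fun y => P u * sin y) (P u * cos v).
  by have := derM (der_cst v (P u)) (is_derive_sin v); rewrite mul0r add0r.
have h3 : is_derive v (1 : R) (fun y => E u + a * y) a.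
  have := derD (der_cst v (E u)) (derM (der_cst v a) (der_id v)).
  by rewrite mul0r !add0r mulr1.
exact: der_pair (der_pair (der_pair h1 h2) (der_cst v (Q u))) h3.
Qed.

Let cP u : continuous_at u P. Proof. exact: is_derive1_continuous (hP u). Qed.
Let cQ u : continuous_at u Q. Proof. exact: is_derive1_continuous (hQ u). Qed.
Let cE u : continuous_at u E. Proof. exact: is_derive1_continuous (hE u). Qed.

Let comp1 (f : R -> R) (w : R * R) :
  (forall u, continuous_at u f) -> continuous_at w (fun w => f w.1).
Proof. by move=> cf; apply: cts_comp; [exact: cf|exact: cvg_fst]. Qed.

Let comp2 (f : R -> R) (w : R * R) :
  (forall u, continuous_at u f) -> continuous_at w (fun w => f w.2).
Proof. by move=> cf; apply: cts_comp; [exact: cf|exact: cvg_snd]. Qed.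

Let c1 (w : R * R) : continuous_at w (fun w => cos w.2).
Proof. by apply: comp2; exact: continuous_cos. Qed.

Let c2 (w : R * R) : continuous_at w (fun w => sin w.2).
Proof. by apply: comp2; exact: continuous_sin. Qed.

Lemma continuous_screw : continuous (fun w : R * R => screw a P Q E w.1 w.2).
Proof.
move=> w.
have cs : continuous_at w (fun w : R * R => w.2) by exact: cvg_snd.
exact: (cts_pair (cts_pair (cts_pair (ctsM (@comp1 P w cP) (@c1 w))
  (ctsM (@comp1 P w cP) (@c2 w))) (@comp1 Q w cQ))
  (ctsD (@comp1 E w cE) (ctsM (@cts_cst _ _ w a) cs))).
Qed.

Hypotheses (cP' : continuous P') (cQ' : continuous Q') (cE' : continuous E').

(** In the frame rotated by v, the vector c du + d dv has the components c P', d P, c Q' and c E' +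
    d a. *)
Lemma immersion_screw :
  (forall u c d, c * P' u = 0 -> d * P u = 0 -> c * Q' u = 0 ->
     c * E' u + d * a = 0 -> c = 0 /\ d = 0) ->
  immersion (screw a P Q E).
Proof.
move=> H; split.
- by move=> u v; split; apply: is_derive1_derivable;
    [exact: screw_du|exact: screw_dv].
- have -> : (fun w : R * R => du (screw a P Q E) w.1 w.2) = (fun w : R * R =>
      ((P' w.1 * cos w.2, P' w.1 * sin w.2, Q' w.1), E' w.1)).
    by apply/funext => w; rewrite /du (is_derive1_val (screw_du _ _)).
  move=> w; exact: (cts_pair (cts_pair (cts_pair (ctsM (@comp1 P' w cP') (@c1 w))
    (ctsM (@comp1 P' w cP') (@c2 w))) (@comp1 Q' w cQ')) (@comp1 E' w cE')).
- have -> : (fun w : R * R => dv (screw a P Q E) w.1 w.2) = (fun w : R * R =>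
      ((- (P w.1 * sin w.2), P w.1 * cos w.2, 0), a)).
    by apply/funext => w; rewrite /dv (is_derive1_val (screw_dv _ _)).
  move=> w; exact: (cts_pair (cts_pair (cts_pair
    (ctsN (ctsM (@comp1 P w cP) (@c2 w))) (ctsM (@comp1 P w cP) (@c1 w)))
    (@cts_cst _ _ w 0)) (@cts_cst _ _ w a)).
- move=> u v c d; rewrite /du /dv (is_derive1_val (screw_du _ _)).
  rewrite (is_derive1_val (screw_dv _ _)) => -[e1 e2 e3 e4].
  have cs := cos2Dsin2 v.
  have e1' : c * (P' u * cos v) + d * - (P u * sin v) = 0 by exact: e1.
  have e2' : c * (P' u * sin v) + d * (P u * cos v) = 0 by exact: e2.
  have e3' : c * Q' u + d * 0 = 0 by exact: e3.
  have e4' : c * E' u + d * a = 0 by exact: e4.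
  apply: (H u) => //; last by rewrite -e3' mulr0 addr0.
  + rewrite -[LHS]mulr1 -cs.
    transitivity ((c * (P' u * cos v) + d * - (P u * sin v)) * cos v +
       (c * (P' u * sin v) + d * (P u * cos v)) * sin v); first by ring.
    by rewrite e1' e2' !mul0r addr0.
  + rewrite -[LHS]mulr1 -cs.
    transitivity (- (c * (P' u * cos v) + d * - (P u * sin v)) * sin v +
       (c * (P' u * sin v) + d * (P u * cos v)) * cos v); first by ring.
    by rewrite e1' e2' oppr0 !mul0r addr0.
Qed.

End Screw.

Section ScrewReverse.
Variables (R : realType) (a c0 : R) (P Q E P' Q' E' : R -> R).

Lemma reverse_translate_screw :
  reverse (translate c0 (screw a P Q E)) =
  screw a (fun u => P (- u)) (fun u => Q (- u)) (fun u => E (- u) + c0).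
Proof.
apply/funext => u; apply/funext => v.
by rewrite /reverse /translate /screw /= addrAC.
Qed.

Hypotheses (hP : forall u, is_derive u (1 : R) P (P' u))
           (hQ : forall u, is_derive u (1 : R) Q (Q' u))
           (hE : forall u, is_derive u (1 : R) E (E' u)).

Let derN_arg (f f' : R -> R) : (forall u, is_derive u (1 : R) f (f' u)) ->
  forall u, is_derive u (1 : R) (fun u => f (- u)) (- f' (- u)).
Proof.
by move=> hf u; have := der_comp (hf (- u)) (derN (der_id u)); rewrite mulrN1.
Qed.

Let hP' := derN_arg hP.
Let hQ' := derN_arg hQ.
Let hE' u : is_derive u (1 : R) (fun u => E (- u) + c0) (- E' (- u)).
Proof. by have := derD (derN_arg hE u) (der_cst u c0); rewrite addr0. Qed.

Lemma continuous_reverse_translate_screw :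
  continuous (fun w : R * R => reverse (translate c0 (screw a P Q E)) w.1 w.2).
Proof. by rewrite reverse_translate_screw;
  exact: (continuous_screw (@hP') (@hQ') (@hE')). Qed.

Lemma immersion_reverse_translate_screw :
  continuous P' -> continuous Q' -> continuous E' ->
  (forall u c d, c * P' u = 0 -> d * P u = 0 -> c * Q' u = 0 ->
     c * E' u + d * a = 0 -> c = 0 /\ d = 0) ->
  immersion (reverse (translate c0 (screw a P Q E))).
Proof.
move=> cP cQ cE H; rewrite reverse_translate_screw.
have cN (f : R -> R) : continuous f -> continuous (fun u => - f (- u)).
  by move=> cf u; apply: ctsN; apply: (cts_comp (h := f)); [exact: cf|cts].
apply: (immersion_screw (@hP') (@hQ') (@hE') (cN _ cP) (cN _ cQ) (cN _ cE)).
move=> u c d h1 h2 h3 h4; have [c0' d0] : - c = 0 /\ d = 0.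
  by apply: (H (- u)) => //; rewrite mulNr -mulrN.
by split=> //; rewrite -[c]opprK c0' oppr0.
Qed.

End ScrewReverse.

(** * Explicit formulas for the tubes *)

Section TubeFormulas.
Variables (R : realType) (kappa a : R).
Hypothesis kappa_gt0 : 0 < kappa.

Definition slant : R := Num.sqrt (1 + a ^+ 2 * kappa).
Definition ecc : R := slant^-1.
(** The absolute value makes al nonnegative for either sign of the pitch; the sign of a returns in
    [tube_height_angle]. *)
Definition coecc : R := `|a| * Num.sqrt kappa / slant.

Local Notation k := (Num.sqrt kappa).
Local Notation al := coecc.
Local Notation e := ecc.

Lemma sqrt_kappa_gt0 : 0 < k. Proof. by rewrite sqrtr_gt0 kappa_gt0. Qed.

Lemma sqr_sqrt_kappa : k ^+ 2 = kappa. Proof.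
by rewrite sqr_sqrtr// ltW ?kappa_gt0. Qed.

Let slant_arg_gt0 : 0 < 1 + a ^+ 2 * kappa.
Proof. by have := mulr_ge0 (sqr_ge0 a) (ltW kappa_gt0); lra. Qed.

Lemma slant_gt0 : 0 < slant. Proof. by rewrite sqrtr_gt0. Qed.

Lemma slant2E : slant ^+ 2 = 1 + a ^+ 2 * kappa.
Proof. by rewrite sqr_sqrtr// ltW. Qed.

Lemma ecc_gt0 : 0 < e. Proof. by rewrite invr_gt0 slant_gt0. Qed.

Lemma coecc2_ecc2 : al ^+ 2 + e ^+ 2 = 1 :> R.
Proof.
have D0 := slant_gt0; have D2 := slant2E.
rewrite /coecc /ecc !(exprMn, exprVn) real_normK ?num_real// sqr_sqrt_kappa D2.
by field; have := slant_arg_gt0; lra.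
Qed.

Lemma slant_coecc : slant / k * al = `|a|.
Proof.
by rewrite /coecc; field; rewrite !gt_eqF ?slant_gt0 ?sqrt_kappa_gt0.
Qed.

(* From here on, the tube of curvature H is labelled by h = 2 H / sqrt kappa;
   its radius is given by cot (sqrt kappa r) = - sin s / h. *)
Definition tube_norm (h s : R) : R := Num.sqrt (h ^+ 2 + sin s ^+ 2).

Lemma tube_norm_gt0 (h s : R) : 0 < h -> 0 < tube_norm h s.
Proof.
by move=> h0; rewrite sqrtr_gt0 ltr_wpDr ?sqr_ge0// exprn_gt0.
Qed.

Lemma tube_norm2 (h s : R) : 0 < h -> tube_norm h s ^+ 2 = h ^+ 2 + sin s ^+ 2.
Proof. by move=> h0; rewrite sqr_sqrtr// addr_ge0 ?sqr_ge0. Qed.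

(** The defining equation reduces to h cos (k r) + sin (k r) sin s = 0 with k = sqrt kappa, which
    together with sin (k r) > 0 determines a point of the unit circle. This gives the existence that
    [get] requires as well as the values. *)
Lemma tube_radiusP (H s : R) : 0 < H ->
  sn kappa (tube_radius kappa H s) = 2 * H / k / (k * tube_norm (2 * H / k) s) /\
  cs kappa (tube_radius kappa H s) = - sin s / tube_norm (2 * H / k) s.
Proof.
move=> H0; have k0 := sqrt_kappa_gt0; have k2 := sqr_sqrt_kappa.
set h := 2 * H / k.
have h0 : 0 < h by rewrite divr_gt0// mulr_gt0.
have r0 := tube_norm_gt0 s h0; have r2 := tube_norm2 s h0.
set r := tube_norm h s in r0 r2 *.
have eqE (x : R) : (2 * H / kappa * (cs kappa x - 1) + sn kappa x * sin s =
    - (2 * H / kappa)) <-> h * cos (k * x) + sin (k * x) * sin s = 0.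
  have -> : 2 * H / kappa = h / k by rewrite /h -[X in _ / X]k2; field;
    rewrite gt_eqF.
  rewrite /cs /sn; split=> E.
    have -> : h * cos (k * x) + sin (k * x) * sin s = k * (h / k *
       (cos (k * x) - 1) + sin (k * x) / k * sin s + h / k).
      by field; rewrite gt_eqF.
    by rewrite E addNr mulr0.
  have -> : h / k * (cos (k * x) - 1) + sin (k * x) / k * sin s =
     (h * cos (k * x) + sin (k * x) * sin s) / k - h / k.
    by field; rewrite gt_eqF.
  by rewrite E mul0r add0r.
have [] : [set x : R | 0 < x < pi / k /\
    2 * H / kappa * (cs kappa x - 1) + sn kappa x * sin s =
    - (2 * H / kappa)] (tube_radius kappa H s).
  apply: getPex; have s1 : (- sin s / r) ^+ 2 < 1.
    rewrite expr_div_n sqrrN r2 ltr_pdivrMr ?mul1r; last first.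
      by rewrite -r2 exprn_gt0.
    by rewrite ltrDr exprn_gt0.
  have s1' := sqr_lt1 s1.
  have s1'' : -1 <= - sin s / r <= 1 by case/andP: s1' => /ltW -> /ltW ->.
  exists (acos (- sin s / r) / k) => /=; split.
    rewrite divr_gt0 ?ltr_pM2r ?invr_gt0// ?acos_gt0 ?acos_ltpi//.
      by case/andP: s1' => -> /ltW ->.
    by case/andP: s1' => /ltW -> ->.
  have kx : k * (acos (- sin s / r) / k) = acos (- sin s / r).
    by rewrite mulrC divfK ?gt_eqF.
  apply/eqE; rewrite kx acosK ?in_itv// sin_acos//.
  have -> : 1 - (- sin s / r) ^+ 2 = (h / r) ^+ 2.
    by field: r2; rewrite gt_eqF.
  have hr0 : 0 < h / r by rewrite (divr_gt0 h0 r0).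
  rewrite sqrtr_sqr (gtr0_norm hr0).
  by field; rewrite gt_eqF.
set x := tube_radius kappa H s => /andP[x0 xpi] /(eqE x).1 E.
have sx : 0 < sin (k * x).
  by rewrite sin_gt0_pi// mulr_gt0//= -ltr_pdivlMl// mulrC.
have cs2 := cos2Dsin2 (k * x).
have c : cos (k * x) = - (sin (k * x) * sin s) / h.
  by rewrite -[LHS](mulKf (lt0r_neq0 h0));
    rewrite (_ : h * _ = - (sin (k * x) * sin s)); [rewrite mulrC|lra].
have e2 : (sin (k * x)) ^+ 2 = (h / r) ^+ 2.
  have e3 : sin (k * x) ^+ 2 * r ^+ 2 = h ^+ 2.
    rewrite r2; move: cs2; rewrite c => cs2.
    rewrite -[RHS]mulr1 -cs2; field; rewrite gt_eqF//.
  by rewrite expr_div_n -e3 mulfK// expf_neq0// gt_eqF.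
have sE : sin (k * x) = h / r.
  by apply/eqP; rewrite -(eqrXn2 (n := 2)) ?e2 ?(ltW sx)// ltW// (divr_gt0 h0 r0).
split; rewrite /sn /cs; first by rewrite sE; field; rewrite !gt_eqF.
by rewrite c sE; field; rewrite !gt_eqF.
Qed.

Definition tube_profile_radius (h s : R) : R := h / (k * tube_norm h s).
Definition tube_profile_alt (h s : R) : R := - sin s / (k * tube_norm h s).
Definition tube_profile_height (h s : R) : R :=
  - (slant / k) *
  profile al e h (cos s / Num.sqrt (h ^+ 2 + al ^+ 2 * sin s ^+ 2)).

Definition tube_height_rate (h s : R) : R := slant / k *
  (Num.sqrt (h ^+ 2 + al ^+ 2 * sin s ^+ 2) / (h ^+ 2 + sin s ^+ 2) * sin s).

Lemma derive_tube_height (h s : R) : 0 < h ->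
  is_derive s (1 : R) (tube_profile_height h) (tube_height_rate h s).
Proof.
move=> h0.
have := derM (der_cst s (- (slant / k)))
  (derive_profile_section coecc2_ecc2 s h0).
by rewrite mul0r add0r mulrNN.
Qed.

Lemma continuous_tube_height_rate (h : R) : 0 < h ->
  continuous (tube_height_rate h).
Proof.
move=> h0 s; rewrite /tube_height_rate -/(continuous_at _ _); cts.
by rewrite gt_eqF// ltr_wpDr ?sqr_ge0// exprn_gt0.
Qed.

Lemma tube_heightE (H : R) : 0 < H ->
  tube_height kappa a H = tube_profile_height (2 * H / k).
Proof.
move=> H0; apply/funext => s; rewrite /tube_height.
have k0 := sqrt_kappa_gt0; have k2 := sqr_sqrt_kappa; have D0 := slant_gt0;
  have D2 := slant2E.
set h := 2 * H / k.
have h0 : 0 < h by rewrite divr_gt0// mulr_gt0.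
have -> : (fun u => Num.sqrt (sn kappa (tube_radius kappa H u) ^+ 2 + a ^+ 2) /
    (2 * H * sn kappa (tube_radius kappa H u) -
     cs kappa (tube_radius kappa H u) * sin u) * sin u) = tube_height_rate h.
  apply/funext => u; have [-> ->] := tube_radiusP u H0; rewrite -/h.
  have r0 := tube_norm_gt0 u h0; have r2 := tube_norm2 u h0.
  set r := tube_norm h u in r0 r2 *.
  have -> : 2 * H = h * k by rewrite /h divfK// gt_eqF.
  have q0 := sqrt_ellipse_gt0 al u h0.
  have q2 : Num.sqrt (h ^+ 2 + al ^+ 2 * sin u ^+ 2) ^+ 2 =
      h ^+ 2 + al ^+ 2 * sin u ^+ 2.
    by rewrite sqr_sqrtr// ltW// -sqrtr_gt0.
  have -> : (h / (k * r)) ^+ 2 + a ^+ 2 =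
     (slant / (k * r) * Num.sqrt (h ^+ 2 + al ^+ 2 * sin u ^+ 2)) ^+ 2.
    have a2 : `|a| ^+ 2 = a ^+ 2 by rewrite real_normK ?num_real.
    rewrite [RHS]exprMn q2 /coecc.
    by field: r2 D2 k2 a2; rewrite !gt_eqF.
  rewrite sqrtr_sqr ger0_norm; last by rewrite mulr_ge0 ?divr_ge0 ?mulr_ge0 ?ltW.
  rewrite /tube_height_rate -r2.
  (* The denominator of the height integrand is just [tube_norm], so it never vanishes. *)
  have -> : h * k * (h / (k * r)) - - sin u / r * sin u = r.
    by field: r2; rewrite !gt_eqF.
  by field; rewrite !gt_eqF.
have hF x : is_derive x (1 : R) (tube_profile_height h) (tube_height_rate h x).
  exact: derive_tube_height.
rewrite (oriented_integral_derive _ _ hF (continuous_tube_height_rate h0)).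
(* The primitive is 0 at the base point pi / 2 of the integral, where the cosine vanishes. *)
rewrite [X in _ - X](_ : _ = 0) ?subr0// /tube_profile_height cos_pihalf mul0r.
by rewrite /profile !mulr0 atan0 artanh0 !mulr0 addr0 mulr0.
Qed.

Lemma tubeE (H : R) : 0 < H ->
  tube kappa a H = screw a (tube_profile_radius (2 * H / k))
    (tube_profile_alt (2 * H / k)) (tube_profile_height (2 * H / k)).
Proof.
move=> H0; apply/funext => s; apply/funext => t.
rewrite /tube /cyl tube_heightE//; have [-> ->] := tube_radiusP s H0.
rewrite /screw /tube_profile_radius /tube_profile_alt.
by rewrite -[_ / _ / k]mulrA -invfM [_ * k]mulrC.
Qed.

Definition tube_radius_rate (h s : R) : R :=
  - (h * sin s * cos s) / (k * tube_norm h s ^+ 3).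
Definition tube_alt_rate (h s : R) : R :=
  - (h ^+ 2 * cos s) / (k * tube_norm h s ^+ 3).

Lemma derive_tube_radius (h s : R) : 0 < h ->
  is_derive s (1 : R) (tube_profile_radius h) (tube_radius_rate h s).
Proof.
move=> h0; have k0 := sqrt_kappa_gt0; have r0 := tube_norm_gt0 s h0.
have r2 := tube_norm2 s h0.
rewrite /tube_profile_radius /tube_radius_rate /tube_norm; eapply is_derive_eq.
  der; rewrite -/(tube_norm h s) ?gt_eqF ?mulr_gt0//.
  by rewrite -r2 exprn_gt0.
cbv beta; rewrite -/(tube_norm h s); move: (tube_norm h s) r0 r2 => r r0 r2.
by field: r2; rewrite !gt_eqF.
Qed.

Lemma derive_tube_alt (h s : R) : 0 < h ->
  is_derive s (1 : R) (tube_profile_alt h) (tube_alt_rate h s).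
Proof.
move=> h0; have k0 := sqrt_kappa_gt0; have r0 := tube_norm_gt0 s h0.
have r2 := tube_norm2 s h0.
rewrite /tube_profile_alt /tube_alt_rate /tube_norm; eapply is_derive_eq.
  der; rewrite -/(tube_norm h s) ?gt_eqF ?mulr_gt0//.
  by rewrite -r2 exprn_gt0.
cbv beta; rewrite -/(tube_norm h s); move: (tube_norm h s) r0 r2 => r r0 r2.
have c2 := cos2Dsin2 s.
by field: r2; rewrite !gt_eqF.
Qed.

Lemma continuous_tube_rates (h : R) : 0 < h ->
  continuous (tube_radius_rate h) /\ continuous (tube_alt_rate h).
Proof.
move=> h0; have k0 := sqrt_kappa_gt0.
have cr (s : R) : continuous_at s (fun s => k * tube_norm h s ^+ 3).
  by rewrite /tube_norm; cts.
have r3 (s : R) : k * tube_norm h s ^+ 3 != 0.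
  by rewrite mulf_neq0 ?expf_neq0// gt_eqF ?tube_norm_gt0.
by split=> s; apply: ctsM; [cts|apply: ctsV|cts|apply: ctsV].
Qed.

(** The radius is positive, which forces d = 0; the height rate vanishes only with sin u and the
    altitude rate only with cos u, so not both at once. *)
Lemma tube_rates_nondegenerate (h u c d : R) : 0 < h ->
  d * tube_profile_radius h u = 0 -> c * tube_alt_rate h u = 0 ->
  c * tube_height_rate h u + d * a = 0 -> c = 0 /\ d = 0.
Proof.
move=> h0 dP cQ cE; have k0 := sqrt_kappa_gt0; have r0 := tube_norm_gt0 u h0.
have r3 : k * tube_norm h u ^+ 3 != 0 by rewrite mulf_neq0 ?expf_neq0// gt_eqF.
have d0 : d = 0.
  move/eqP: dP; rewrite mulf_eq0 => /orP[/eqP//|].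
  by rewrite gt_eqF// divr_gt0// mulr_gt0.
split=> //; move: cE; rewrite d0 mul0r addr0 => /eqP.
rewrite mulf_eq0 => /orP[/eqP//|]; rewrite mulf_eq0 gt_eqF ?divr_gt0 ?slant_gt0//=.
rewrite mulf_eq0 gt_eqF/=; last first.
  by rewrite divr_gt0 ?sqrt_ellipse_gt0// -tube_norm2 ?exprn_gt0.
move=> /eqP s0; move/eqP: cQ; rewrite mulf_eq0 => /orP[/eqP//|].
rewrite mulf_eq0 invr_eq0 (negbTE r3) orbF oppr_eq0 mulf_eq0.
rewrite expf_eq0/= gt_eqF//= => /eqP c0.
have := cos2Dsin2 u; rewrite s0 c0 !expr0n/= addr0 => /esym/eqP.
by rewrite oner_eq0.
Qed.

End TubeFormulas.

(** * Foliations from labelled charts *)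

Section PlaneTopology.
Variable R : realType.

Lemma connected_plane : connected [set: R * R].
Proof.
have -> : [set: R * R] =
    \bigcup_(v in [set: R * R]) range (fun t : R => (t * v.1, t * v.2)).
  apply/seteqP; split=> // -[x y] _; exists (x, y) => //.
  by exists 1 => //; rewrite !mul1r.
apply: bigcup_connected => [|v _].
  by exists (0, 0) => v _; exists 0 => //; rewrite !mul0r.
apply: connected_continuous_connected.
  exact/connected_intervalP.
apply: continuous_subspaceT => t.
by apply: cts_pair; cts.
Qed.

Lemma connected_range_plane (T : topologicalType) (f : R * R -> T) :
  continuous f -> connected (range f).
Proof.
move=> cf; apply: connected_continuous_connected; first exact: connected_plane.
exact: continuous_subspaceT.
Qed.

(** A norm preserving map is proper: the preimages of points near q stay in one compact square, on
    which F sends closed sets to closed sets. *)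
Lemma inverse_continuous_isometry (F G : R * R -> R * R) :
  continuous F -> cancel F G -> cancel G F ->
  (forall w, (F w).1 ^+ 2 + (F w).2 ^+ 2 = w.1 ^+ 2 + w.2 ^+ 2) ->
  continuous G.
Proof.
move=> cF FG GF nF q.
have nG y : (G y).1 ^+ 2 + (G y).2 ^+ 2 = y.1 ^+ 2 + y.2 ^+ 2.
  by rewrite -[in RHS](GF y) nF.
pose N (y : R * R) := y.1 ^+ 2 + y.2 ^+ 2.
have cN : continuous N by move=> y; rewrite /N -/(continuous_at _ _); cts.
(* The added 1 leaves room around q and makes B >= 1, so that x^2 <= B bounds |x| by B. *)
pose B := N q + 1.
have N0 y : 0 <= N y by rewrite addr_ge0 ?sqr_ge0.
have B1 : 1 <= B by rewrite lerDr.
pose K := `[- B, B] `*` `[- B, B] : set (R * R).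
have cK : compact K by apply: compact_setX; exact: segment_compact.
have sqB (x : R) : x ^+ 2 <= B -> `[- B, B]%classic x.
  by move=> xB /=; rewrite in_itv/= -ler_norml; have := real_normK (num_real x);
    have := normr_ge0 x; nra.
have KG y : N y < B -> K (G y).
  move=> yB; have := nG y; rewrite -/(N y) => GN.
  by split; apply: sqB; have := sqr_ge0 (G y).1; have := sqr_ge0 (G y).2; lra.
move=> A /=; rewrite nbhsE => -[W [oW WGq] WA].
(* The points of the square outside the neighbourhood W of G q: their image is closed and misses
   q. *)
have cKW : compact (K `&` ~` W).
  apply: (subclosed_compact _ cK) => //.
  apply: closedI; last by rewrite closedC.
  by apply: compact_closed cK; exact: norm_hausdorff.
have cFK : closed (F @` (K `&` ~` W)).
  apply: compact_closed; first exact: norm_hausdorff.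
  by apply: continuous_compact => //; exact: continuous_subspaceT.
have nq1 : nbhs q (~` (F @` (K `&` ~` W))).
  apply: open_nbhs_nbhs; split; first by rewrite openC.
  by move=> -[w [_ nWw] Fw]; apply: nWw; rewrite -[w]FG Fw.
have nq2 : \forall y \near q, N y < B.
  have NB : \forall t \near N q, t < B by apply: lt_nbhsl; rewrite ltrDl.
  exact: cN NB.
rewrite /nbhs/=; near=> y.
apply: WA; apply: contrapT => nW.
have : (~` (F @` (K `&` ~` W))) y by near: y; exact: nq1.
apply; exists (G y); last exact: GF.
by split=> //; apply: KG; near: y; exact: nq2.
Unshelve. all: by end_near. Qed.

End PlaneTopology.

Section LabelledCharts.
Variable R : realType.
Local Notation ambient := (Defs.space R).

Lemma connected_plaque (M V : set ambient) phi q :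
  chart M V phi -> V q -> connected (plaque V phi q).
Proof.
move=> [VM oV cphi [psi [cpsi psiK Vpsi phiK]]] Vq.
have -> : plaque V phi q = range (fun w : R * R => psi (w, (phi q).2)).
  apply/seteqP; split=> [p [Vp /= pq]|_ [w _ <-]].
    by exists (phi p).1 => //; rewrite -pq -surjective_pairing psiK.
  by split=> //=; rewrite phiK.
apply: connected_range_plane => w.
have c : continuous_at w (fun w : R * R => (w, (phi q).2)).
  by apply: cts_pair; [exact: cts_id|exact: cts_cst].
exact: (continuous_comp c (cpsi _)).
Qed.

(* If the transverse coordinate of every chart determines the leaf, then each
   leaf meets the chart in a single plaque. *)
Lemma foliates_labelled (M U : set ambient) (I : set R) (S : R -> surface R)
    (L : R -> set ambient) :
  (forall i, I i -> support_of (S i) = L i) ->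
  (forall i, I i -> immersion (S i)) ->
  (forall i, I i -> connected (L i)) ->
  (forall i j p, L i p -> L j p -> i = j) ->
  (forall p, U p <-> exists2 i, I i & L i p) ->
  (forall p, U p -> exists V phi (f : R -> R), [/\ chart M V phi, V p, V `<=` U,
      injective f & forall q, V q -> L (f (phi q).2) q]) ->
  foliates M U [set S i | i in I].
Proof.
move=> SL Simm cL Ldisj UL charts.
have plaqueE i V phi (f : R -> R) q : I i -> injective f ->
    (forall q, V q -> L (f (phi q).2) q) -> (support_of (S i) `&` V) q ->
    support_of (S i) `&` V = plaque V phi q.
  move=> Ii finj Vf [+ Vq]; rewrite SL// => Lq.
  have fq : f (phi q).2 = i by apply: Ldisj Lq; exact: Vf.
  apply/seteqP; split=> p [].
    by move=> Lp Vp; split=> //=; apply: finj; rewrite fq; apply: Ldisj Lp;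
      exact: Vf.
  by move=> Vp /= pq; split=> //; rewrite -fq -pq; exact: Vf.
split.
- move=> _ [i Ii <-]; split; last by rewrite SL//; exact: cL.
  split; first exact: Simm.
  move=> p Sp; have Lp : L i p by rewrite -SL.
  have [|V [phi [f [cV Vp VU finj Vf]]]] := charts p.
    by apply/UL; exists i.
  by exists V, phi; split=> //; apply: plaqueE Vf _.
- move=> _ _ [i Ii <-] [j Ij <-] [p []]; rewrite !SL// => Lip Ljp.
  by rewrite (Ldisj _ _ _ Lip Ljp).
- apply/seteqP; split=> [p [_ [i Ii <-]]|p /UL[i Ii Lp]].
    by rewrite SL// => Lp; apply/UL; exists i.
  by exists (S i); [exists i|rewrite SL].
- move=> p Up; have [V [phi [f [cV Vp VU finj Vf]]]] := charts p Up.
  exists V, phi; split=> // _ q [i Ii <-] SVq.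
  have E := plaqueE i V phi f q Ii finj Vf SVq.
  rewrite {1}E connected_component_id//; last first.
    by apply: connected_plaque cV _; case: SVq.
  by rewrite -E.
Qed.

(** A chart must be onto R^2 x R, so the half-line of positive transverse coordinates is stretched
    by ln. It is used to keep the tubes with H > 0 only. *)
Lemma chart_half (M V : set ambient) phi : chart M V phi ->
  chart M (V `&` [set q | 0 < (phi q).2]) (fun q => ((phi q).1, ln (phi q).2)).
Proof.
move=> [VM oV cphi [psi [cpsi psiK Vpsi phiK]]].
split.
- by move=> p [/VM].
- have [W oW WV] := (@open_subspaceP _ M V).1 oV.
  have oP : open ((fun q => 0 < (phi q).2) : set (subspace V)).
    have c2 : continuous (fun q : subspace V => (phi q).2).
      move=> q; exact: (continuous_comp (cphi q) cvg_snd).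
    by have /continuousP/(_ _ (@open_gt _ 0)) := c2.
  have [P oP' PV] := (@open_subspaceP _ V _).1 oP.
  apply/open_subspaceP; exists (W `&` P); first exact: openI.
  apply/seteqP; split=> q.
    move=> [[Wq Pq] Mq]; have [Vq _] : (V `&` M) q by rewrite -WV.
    have [? _] : ([set q | 0 < (phi q).2] `&` V) q by rewrite -PV.
    by split; [split|].
  move=> [[Vq pq] Mq].
  have [Wq _] : (W `&` M) q by rewrite WV.
  have [Pq _] : (P `&` V) q by rewrite PV.
  by split; [split|].
- apply/subspace_continuousP => q [Vq /= pq].
  have cq : phi @ within (V `&` [set q | 0 < (phi q).2]) (nbhs q) --> phi q.
    have := (subspace_continuousP V phi).1 cphi q Vq; apply: cvg_trans.
    by apply: cvg_app; apply: within_subset => x [].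
  have c (f : (R * R) * R -> R * R * R) : {for phi q, continuous f} ->
      (f \o phi) @ within (V `&` [set q | 0 < (phi q).2]) (nbhs q) --> f (phi q).
    by move=> cf; exact: cvg_comp cq cf.
  apply: (c (fun y => (y.1, ln y.2))).
  rewrite -/(continuous_at _ _); apply: cts_pair; first exact: cvg_fst.
  by apply: (continuous_comp (g := @ln R)); [exact: cvg_snd|exact: continuous_ln].
- exists (fun y => psi (y.1, expR y.2)); split.
  + move=> y; have c : continuous_at y (fun y : (R * R) * R => (y.1, expR y.2)).
      apply: cts_pair; first exact: cvg_fst.
      by apply: (continuous_comp (g := expR)); [exact: cvg_snd|
        exact: continuous_expR].
    exact: (continuous_comp c (cpsi _)).
  + move=> p [Vp /= pp]; rewrite lnK ?posrE//.
    by rewrite -surjective_pairing psiK.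
  + by move=> y; split=> //=; rewrite phiK/= expR_gt0.
  + by move=> [y1 y2] /=; rewrite phiK/= expRK.
Qed.

Lemma chart_open (M W : set ambient) (phi : ambient -> (R * R) * R)
    (psi : (R * R) * R -> ambient) :
  open W -> (forall q, M q -> W q -> {for q, continuous phi}) -> continuous psi ->
  (forall p, M p -> W p -> psi (phi p) = p) ->
  (forall y, M (psi y) /\ W (psi y)) -> (forall y, phi (psi y) = y) ->
  chart M (M `&` W) phi.
Proof.
move=> oW cphi cpsi psiK MW phiK; split.
- by move=> p [].
- by rewrite open_subspaceTI; exact: open_subspaceW.
- apply: continuous_in_subspaceT => q; rewrite inE => -[Mq Wq].
  exact: cphi.
- exists psi; split=> //; first by move=> p [Mp Wp]; exact: psiK.
Qed.

End LabelledCharts.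

Lemma cos_sin_exists (R : realType) (x y : R) : x ^+ 2 + y ^+ 2 = 1 ->
  exists u, cos u = x /\ sin u = y.
Proof.
move=> xy; have x1 : -1 <= x <= 1.
  rewrite -ler_norml -ler_sqr ?nnegrE// real_normK ?num_real// expr1n.
  by have := sqr_ge0 y; lra.
have sE : sin (acos x) = `|y|.
  by rewrite sin_acos// -xy [_ + y ^+ 2]addrC addrK sqrtr_sqr.
have [y0|y0] := leP 0 y.
  by exists (acos x); rewrite acosK ?in_itv// sE ger0_norm.
by exists (- acos x); rewrite cosN sinN acosK ?in_itv// sE ltr0_norm// opprK.
Qed.

(** * The leaves as level sets *)

Section Leaves.
Variables (R : realType) (kappa a : R).
Hypotheses (kappa_gt0 : 0 < kappa) (a_neq0 : a != 0).
Local Notation ambient := (Defs.space R).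
Local Notation k := (Num.sqrt kappa).
Local Notation al := (coecc kappa a).
Local Notation e := (ecc kappa a).
Implicit Types (p q : ambient) (h : R).

Definition radial p : R := Num.sqrt (p.1.1.1 ^+ 2 + p.1.1.2 ^+ 2).
(** [cosd] and [sind] are [radial] times the cosine and the sine of the helical angle z / a - theta.
    Unlike that angle, they are defined and continuous everywhere, and they are invariant under the
    screw motions. *)
Definition cosd p : R := p.1.1.1 * cos (p.2 / a) + p.1.1.2 * sin (p.2 / a).
Definition sind p : R := p.1.1.1 * sin (p.2 / a) - p.1.1.2 * cos (p.2 / a).

(* [leaf (2 H / sqrt kappa)] is the tube of curvature H, the helicoid for H = 0
   and the opposite tube for H < 0.  On the fibers over the poles [radial p] is
   0 and the quotient is the junk value 0, but there the second condition
   already forces h = 0. *)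
Definition leaf h : set ambient :=
  [set p | [/\ S2xR kappa p, (p.1.2 * h) ^+ 2 <= radial p ^+ 2
             & cosd p = radial p * cos (leaf_angle al e h (p.1.2 / radial p))]].

Lemma coecc_gt0 : 0 < al.
Proof.
by rewrite divr_gt0 ?mulr_gt0 ?normr_gt0 ?a_neq0 ?(sqrt_kappa_gt0 kappa_gt0)
  ?(slant_gt0 a kappa_gt0).
Qed.

Let e_gt0 : 0 < e := ecc_gt0 a kappa_gt0.
Let al_e : al ^+ 2 + e ^+ 2 = 1 := coecc2_ecc2 a kappa_gt0.

Lemma radial_ge0 p : 0 <= radial p. Proof. exact: sqrtr_ge0. Qed.

Lemma radial2 p : radial p ^+ 2 = p.1.1.1 ^+ 2 + p.1.1.2 ^+ 2.
Proof. by rewrite sqr_sqrtr// addr_ge0 ?sqr_ge0. Qed.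

Lemma cosd2_sind2 p : cosd p ^+ 2 + sind p ^+ 2 = radial p ^+ 2.
Proof.
by rewrite radial2 /cosd /sind; have c2 := cos2sin2 (p.2 / a); ring: c2.
Qed.

Lemma x_cosd p : p.1.1.1 = cosd p * cos (p.2 / a) + sind p * sin (p.2 / a).
Proof. by rewrite /cosd /sind; have c2 := cos2sin2 (p.2 / a); ring: c2. Qed.

Lemma y_cosd p : p.1.1.2 = cosd p * sin (p.2 / a) - sind p * cos (p.2 / a).
Proof. by rewrite /cosd /sind; have c2 := cos2sin2 (p.2 / a); ring: c2. Qed.

Lemma S2xRE p : S2xR kappa p <-> radial p ^+ 2 + p.1.2 ^+ 2 = kappa^-1.
Proof. by rewrite radial2. Qed.

Lemma radial0_cosd p : radial p = 0 -> cosd p = 0.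
Proof.
move=> r0; have := cosd2_sind2 p; rewrite r0 expr0n/= => /eqP.
by rewrite paddr_eq0 ?sqr_ge0// sqrf_eq0 => /andP[/eqP].
Qed.

Lemma radial0_alt p : S2xR kappa p -> radial p = 0 -> p.1.2 != 0.
Proof.
move=> /S2xRE + r0; rewrite r0 expr0n/= add0r => E.
by apply: contraTneq isT => Z; move/eqP: E;
  rewrite Z expr0n/= eq_sym invr_eq0 gt_eqF// kappa_gt0.
Qed.

Lemma leaf_radial0 h p : leaf h p -> radial p = 0 -> h = 0.
Proof.
move=> [Mp th _] r0; have Z := radial0_alt Mp r0.
move: th; rewrite r0 expr0n/= exprMn => H; apply/eqP.
have Z2 : 0 < p.1.2 ^+ 2 by rewrite exprn_even_gt0.
by rewrite -sqrf_eq0 eq_le sqr_ge0 andbT -(pmulr_rle0 _ Z2).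
Qed.

Lemma leaf_slope h p : leaf h p -> (p.1.2 / radial p * h) ^+ 2 <= 1.
Proof.
move=> [_ th _]; have := radial_ge0 p; rewrite le_eqVlt => /predU1P[<-|r0].
  by rewrite invr0 mulr0 mul0r expr0n/= ler01.
by rewrite mulrAC expr_div_n ler_pdivrMr ?mul1r// exprn_gt0.
Qed.

Hypothesis e_artanh : e * artanh e <= 1.

Let LA_itv h t : (t * h) ^+ 2 <= 1 -> 0 <= leaf_angle al e h t <= pi.
Proof. exact: (leaf_angle_itv coecc_gt0 e_gt0 al_e e_artanh). Qed.

(** Off the fibers over the poles, cos is injective on [0, pi], where the leaf angles lie, so the
    two labels have the same angle at the same slope. *)
Lemma leaf_disjoint h h' p : leaf h p -> leaf h' p -> h = h'.
Proof.
move=> Lp Lp'; have [r0|r0] := eqVneq (radial p) 0.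
  by rewrite (leaf_radial0 Lp r0) (leaf_radial0 Lp' r0).
have t1 := leaf_slope Lp; have t2 := leaf_slope Lp'.
apply: (leaf_angle_inj coecc_gt0 e_gt0 al_e e_artanh t1 t2).
apply: cos_inj; rewrite ?in_itv/=; [exact: LA_itv t1|exact: LA_itv t2|].
by apply: (mulfI r0); case: Lp => _ _ <-; case: Lp' => _ _ <-.
Qed.

(** The excluded points are those of the two limit geodesics: altitude 0 and helical angle 0 or
    pi. *)
Lemma leaf_cover p : S2xR kappa p -> ~ (p.1.2 = 0 /\ cosd p ^+ 2 = radial p ^+ 2) ->
  exists h, leaf h p.
Proof.
move=> Mp H; have := radial_ge0 p; rewrite le_eqVlt => /predU1P[r0|r0].
  exists 0; split=> //; first by rewrite mulr0 expr0n/= sqr_ge0.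
  by rewrite radial0_cosd// -r0 mul0r.
have r2 : 0 < radial p ^+ 2 by exact: exprn_gt0.
have c2 : cosd p ^+ 2 <= radial p ^+ 2.
  by rewrite -cosd2_sind2; have := sqr_ge0 (sind p); lra.
have c1 : -1 <= cosd p / radial p <= 1.
  rewrite -ler_norml -ler_sqr ?nnegrE// real_normK ?num_real// expr1n.
  by rewrite expr_div_n ler_pdivrMr// mul1r.
have tc : p.1.2 / radial p != 0 \/ -1 < cosd p / radial p < 1.
  have [Z|Z] := eqVneq p.1.2 0; last by left;
    rewrite mulf_neq0// invr_neq0// gt_eqF.
  right; apply: sqr_lt1; rewrite expr_div_n ltr_pdivrMr// mul1r lt_def c2 andbT.
  by apply/eqP => E; apply: H.
have [h th hc] := leaf_angle_onto coecc_gt0 e_gt0 al_e e_artanh c1 tc.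
exists h; split=> //; last by rewrite hc mulrC divfK// gt_eqF.
by move: th; rewrite mulrAC expr_div_n ler_pdivrMr// mul1r.
Qed.

(** At slope 0 every leaf angle is strictly between 0 and pi, so its sine does not vanish. *)
Lemma leaf_off_limits h p : leaf h p ->
  ~ (p.1.2 = 0 /\ cosd p ^+ 2 = radial p ^+ 2).
Proof.
move=> [Mp th E] [Z].
have r0 : radial p != 0 by apply/negP => /eqP/(radial0_alt Mp); rewrite Z eqxx.
rewrite E Z mul0r exprMn => /(congr1 (fun x => x / radial p ^+ 2)).
rewrite mulrC mulKf ?expf_neq0// divff ?expf_neq0//.
have := @leaf_angle_itvo _ al e coecc_gt0 e_gt0 al_e e_artanh h 0.
rewrite mul0r expr0n/= ltr01 => /(_ isT) LA.
have := cos2Dsin2 (leaf_angle al e h 0).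
have := exprn_gt0 2 (sin_gt0_pi LA); lra.
Qed.

Lemma leaf_sign_gt0 h p : leaf h p -> 0 < h -> 0 < cosd p.
Proof.
move=> Lp h0; have [r0|r0] := eqVneq (radial p) 0.
  by move: h0; rewrite (leaf_radial0 Lp r0) ltxx.
have t1 := leaf_slope Lp; case: (Lp) => _ _ ->.
have r0' : 0 < radial p by rewrite lt_def r0 radial_ge0.
rewrite (pmulr_rgt0 _ r0').
have := leaf_angle_itv_ge0 coecc_gt0 e_gt0 al_e e_artanh (ltW h0) t1.
have := leaf_angle_decr_ge0 coecc_gt0 e_gt0 al_e e_artanh (lexx 0) h0 t1.
rewrite leaf_angle0 => l1 l2.
by apply: cos_gt0_pihalf; have := pi_gt0 R; lra.
Qed.

(** Here c stands for an odd multiple of pi a; the formulation by cos and sin serves pi a, pi |a|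
    and - pi |a| alike. *)
Lemma leaf_shift h p c : cos (c / a) = -1 -> sin (c / a) = 0 ->
  leaf h p -> leaf (- h) (p.1, p.2 + c).
Proof.
move=> cc cs Lp; have t1 := leaf_slope Lp; case: Lp => Mp th E.
split=> //=; first by rewrite mulrN sqrrN.
rewrite {2}/radial/= -/(radial p) leaf_angleN//; last exact: coecc_gt0.
rewrite [pi - _]addrC cosDpi cosN mulrN -E /cosd /=.
by rewrite mulrDl cosD sinD cc cs; ring.
Qed.

(** The helicoid is the surface [cosd] = 0; it separates the positive labels from the negative
    ones. *)
Lemma leaf_sign h p : leaf h p -> (0 < h <-> 0 < cosd p).
Proof.
move=> Lp; split; first exact: leaf_sign_gt0.
move=> c0; rewrite ltNge le_eqVlt; apply/negP => /predU1P[h0|h0].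
  by case: Lp => _ _; rewrite h0 leaf_angle0 cos_pihalf mulr0 => E; move: c0;
    rewrite E ltxx.
have ca : cos (pi * a / a) = -1 by rewrite mulfK// cospi.
have sa : sin (pi * a / a) = 0 by rewrite mulfK// sinpi.
have Lp' := leaf_shift ca sa Lp.
have := leaf_sign_gt0 Lp'; rewrite oppr_gt0 h0 => /(_ isT).
by rewrite /cosd/= mulrDl cosD sinD ca sa; move: c0; rewrite /cosd; lra.
Qed.

End Leaves.

(** * Supports of the tubes, the helicoid and the opposite tubes *)

Section Supports.
Variables (R : realType) (kappa a : R).
Hypotheses (kappa_gt0 : 0 < kappa) (a_neq0 : a != 0).
Local Notation ambient := (Defs.space R).
Local Notation k := (Num.sqrt kappa).
Local Notation al := (coecc kappa a).
Local Notation e := (ecc kappa a).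
Local Notation leaf := (leaf kappa a).

Let al_gt0 : 0 < al := coecc_gt0 kappa_gt0 a_neq0.
Let e_gt0 : 0 < e := ecc_gt0 a kappa_gt0.
Let al_e : al ^+ 2 + e ^+ 2 = 1 := coecc2_ecc2 a kappa_gt0.
Let k0 : 0 < k := sqrt_kappa_gt0 kappa_gt0.
Let k2 : k ^+ 2 = kappa := sqr_sqrt_kappa kappa_gt0.

Lemma leaf_angle_evenr h t : leaf_angle al e h (- t) = leaf_angle al e h t.
Proof. by rewrite /leaf_angle /angle_shift /tilt mulNr !sqrrN. Qed.

(** The sign is governed by cos s and by a; the equation of a leaf, being written with a cosine,
    sees both signs alike. *)
Lemma tube_height_angle (h s : R) : 0 < h ->
  tube_profile_height kappa a h s / a = leaf_angle al e h (sin s / h) \/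
  tube_profile_height kappa a h s / a = - leaf_angle al e h (sin s / h).
Proof.
move=> h0.
have main : tube_profile_height kappa a h s = `|a|
  * leaf_angle al e h (sin s / h) \/
    tube_profile_height kappa a h s = - (`|a| * leaf_angle al e h (sin s / h)).
  have LAE : `|a| * leaf_angle al e h (sin s / h) = slant kappa a / k * profile al e h
      (`|cos s| / Num.sqrt (h ^+ 2 + al ^+ 2 * sin s ^+ 2)).
    by rewrite -profile_leaf_angle// mulrA slant_coecc.
  rewrite LAE /tube_profile_height.
  have [c0|c0] := ger0P (cos s); first by right; rewrite mulNr.
  have /andP[p1 p2] := profile_section_itv al_e s h0.
  by left; rewrite [- cos s / _]mulNr (profileN _ p2 p1) mulNr mulrN.
have [aE|aE] : a = `|a| \/ a = - `|a|.
- by have [a0|a0] := ger0P a; [left|right; rewrite opprK].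
- case: main => ->; [left|right]; rewrite [X in _ / X]aE.
    by rewrite mulrC mulKf// normr_eq0.
  by rewrite mulNr mulrC mulKf// normr_eq0.
- case: main => ->; [right|left]; rewrite [X in _ / X]aE invrN mulrN.
    by rewrite mulrC mulKf// normr_eq0.
  by rewrite mulNr opprK mulrC mulKf// normr_eq0.
Qed.

Lemma radial_screw (P Q E : R -> R) u v :
  0 <= P u -> radial (screw a P Q E u v) = P u.
Proof.
move=> P0; rewrite /radial /screw /= !exprMn -mulrDr cos2Dsin2 mulr1 sqrtr_sqr.
by rewrite ger0_norm.
Qed.

Lemma cosd_screw (P Q E : R -> R) u v :
  cosd a (screw a P Q E u v) = P u * cos (E u / a).
Proof.
rewrite /cosd /screw /=; have -> : (E u + a * v) / a = E u / a + v by field.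
rewrite cosD sinD.
have c2 := cos2sin2 v.
by ring: c2.
Qed.

Lemma support_tube (H : R) : 0 < H ->
  support_of (tube kappa a H) = leaf (2 * H / k).
Proof.
move=> H0; rewrite tubeE//; set h := 2 * H / k.
have h0 : 0 < h by rewrite divr_gt0// mulr_gt0.
apply/seteqP; split=> [_ [s [v ->]]|p Lp].
  have r0 := tube_norm_gt0 s h0; have r2 := tube_norm2 s h0.
  have P0 : 0 < tube_profile_radius kappa h s by rewrite divr_gt0// mulr_gt0.
  split.
  - apply/S2xRE; rewrite (radial_screw _ _ _ (ltW P0)) /screw /=.
    rewrite /tube_profile_radius /tube_profile_alt -[in RHS]k2.
    by field: r2; rewrite !gt_eqF.
  - rewrite (radial_screw _ _ _ (ltW P0)) /screw /= /tube_profile_alt /tube_profile_radius.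
    have -> : - sin s / (k * tube_norm h s) * h =
        - sin s * (h / (k * tube_norm h s)) by ring.
    by rewrite exprMn sqrrN ler_piMl ?sqr_ge0.
  - rewrite cosd_screw (radial_screw _ _ _ (ltW P0)); congr (_ * _).
    have -> : (screw a (tube_profile_radius kappa h) (tube_profile_alt kappa h)
        (tube_profile_height kappa a h) s v).1.2 / tube_profile_radius kappa h s =
        - (sin s / h).
      by rewrite /= /tube_profile_alt /tube_profile_radius; field; rewrite !gt_eqF.
    rewrite leaf_angle_evenr.
    by case: (tube_height_angle s h0) => ->; rewrite ?cosN.
have r0 : 0 < radial p.
  rewrite lt_def radial_ge0 andbT; apply/eqP => /(leaf_radial0 kappa_gt0 Lp) h1.
  by move: h0; rewrite h1 ltxx.
have t1 := leaf_slope Lp; case: (Lp) => /S2xRE Mp _ E.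
set t := p.1.2 / radial p in t1 E.
have Zt : p.1.2 = t * radial p by rewrite /t divfK// gt_eqF.
(* Two parameters of the profile curve fit the slope t, with opposite cosines and hence opposite
   heights; [sind] tells which of them leads to p. *)
have [s [sE [hc hs]]] : exists s, [/\ sin s = - (t * h),
    cosd a p = radial p * cos (tube_profile_height kappa a h s / a) &
    sind a p = radial p * sin (tube_profile_height kappa a h s / a)].
  have sq : (Num.sqrt (1 - (t * h) ^+ 2)) ^+ 2 + (- (t * h)) ^+ 2 = 1.
    by rewrite sqrrN sqr_sqrtr ?subr_ge0// subrK.
  have sq' : (- Num.sqrt (1 - (t * h) ^+ 2)) ^+ 2 + (- (t * h)) ^+ 2 = 1.
    by rewrite [X in X + _]sqrrN.
  have [s1 [c1 s1E]] := cos_sin_exists sq.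
  have [s2 [c2 s2E]] := cos_sin_exists sq'.
  have thE s : sin s = - (t * h) ->
      leaf_angle al e h (sin s / h) = leaf_angle al e h t.
    by move=> ->; rewrite mulNr mulfK ?gt_eqF// leaf_angle_evenr.
  have hN : tube_profile_height kappa a h s2 = - tube_profile_height kappa a h s1.
    have := profile_section_itv al_e s1 h0; rewrite c1 s1E => /andP[p1 p2].
    rewrite /tube_profile_height c2 c1 s2E s1E.
    by rewrite [- Num.sqrt (1 - _) / _]mulNr (profileN _ p2 p1) mulrN.
  have cE s : sin s = - (t * h) ->
      cosd a p = radial p * cos (tube_profile_height kappa a h s / a).
    by move=> sE; case: (tube_height_angle s h0) => ->; rewrite (thE _ sE) ?cosN.
  have : sind a p ^+ 2 = (radial p * sin (tube_profile_height kappa a h s1 / a)) ^+ 2.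
    have := cosd2_sind2 a p; rewrite (cE _ s1E) !exprMn sin2cos2 => F.
    by rewrite mulrBr mulr1 -[X in X - _]F [RHS]addrC addKr.
  move/eqP; rewrite eqf_sqr => /orP[/eqP sd|/eqP sd].
    by exists s1; split=> //; exact: cE.
  exists s2; split=> //; first exact: cE.
  by rewrite hN mulNr sinN mulrN.
exists s, ((p.2 - tube_profile_height kappa a h s) / a).
have r2 := tube_norm2 s h0; have n0 := tube_norm_gt0 s h0.
have PE : tube_profile_radius kappa h s = radial p.
  apply/eqP; rewrite -(eqrXn2 (n := 2)) ?ltW ?divr_gt0 ?mulr_gt0//.
  have t0 : 0 < 1 + t ^+ 2 by have := sqr_ge0 t; lra.
  have rE : radial p ^+ 2 = kappa^-1 / (1 + t ^+ 2).
    by rewrite -Mp Zt; field; rewrite gt_eqF.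
  have r2' : tube_norm h s ^+ 2 = h ^+ 2 * (1 + t ^+ 2) by rewrite r2 sE; ring.
  apply/eqP; rewrite rE /tube_profile_radius.
  by field: r2' k2; rewrite !gt_eqF.
have QE : tube_profile_alt kappa h s = p.1.2.
  by rewrite /tube_profile_alt sE Zt -PE /tube_profile_radius; field;
    rewrite !gt_eqF.
have tE : (p.2 - tube_profile_height kappa a h s) / a =
  p.2 / a - tube_profile_height kappa a h s / a by rewrite mulrBl.
case: p => -[[x y] z] w in Lp r0 t t1 E Mp Zt s sE hc hs r2 n0 PE QE tE *.
rewrite /= in tE; rewrite /screw PE QE; congr (_, _, _, _) => /=.
- rewrite [LHS](x_cosd a (x, y, z, w)) hc hs tE cosB /=; ring.
- rewrite [LHS](y_cosd a (x, y, z, w)) hc hs tE sinB /=; ring.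
- by rewrite mulrC divfK// subrKC.
Qed.

Lemma helicoidE : helicoid kappa a =
  screw a (fun t => sn kappa (- t)) (fun t => cs kappa (- t) / k)
    (fun=> pi / 2 * `|a|).
Proof. by []. Qed.

Lemma normr_div_self : `|a| / a = 1 \/ `|a| / a = -1.
Proof.
have [a0|a0] := ger0P a; first by left; rewrite divff.
by right; rewrite mulNr divff.
Qed.

Lemma sqr_sn_cs (r : R) : sn kappa r ^+ 2 + (cs kappa r / k) ^+ 2 = kappa^-1.
Proof.
rewrite /sn /cs -[in RHS]k2; have c2 := cos2sin2 (k * r).
by field: c2; rewrite gt_eqF.
Qed.

Lemma support_helicoid : support_of (helicoid kappa a) = leaf 0.
Proof.
have cpi : cos (pi / 2 * `|a| / a) = 0.
  rewrite -mulrA; case: normr_div_self => ->; rewrite ?mulr1 ?mulrN1 ?cosN;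
    exact: cos_pihalf.
rewrite helicoidE; apply/seteqP; split=> [_ [t [v ->]]|p [Mp _ E]].
  split.
  - rewrite /S2xR /screw /= -(sqr_sn_cs (- t)); have c2 := cos2sin2 v.
    by ring: c2.
  - by rewrite mulr0 expr0n/= sqr_ge0.
  - by rewrite cosd_screw leaf_angle0 cos_pihalf mulr0 cpi mulr0.
have c0 : cosd a p = 0 by rewrite E leaf_angle0 cos_pihalf mulr0.
have [sg [sg2 sgE]] : exists sg, sg ^+ 2 = 1 /\ `|a| / a = sg.
  by case: normr_div_self => ->; [exists 1|exists (-1)]; rewrite ?sqrrN expr1n.
(* Since [cosd] is 0, the pair of altitude and +- [sind] lies on a circle of radius 1 / k, whose
   angle is the parameter on the complete geodesic. *)
have zk : (k * p.1.2) ^+ 2 + (k * (sg * sind a p)) ^+ 2 = 1.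
  have := cosd2_sind2 a p; rewrite c0 expr0n/= add0r => S.
  rewrite !exprMn sg2 mul1r S k2 -mulrDr addrC.
  by have /S2xRE -> := Mp; rewrite mulfV// gt_eqF// kappa_gt0.
have [th [cth sth]] := cos_sin_exists zk.
exists (- (th / k)), ((p.2 - pi / 2 * `|a|) / a).
have sthE : sn kappa (- - (th / k)) = sg * sind a p.
  by rewrite opprK /sn [k * _]mulrC divfK ?gt_eqF// sth; field; rewrite gt_eqF.
have cthE : cs kappa (- - (th / k)) / k = p.1.2.
  by rewrite opprK /cs [k * _]mulrC divfK ?gt_eqF// cth; field; rewrite gt_eqF.
have tE : (p.2 - pi / 2 * `|a|) / a = p.2 / a - sg * (pi / 2).
  by rewrite -sgE; field.
have cE : cos (sg * (pi / 2)) = 0.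
  by rewrite -cpi -sgE; congr cos; ring.
have sE : sin (sg * (pi / 2)) = sg.
  rewrite -sgE; case: normr_div_self => ->; rewrite ?mul1r ?mulN1r ?sinN;
   by rewrite sin_pihalf.
case: p => -[[x y] z] w in Mp E c0 zk cth sth sthE cthE tE *.
rewrite /= in tE; rewrite /screw sthE cthE; congr (_, _, _, _) => /=.
- rewrite [LHS](x_cosd a (x, y, z, w)) c0 tE cosB /= cE sE.
  by rewrite mul0r mulr0 !add0r; ring: sg2.
- rewrite [LHS](y_cosd a (x, y, z, w)) c0 tE sinB /= cE sE.
  by rewrite mul0r mulr0 !sub0r; ring: sg2.
- by field.
Qed.

Lemma support_reverse_translate (c : R) (S : surface R) (p : ambient) :
  support_of (reverse (translate c S)) p <-> support_of S (p.1, p.2 - c).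
Proof.
split=> -[u [v]].
  move=> ->; exists (- u), v; rewrite /reverse /translate /= addrK.
  by case: (S _ _).
move=> E; exists (- u), v; rewrite /reverse /translate opprK -E /= subrK.
by case: p {E}.
Qed.

Lemma support_opposite (S : surface R) h : support_of S = leaf h ->
  support_of (reverse (translate (pi * `|a|) S)) = leaf (- h).
Proof.
move=> SL; have cc : cos (pi * `|a| / a) = -1 /\ sin (pi * `|a| / a) = 0.
  rewrite -mulrA; case: normr_div_self => ->;
    by rewrite ?mulr1 ?mulrN1 ?cosN ?sinN cospi sinpi ?oppr0.
have cc' : cos (- (pi * `|a|) / a) = -1 /\ sin (- (pi * `|a|) / a) = 0.
  by rewrite mulNr cosN sinN; case: cc => -> ->; rewrite oppr0.
apply/seteqP; split=> p.
  move=> /support_reverse_translate; rewrite SL => Lp.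
  have := leaf_shift kappa_gt0 a_neq0 cc.1 cc.2 Lp.
  by rewrite /= subrK; case: p {Lp}.
move=> Lp; apply/support_reverse_translate; rewrite SL.
by have := leaf_shift kappa_gt0 a_neq0 cc'.1 cc'.2 Lp; rewrite opprK.
Qed.

Lemma connected_support (S : surface R) :
  continuous (fun w : R * R => S w.1 w.2) -> connected (support_of S).
Proof.
move=> cS; have -> : support_of S = range (fun w : R * R => S w.1 w.2).
  apply/seteqP; split=> [p [u [v ->]]|_ [w _ <-]]; last by exists w.1, w.2.
  by exists (u, v).
exact: connected_range_plane.
Qed.

End Supports.

(** * Continuity and regularity of the parametrised leaves *)

Section Regularity.
Variables (R : realType) (kappa a : R).
Hypotheses (kappa_gt0 : 0 < kappa).
Local Notation k := (Num.sqrt kappa).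

Let tube_data (H : R) : 0 < H -> let h := 2 * H / k in
  [/\ 0 < h,
      forall u, is_derive u (1 : R) (tube_profile_radius kappa h)
        (tube_radius_rate kappa h u),
      forall u, is_derive u (1 : R) (tube_profile_alt kappa h)
        (tube_alt_rate kappa h u) &
      forall u, is_derive u (1 : R) (tube_profile_height kappa a h)
        (tube_height_rate kappa a h u)].
Proof.
move=> H0; have k0 := sqrt_kappa_gt0 kappa_gt0.
have h0 : 0 < 2 * H / k by rewrite divr_gt0// mulr_gt0.
split; first exact: h0.
- by move=> u; exact: (derive_tube_radius kappa_gt0 u h0).
- by move=> u; exact: (derive_tube_alt kappa_gt0 u h0).
- by move=> u; exact: (derive_tube_height a kappa_gt0 u h0).
Qed.

Lemma continuous_tube (H : R) : 0 < H ->
  continuous (fun w : R * R => tube kappa a H w.1 w.2).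
Proof.
move=> H0; have [h0 hP hQ hE] := tube_data H0.
by rewrite tubeE//; exact: (continuous_screw hP hQ hE).
Qed.

Lemma immersion_tube (H : R) : 0 < H -> immersion (tube kappa a H).
Proof.
move=> H0; have [h0 hP hQ hE] := tube_data H0.
have [cP cQ] := continuous_tube_rates kappa_gt0 h0.
rewrite tubeE//.
apply: (immersion_screw hP hQ hE cP cQ (continuous_tube_height_rate h0)).
by move=> u c d _; exact: tube_rates_nondegenerate.
Qed.

Lemma continuous_opposite_tube (c0 H : R) : 0 < H ->
  continuous (fun w : R * R => reverse (translate c0 (tube kappa a H)) w.1 w.2).
Proof.
move=> H0; have [h0 hP hQ hE] := tube_data H0.
by rewrite tubeE//; exact: (continuous_reverse_translate_screw hP hQ hE).
Qed.

Lemma immersion_opposite_tube (c0 H : R) : 0 < H ->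
  immersion (reverse (translate c0 (tube kappa a H))).
Proof.
move=> H0; have [h0 hP hQ hE] := tube_data H0.
have [cP cQ] := continuous_tube_rates kappa_gt0 h0.
rewrite tubeE//.
apply: (immersion_reverse_translate_screw _ hP hQ hE cP cQ
  (continuous_tube_height_rate h0)).
by move=> u c d _; exact: tube_rates_nondegenerate.
Qed.

Let helicoid_data :
  [/\ forall u, is_derive u (1 : R) (fun t => sn kappa (- t)) (- cs kappa (- u)),
      forall u, is_derive u (1 : R) (fun t =>
        cs kappa (- t) / k) (k * sn kappa (- u)) &
      forall u, is_derive u (1 : R) (fun=> pi / 2 * `|a|) 0].
Proof.
have k0 := lt0r_neq0 (sqrt_kappa_gt0 kappa_gt0).
split=> u; last exact: der_cst.
- by rewrite /sn /cs; eapply is_derive_eq; [der|cbv beta; field].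
- by rewrite /sn /cs; eapply is_derive_eq; [der|cbv beta; field].
Qed.

Lemma continuous_helicoid :
  continuous (fun w : R * R => helicoid kappa a w.1 w.2).
Proof. by have [hP hQ hE] := helicoid_data; exact: (continuous_screw hP hQ hE). Qed.

(** The distance to the axis vanishes on the fibers over the poles, so there the independence of the
    two directions comes from the vertical component a. *)
Lemma immersion_helicoid : a != 0 -> immersion (helicoid kappa a).
Proof.
move=> a0; have k0 := sqrt_kappa_gt0 kappa_gt0; have [hP hQ hE] := helicoid_data.
have cP : continuous (fun u : R => - cs kappa (- u)).
  by move=> u; rewrite /cs -/(continuous_at _ _); cts.
have cQ : continuous (fun u : R => k * sn kappa (- u)).
  by move=> u; rewrite /sn -/(continuous_at _ _); cts.
apply: (immersion_screw (a := a) hP hQ hE cP cQ).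
  exact: cst_continuous.
move=> u c d cP' _ cQ' /eqP; rewrite mulr0 add0r mulf_eq0 (negbTE a0) orbF =>
  /eqP d0.
split=> //; apply/eqP; rewrite -sqrf_eq0.
have -> : c ^+ 2 = (c * - cs kappa (- u)) ^+ 2 + (c * (k * sn kappa (- u))) ^+ 2.
  rewrite /sn /cs; have c2 := cos2sin2 (k * - u).
  by field: c2; rewrite gt_eqF.
by rewrite cP' cQ' expr0n/= addr0.
Qed.

End Regularity.

(** * Charts around the fibers over the poles *)

Section PlaneMap.
Variables (R : realType) (al e : R).
Hypotheses (al_gt0 : 0 < al) (e_gt0 : 0 < e) (al_e : al ^+ 2 + e ^+ 2 = 1 :> R).
Hypothesis e_artanh : e * artanh e <= 1.
Implicit Types (x : R * R) (w h : R).

Let al2_gt0 : 0 < al ^+ 2. Proof. exact: exprn_gt0. Qed.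

Definition plane_hyp w h : R := Num.sqrt (w ^+ 2 + h ^+ 2 + al ^+ 2).

(** For w >= 0 this is [angle_shift] at the slope 1 / sqrt (w^2 + h^2); it is odd in w, whose sign
    distinguishes the two sheets of the leaf. *)
Definition plane_shift w h : R :=
  h * e / Num.sqrt (1 + h ^+ 2) / al *
  artanh (e / Num.sqrt (1 + h ^+ 2) * (w / plane_hyp w h)).

(* In the gnomonic projection of a hemisphere, turned back by the screw motion,
   the leaf of label h is the image of the line of ordinate h.  The map
   preserves the norm: on the circle of radius 1 / |t| it is
   h |-> leaf_angle h t in polar angle. *)
Definition plane_map x : R * R :=
  let w := x.1 in let h := x.2 in
  ((h * plane_hyp w h * cos (plane_shift w h) - al * w * sin (plane_shift w h))
     / Num.sqrt (h ^+ 2 + al ^+ 2),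
   (al * w * cos (plane_shift w h) + h * plane_hyp w h * sin (plane_shift w h))
     / Num.sqrt (h ^+ 2 + al ^+ 2)).

Let hyp_arg_gt0 w h : 0 < w ^+ 2 + h ^+ 2 + al ^+ 2.
Proof. by have := sqr_ge0 w; have := sqr_ge0 h; have := al2_gt0; lra. Qed.

Let hyp_gt0 w h : 0 < plane_hyp w h. Proof. by rewrite sqrtr_gt0. Qed.

Let hyp2 w h : plane_hyp w h ^+ 2 = w ^+ 2 + h ^+ 2 + al ^+ 2.
Proof. by rewrite sqr_sqrtr// ltW. Qed.

Let e_lt1 : e < 1.
Proof. by have := al_e; have := e_gt0; have := al2_gt0; nra. Qed.

Let shift_arg_itv w h : -1 < e / Num.sqrt (1 + h ^+ 2) * (w / plane_hyp w h) < 1.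
Proof.
apply: sqr_lt1; rewrite exprMn.
have g0 := modulus_gt0 e_gt0 h; have g1 := modulus_le e_gt0 h.
have g2 : (e / Num.sqrt (1 + h ^+ 2)) ^+ 2 < 1 by have := e_lt1; nra.
have v1 : (w / plane_hyp w h) ^+ 2 <= 1.
  rewrite expr_div_n ler_pdivrMr ?exprn_gt0// mul1r hyp2.
  by have := sqr_ge0 h; have := al2_gt0; lra.
by have := sqr_ge0 (w / plane_hyp w h); have :=
  sqr_ge0 (e / Num.sqrt (1 + h ^+ 2)); nra.
Qed.

Lemma continuous_plane_map : continuous plane_map.
Proof.
move=> x; rewrite -/(continuous_at _ _).
have cw : continuous_at x (fun x : R * R => x.1) by exact: cvg_fst.
have ch : continuous_at x (fun x : R * R => x.2) by exact: cvg_snd.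
have cy : continuous_at x (fun x : R * R => plane_hyp x.1 x.2).
  by rewrite /plane_hyp; cts.
have cs : continuous_at x (fun x : R * R => plane_shift x.1 x.2).
  have N0 := lt0r_neq0 (sqrt1D_gt0 x.2).
  apply: ctsM; first by cts; rewrite ?N0 ?gt_eqF.
  apply: cts_artanh; first exact: shift_arg_itv.
  apply: ctsM; first by cts.
  by apply: ctsM => //; apply: ctsV => //; apply: lt0r_neq0; exact: hyp_gt0.
have r0 := lt0r_neq0 (sqrt_sqrDal2_gt0 al_gt0 x.2).
have cr : continuous_at x (fun x : R * R => (Num.sqrt (x.2 ^+ 2 + al ^+ 2))^-1).
  by apply: ctsV => //; cts.
have cc := cts_cos cs; have csn := cts_sin cs.
have c1 := ctsM ch cy; have c2 := ctsM (@cts_cst _ _ x al) cw.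
exact: (cts_pair (ctsM (ctsD (ctsM c1 cc) (ctsN (ctsM c2 csn))) cr)
  (ctsM (ctsD (ctsM c2 cc) (ctsM c1 csn)) cr)).
Qed.

(** [plane_map] rotates by [plane_shift] the vector (h y, al w) / sqrt (h^2 + al^2), where y is
    [plane_hyp], and h^2 y^2 + al^2 w^2 = (h^2 + al^2) (w^2 + h^2). *)
Lemma plane_map_norm x :
  (plane_map x).1 ^+ 2 + (plane_map x).2 ^+ 2 = x.1 ^+ 2 + x.2 ^+ 2.
Proof.
case: x => w h; rewrite /plane_map /=.
have r0 := sqrt_sqrDal2_gt0 al_gt0 h; have r2 := sqr_sqrt_sqrDal2 al_gt0 h.
have y2 := hyp2 w h; have c2 := cos2sin2 (plane_shift w h).
set r := Num.sqrt _ in r0 r2 *; set y := plane_hyp w h in y2 *.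
by field: r2 y2 c2; rewrite gt_eqF.
Qed.

Lemma plane_map_opp w h :
  plane_map (- w, h) = ((plane_map (w, h)).1, - (plane_map (w, h)).2).
Proof.
have yE : plane_hyp (- w) h = plane_hyp w h by rewrite /plane_hyp sqrrN.
have sE : plane_shift (- w) h = - plane_shift w h.
  by rewrite /plane_shift yE mulNr mulrN artanhN ?shift_arg_itv// mulrN.
rewrite /plane_map /= yE sE cosN sinN; congr pair; first by congr (_ / _); ring.
by rewrite -mulNr; congr (_ / _); ring.
Qed.

Let rho w h := Num.sqrt (w ^+ 2 + h ^+ 2).

Let rho2 w h : rho w h ^+ 2 = w ^+ 2 + h ^+ 2.
Proof. by rewrite sqr_sqrtr// addr_ge0 ?sqr_ge0. Qed.

Let rho_slope w h : 0 < rho w h -> ((rho w h)^-1 * h) ^+ 2 <= 1.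
Proof.
move=> r0; rewrite mulrC expr_div_n ler_pdivrMr ?exprn_gt0// mul1r rho2.
by rewrite lerDr sqr_ge0.
Qed.

Lemma plane_map_polar w h : 0 <= w -> 0 < rho w h ->
  plane_map (w, h) = (rho w h * cos (leaf_angle al e h (rho w h)^-1),
                      rho w h * sin (leaf_angle al e h (rho w h)^-1)).
Proof.
move=> w0 r0; have t1 := rho_slope r0.
rewrite cos_leaf_angle// sin_leaf_angle//.
have r2 := rho2 w h; have y0 := hyp_gt0 w h; have y2 := hyp2 w h.
have pE : Num.sqrt (1 + al ^+ 2 * (rho w h)^-1 ^+ 2) = plane_hyp w h / rho w h.
  rewrite -[RHS]ger0_norm; last by rewrite divr_ge0 ?ltW.
  rewrite -[RHS]sqrtr_sqr; congr Num.sqrt.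
  by field: y2 r2; rewrite gt_eqF.
have wE : Num.sqrt (1 - ((rho w h)^-1 * h) ^+ 2) = w / rho w h.
  rewrite -[RHS]ger0_norm; last by rewrite divr_ge0 // ltW.
  rewrite -[RHS]sqrtr_sqr; congr Num.sqrt.
  by field: r2; rewrite gt_eqF.
have sE : angle_shift al e h (rho w h)^-1 = plane_shift w h.
  rewrite /angle_shift /plane_shift /tilt pE wE; congr (_ * artanh (_ * _)).
  by field; rewrite !gt_eqF.
rewrite pE wE sE /plane_map /=.
have q0 := sqrt_sqrDal2_gt0 al_gt0 h.
by congr pair; field; rewrite !gt_eqF.
Qed.

(** The first coordinate sees only the cosine of the helical angle, so the formula of
    [plane_map_polar] extends to both signs of w, and to the origin, where both sides are 0. *)
Lemma plane_map_fst w h :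
  (plane_map (w, h)).1 = rho w h * cos (leaf_angle al e h (rho w h)^-1).
Proof.
have [r0|r0] := eqVneq (rho w h) 0.
  have := plane_map_norm (w, h); rewrite /= -(rho2 w h) r0 expr0n/= mul0r => /eqP.
  by rewrite paddr_eq0 ?sqr_ge0// sqrf_eq0 => /andP[/eqP].
have r1 : 0 < rho w h by rewrite lt_def r0 sqrtr_ge0.
have [w0|w0] := leP 0 w; first by rewrite plane_map_polar.
have rN : rho (- w) h = rho w h by rewrite /rho sqrrN.
rewrite -[w]opprK plane_map_opp plane_map_polar ?rN//; last lra.
by rewrite opprK.
Qed.

(** On the circle of radius r, [leaf_angle_onto] at the slope 1 / r gives h; then w = +- sqrt (r^2 -
    h^2), with the sign of the second coordinate of y. *)
Lemma plane_map_surj y : exists x, plane_map x = y.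
Proof.
case: y => u v; have := sqrtr_ge0 (u ^+ 2 + v ^+ 2).
rewrite le_eqVlt => /predU1P[/esym r0|r0].
  have : u ^+ 2 + v ^+ 2 == 0.
    by rewrite eq_le -sqrtr_eq0 r0 eqxx addr_ge0 ?sqr_ge0.
  rewrite paddr_eq0 ?sqr_ge0// !sqrf_eq0 => /andP[/eqP -> /eqP ->].
  exists (0, 0).
  have : (plane_map (0, 0)).1 ^+ 2 + (plane_map (0, 0)).2 ^+ 2 == 0.
    by rewrite plane_map_norm expr0n addr0.
  rewrite paddr_eq0 ?sqr_ge0// !sqrf_eq0 => /andP[/eqP E1 /eqP E2].
  by rewrite [LHS]surjective_pairing E1 E2.
set r := Num.sqrt (u ^+ 2 + v ^+ 2) in r0.
have r2 : r ^+ 2 = u ^+ 2 + v ^+ 2 by rewrite sqr_sqrtr// addr_ge0 ?sqr_ge0.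
have c1 : -1 <= u / r <= 1.
  rewrite -ler_norml -ler_sqr ?nnegrE// real_normK ?num_real// expr1n.
  by rewrite expr_div_n ler_pdivrMr ?exprn_gt0// mul1r r2 lerDl sqr_ge0.
have t0 : r^-1 != 0 \/ -1 < u / r < 1 by left; rewrite invr_neq0// gt_eqF.
have [h th hc] := leaf_angle_onto al_gt0 e_gt0 al_e e_artanh c1 t0.
have w0 : 0 <= r ^+ 2 - h ^+ 2.
  move: th; rewrite mulrC expr_div_n ler_pdivrMr ?exprn_gt0// mul1r.
  by rewrite subr_ge0.
pose w := Num.sqrt (r ^+ 2 - h ^+ 2).
have rE : rho w h = r.
  by rewrite /rho sqr_sqrtr// subrK sqrtr_sqr gtr0_norm.
have P : plane_map (w, h) = (u, `|v|).
  rewrite plane_map_polar ?rE// ?sqrtr_ge0// hc mulrC divfK ?gt_eqF//.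
  congr pair; have LA := leaf_angle_itv al_gt0 e_gt0 al_e e_artanh th.
  apply/eqP; rewrite -(eqrXn2 (n := 2)) ?mulr_ge0 ?(ltW r0) ?sin_ge0_pi//.
  rewrite real_normK ?num_real// exprMn sin2cos2 hc; apply/eqP.
  by field: r2; rewrite gt_eqF.
have [v0|v0] := leP 0 v; first by exists (w, h); rewrite P ger0_norm.
by exists (- w, h); rewrite plane_map_opp P /= ltr0_norm// opprK.
Qed.

(** The norm and the first coordinate determine h, hence w up to sign. If w' = - w with w nonzero,
    the second coordinates are opposite and equal, so the sine of a leaf angle strictly inside the
    edge would vanish. *)
Lemma plane_map_inj : injective plane_map.
Proof.
move=> [w h] [w' h'] E.
have rE : rho w h = rho w' h'.
  rewrite /rho; congr Num.sqrt.
  by rewrite -(plane_map_norm (w, h)) E plane_map_norm.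
have [r0|r0] := eqVneq (rho w h) 0.
  have z (b c : R) : rho b c = 0 -> b = 0 /\ c = 0.
    move=> r; have := rho2 b c; rewrite r expr0n/= => /esym/eqP.
    by rewrite paddr_eq0 ?sqr_ge0// !sqrf_eq0 => /andP[/eqP -> /eqP ->].
  have [-> ->] := z _ _ r0; rewrite rE in r0.
  by have [-> ->] := z _ _ r0.
have r1 : 0 < rho w h by rewrite lt_def r0 sqrtr_ge0.
have r1' : 0 < rho w' h' by rewrite -rE.
have t1 := rho_slope r1; have t2 := rho_slope r1'.
have hE : h = h'.
  have := congr1 fst E; rewrite !plane_map_fst -rE => /(mulfI r0) ce.
  rewrite -rE in t2.
  apply: (leaf_angle_inj al_gt0 e_gt0 al_e e_artanh t1 t2).
  by apply: cos_inj ce; rewrite in_itv/=; apply: leaf_angle_itv.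
rewrite -{}hE in rE E t2 r1' *; congr pair.
have : w ^+ 2 == w' ^+ 2 by rewrite -(inj_eq (addIr (h ^+ 2))) -!rho2 rE.
rewrite eqf_sqr => /orP[/eqP//|/eqP wN].
wlog w0 : w w' E rE r0 r1 r1' t1 t2 wN / 0 <= w => [hw|].
  have [?|wn] := leP 0 w; first exact: hw.
  have w'0 : 0 <= w' by rewrite -[w']opprK -wN oppr_ge0 ltW.
  by symmetry; apply: (hw w' w) => //; rewrite -?rE// wN opprK.
have w'E : w' = - w by rewrite wN opprK.
have [w00|wn] := eqVneq w 0; first by rewrite w'E w00 oppr0.
have w1 : 0 < w ^+ 2 by rewrite exprn_even_gt0.
have := congr1 snd E; rewrite w'E plane_map_opp plane_map_polar//= => /eqP.
rewrite -subr_eq0 opprK -mulr2n mulrn_eq0/= mulf_eq0 (negbTE r0)/= => /eqP s0.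
have ts : ((rho w h)^-1 * h) ^+ 2 < 1.
  rewrite mulrC expr_div_n ltr_pdivrMr ?exprn_gt0// mul1r rho2.
  by rewrite ltrDr.
have := sin_gt0_pi (leaf_angle_itvo al_gt0 e_gt0 al_e e_artanh ts).
by rewrite s0 ltxx.
Qed.

End PlaneMap.

Lemma cts_compT (U V W : topologicalType) (x : U) (f : U -> V) (h : V -> W) :
  continuous_at x f -> continuous_at (f x) h -> continuous_at x (fun y => h (f y)).
Proof. by move=> cf ch; exact: (continuous_comp cf ch). Qed.

Section PoleChart.
Variables (R : realType) (kappa a sg : R).
Hypotheses (kappa_gt0 : 0 < kappa) (a_neq0 : a != 0) (sg2 : sg ^+ 2 = 1 :> R).
Local Notation ambient := (Defs.space R).
Local Notation k := (Num.sqrt kappa).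
Local Notation al := (coecc kappa a).
Local Notation e := (ecc kappa a).
Hypothesis e_artanh : e * artanh e <= 1.

Let al_gt0 : 0 < al := coecc_gt0 kappa_gt0 a_neq0.
Let e_gt0 : 0 < e := ecc_gt0 a kappa_gt0.
Let al_e : al ^+ 2 + e ^+ 2 = 1 := coecc2_ecc2 a kappa_gt0.
Let k0 : 0 < k := sqrt_kappa_gt0 kappa_gt0.
Let k2 : k ^+ 2 = kappa := sqr_sqrt_kappa kappa_gt0.

Lemma cts_coord (q : ambient) :
  [/\ continuous_at q (fun q : ambient => q.1.1.1),
      continuous_at q (fun q : ambient => q.1.1.2),
      continuous_at q (fun q : ambient => q.1.2) &
      continuous_at q (fun q : ambient => q.2)].
Proof.
have c1 : continuous_at q (fun q : ambient => q.1) by exact: cvg_fst.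
have c2 : continuous_at q (fun q : ambient => q.1.1).
  by apply: (continuous_comp (g := fst)) c1 _; exact: cvg_fst.
split.
- by apply: (continuous_comp (g := fst)) c2 _; exact: cvg_fst.
- by apply: (continuous_comp (g := snd)) c2 _; exact: cvg_snd.
- by apply: (continuous_comp (g := snd)) c1 _; exact: cvg_snd.
- exact: cvg_snd.
Qed.

Lemma cts_cosd (q : ambient) : continuous_at q (@cosd R a).
Proof.
have [c1 c2 _ c4] := cts_coord q.
have c := ctsM c4 (@cts_cst _ _ q a^-1).
exact: (ctsD (ctsM c1 (cts_cos c)) (ctsM c2 (cts_sin c))).
Qed.

Lemma cts_sind (q : ambient) : continuous_at q (@sind R a).
Proof.
have [c1 c2 _ c4] := cts_coord q.
have c := ctsM c4 (@cts_cst _ _ q a^-1).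
exact: (ctsD (ctsM c1 (cts_sin c)) (ctsN (ctsM c2 (cts_cos c)))).
Qed.

Local Notation Phi := (plane_map al e).

Definition plane_inv (y : R * R) : R * R :=
  projT1 (cid (plane_map_surj al_gt0 e_gt0 al_e e_artanh y)).

Lemma plane_invK : cancel plane_inv Phi.
Proof. by move=> y; rewrite /plane_inv; case: cid. Qed.

Lemma plane_mapK : cancel Phi plane_inv.
Proof.
move=> x; apply: (plane_map_inj al_gt0 e_gt0 al_e e_artanh); exact: plane_invK.
Qed.

Lemma continuous_plane_inv : continuous plane_inv.
Proof.
apply: (inverse_continuous_isometry _ plane_mapK plane_invK).
  exact: (continuous_plane_map al_gt0 e_gt0 al_e).
exact: plane_map_norm.
Qed.

Definition pole_domain : set ambient := [set q | 0 < sg * q.1.2].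

(** The gnomonic projection of the hemisphere chosen by sg = +- 1, in the frame turned by z / a,
    followed by the inverse of [plane_map]. Its radius is 1 / |t|. *)
Definition pole_plane (q : ambient) : R * R :=
  plane_inv (cosd a q / (sg * q.1.2), sind a q / (sg * q.1.2)).

Definition pole_phi (q : ambient) : (R * R) * R :=
  (((pole_plane q).1, q.2), (pole_plane q).2).

(** The absolute altitude on the sphere at gnomonic radius sqrt (w^2 + h^2). *)
Definition pole_scale (w h : R) : R := (k * Num.sqrt (1 + (w ^+ 2 + h ^+ 2)))^-1.

Definition pole_psi (y : (R * R) * R) : ambient :=
  let u := Phi (y.1.1, y.2) in let c := pole_scale y.1.1 y.2 in
  let z := y.1.2 / a in
  ((c * (u.1 * cos z + u.2 * sin z), c * (u.1 * sin z - u.2 * cos z), sg * c),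
   y.1.2).

Let root_gt0 w h : 0 < Num.sqrt (1 + (w ^+ 2 + h ^+ 2)) :> R.
Proof. by rewrite sqrtr_gt0; have := sqr_ge0 w; have := sqr_ge0 h; lra. Qed.

Let root2 w h : Num.sqrt (1 + (w ^+ 2 + h ^+ 2)) ^+ 2 = 1 + (w ^+ 2 + h ^+ 2) :> R.
Proof. by rewrite sqr_sqrtr// ltW// -sqrtr_gt0. Qed.

Lemma pole_scale_gt0 w h : 0 < pole_scale w h.
Proof. by rewrite invr_gt0 mulr_gt0. Qed.

Lemma pole_psi_cosd y :
  cosd a (pole_psi y) = pole_scale y.1.1 y.2 * (Phi (y.1.1, y.2)).1.
Proof. by rewrite /cosd /pole_psi /=; have c2 := cos2sin2 (y.1.2 / a); ring: c2.
Qed.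

Lemma pole_psi_sind y :
  sind a (pole_psi y) = pole_scale y.1.1 y.2 * (Phi (y.1.1, y.2)).2.
Proof. by rewrite /sind /pole_psi /=; have c2 := cos2sin2 (y.1.2 / a); ring: c2.
Qed.

Lemma pole_psi_radial2 y :
  radial (pole_psi y) ^+ 2 = pole_scale y.1.1 y.2 ^+ 2 * (y.1.1 ^+ 2 + y.2 ^+ 2).
Proof.
rewrite -(cosd2_sind2 a) pole_psi_cosd pole_psi_sind.
have := @plane_map_norm R al e al_gt0 (y.1.1, y.2).
by move: (Phi _) => u uE; rewrite !exprMn -mulrDr uE.
Qed.

Lemma pole_psi_leaf y : leaf kappa a y.2 (pole_psi y).
Proof.
have c0 := pole_scale_gt0 y.1.1 y.2; have r2 := pole_psi_radial2 y.
have q0 := root_gt0 y.1.1 y.2; have q2 := root2 y.1.1 y.2.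
have rE : radial (pole_psi y) =
    pole_scale y.1.1 y.2 * Num.sqrt (y.1.1 ^+ 2 + y.2 ^+ 2).
  apply/eqP; rewrite -(eqrXn2 (n :=
    2)) ?radial_ge0 ?mulr_ge0 ?(ltW c0) ?sqrtr_ge0//.
  by rewrite r2 exprMn sqr_sqrtr// addr_ge0 ?sqr_ge0.
split.
- apply/S2xRE; rewrite r2 /= exprMn sg2 mul1r /pole_scale -[in RHS]k2.
  by field: q2; rewrite !gt_eqF.
- rewrite r2 /= !exprMn sg2 mul1r ler_pM2l ?exprn_gt0//.
  by rewrite lerDr sqr_ge0.
- rewrite pole_psi_cosd (plane_map_fst al_gt0 e_gt0 al_e) rE -mulrA.
  congr (_ * (_ * cos _)).
  have -> : (pole_psi y).1.2 / (pole_scale y.1.1 y.2 * Num.sqrt (y.1.1 ^+ 2 + y.2 ^+ 2))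
      = sg * (Num.sqrt (y.1.1 ^+ 2 + y.2 ^+ 2))^-1.
    by rewrite /= invfM mulrA mulfK ?gt_eqF.
  move/eqP: sg2; rewrite sqrf_eq1 => /orP[/eqP ->|/eqP ->]; first by rewrite mul1r.
  by rewrite mulN1r leaf_angle_evenr.
Qed.

Lemma pole_phiK p : S2xR kappa p -> pole_domain p -> pole_psi (pole_phi p) = p.
Proof.
move=> /S2xRE Mp; rewrite /pole_domain /= => Op.
pose x := pole_plane p.
have PhiE : Phi x = (cosd a p / (sg * p.1.2), sind a p / (sg * p.1.2)).
  exact: plane_invK.
have c2 : (sg * p.1.2) ^+ 2 = p.1.2 ^+ 2 by rewrite exprMn sg2 mul1r.
have xE : x.1 ^+ 2 + x.2 ^+ 2 = radial p ^+ 2 / (sg * p.1.2) ^+ 2.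
  rewrite -(@plane_map_norm R al e al_gt0) PhiE /= -(cosd2_sind2 a).
  by rewrite !expr_div_n -mulrDl.
have cE : pole_scale x.1 x.2 = sg * p.1.2.
  rewrite /pole_scale xE.
  have -> : 1 + radial p ^+ 2 / (sg * p.1.2) ^+ 2 = (k * (sg * p.1.2))^-1 ^+ 2.
    have -> : radial p ^+ 2 = kappa^-1 - (sg * p.1.2) ^+ 2 by rewrite c2 -Mp addrK.
    have -> : kappa^-1 = (k ^+ 2)^-1 by rewrite k2.
    by move: (sg * p.1.2) Op => c c0; field; rewrite !gt_eqF.
  rewrite sqrtr_sqr gtr0_norm; last by rewrite invr_gt0 (mulr_gt0 k0 Op).
  by move: (sg * p.1.2) Op => c c0; field; rewrite !gt_eqF.
have PhiE' : Phi (x.1, x.2) = (cosd a p / (sg * p.1.2), sind a p / (sg * p.1.2)).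
  by rewrite -surjective_pairing.
rewrite /pole_psi /pole_phi -/x; cbn [fst snd]; rewrite cE PhiE'.
case: p Mp Op {x PhiE PhiE' xE cE c2} => -[[x y] z] w Mp Op.
rewrite /= in Op; congr (_, _, _, _) => /=.
- rewrite [RHS](x_cosd a (x, y, z, w)) /=; field.
  by move: Op; rewrite lt_def mulf_eq0 negb_or => /andP[/andP[-> ->]].
- rewrite [RHS](y_cosd a (x, y, z, w)) /=; field.
  by move: Op; rewrite lt_def mulf_eq0 negb_or => /andP[/andP[-> ->]].
- by rewrite mulrA -expr2 sg2 mul1r.
Qed.

Lemma pole_psiK y : pole_phi (pole_psi y) = y.
Proof.
have c0 := pole_scale_gt0 y.1.1 y.2.
have sE : sg * (pole_psi y).1.2 = pole_scale y.1.1 y.2.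
  by rewrite /= mulrA -expr2 sg2 mul1r.
rewrite /pole_phi /pole_plane sE pole_psi_cosd pole_psi_sind.
rewrite ![pole_scale _ _ * _]mulrC !mulfK ?gt_eqF// -surjective_pairing.
by rewrite plane_mapK; case: y {c0 sE} => -[].
Qed.

Lemma cts_pole_phi p : pole_domain p -> {for p, continuous pole_phi}.
Proof.
rewrite /pole_domain/= => Op; have [_ _ c3 c4] := cts_coord p.
have ci : continuous_at p (fun q : ambient => (sg * q.1.2)^-1).
  by apply: ctsV; [rewrite gt_eqF|apply: ctsM => //; exact: cts_cst].
have cp : continuous_at p pole_plane.
  have c := cts_pair (ctsM (@cts_cosd p) ci) (ctsM (@cts_sind p) ci).
  exact: (cts_compT c (@continuous_plane_inv _)).
have cp1 : continuous_at p (fun q => (pole_plane q).1).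
  exact: (cts_compT (h := fst) cp cvg_fst).
have cp2 : continuous_at p (fun q => (pole_plane q).2).
  exact: (cts_compT (h := snd) cp cvg_snd).
exact: (cts_pair (cts_pair cp1 c4) cp2).
Qed.

Lemma continuous_pole_psi : continuous pole_psi.
Proof.
move=> y.
have cy : continuous_at y (fun y : (R * R) * R => y.1) by exact: cvg_fst.
have cw : continuous_at y (fun y : (R * R) * R => y.1.1).
  exact: (cts_compT (h := fst) cy cvg_fst).
have cz : continuous_at y (fun y : (R * R) * R => y.1.2).
  exact: (cts_compT (h := snd) cy cvg_snd).
have ch : continuous_at y (fun y : (R * R) * R => y.2) by exact: cvg_snd.
have cu : continuous_at y (fun y : (R * R) * R => Phi (y.1.1, y.2)).
  exact: (cts_compT (cts_pair cw ch) (continuous_plane_map al_gt0 e_gt0 al_e (x := _))).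
have cu1 : continuous_at y (fun y : (R * R) * R => (Phi (y.1.1, y.2)).1).
  exact: (cts_compT (h := fst) cu cvg_fst).
have cu2 : continuous_at y (fun y : (R * R) * R => (Phi (y.1.1, y.2)).2).
  exact: (cts_compT (h := snd) cu cvg_snd).
have cc : continuous_at y (fun y : (R * R) * R => pole_scale y.1.1 y.2).
  apply: ctsV; first by rewrite gt_eqF// mulr_gt0.
  apply: ctsM; first exact: cts_cst.
  apply: cts_sqrt; apply: ctsD; first exact: cts_cst.
  by apply: ctsD; apply: ctsX.
have ca := ctsM cz (@cts_cst _ _ y a^-1).
have cco := cts_cos ca; have csi := cts_sin ca.
exact: (cts_pair (cts_pair (cts_pair
  (ctsM cc (ctsD (ctsM cu1 cco) (ctsM cu2 csi)))
  (ctsM cc (ctsD (ctsM cu1 csi) (ctsN (ctsM cu2 cco)))))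
  (ctsM (@cts_cst _ _ y sg) cc)) cz).
Qed.

Lemma pole_chart : chart (S2xR kappa) (S2xR kappa `&` pole_domain) pole_phi.
Proof.
apply: (chart_open (psi := pole_psi)).
- rewrite /pole_domain openE => q /= Oq.
  have c : continuous_at q (fun q : ambient => sg * q.1.2).
    by have [_ _ c3 _] := cts_coord q; exact: (ctsM (@cts_cst _ _ q sg) c3).
  by apply: (c [set x | 0 < x]); exact: lt_nbhsr.
- by move=> q _; exact: cts_pole_phi.
- exact: continuous_pole_psi.
- exact: pole_phiK.
- move=> y; split; first by have [] := pole_psi_leaf y.
  by rewrite /pole_domain /= mulrA -expr2 sg2 mul1r pole_scale_gt0.
- exact: pole_psiK.
Qed.

Lemma pole_leaf q : (S2xR kappa `&` pole_domain) q -> leaf kappa a (pole_phi q).2 q.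
Proof.
by move=> [Mq Oq]; have := pole_psi_leaf (pole_phi q); rewrite pole_phiK.
Qed.

End PoleChart.

(** * Charts around the equator *)

Section LeafLabel.
Variables (R : realType) (al e : R).
Hypotheses (al_gt0 : 0 < al) (e_gt0 : 0 < e) (al_e : al ^+ 2 + e ^+ 2 = 1 :> R).
Hypothesis e_artanh : e * artanh e <= 1.
Implicit Types h t c : R.

Local Notation LA := (leaf_angle al e).

(** On the edge the angle is 0 for h > 0 and pi for h < 0. *)
Lemma leaf_angle_slope_lt1 h t : (t * h) ^+ 2 <= 1 -> 0 < LA h t < pi ->
  (t * h) ^+ 2 < 1.
Proof.
move=> th LA0; rewrite lt_neqAle th andbT; apply/eqP => E.
have [h0|h0|h0] := ltgtP h 0; last by move: E; rewrite h0 mulr0 expr0n/= =>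
  /esym/eqP; rewrite oner_eq0.
- have h0' : 0 < - h by rewrite oppr_gt0.
  have := @leaf_angle_edge _ al e al_gt0 (- h) t h0'.
  rewrite mulrN sqrrN => /(_ E); rewrite leaf_angleN// => /eqP.
  by rewrite subr_eq0 => /eqP pE; move: LA0; rewrite -pE ltxx andbF.
- by move: LA0; rewrite leaf_angle_edge// ltxx.
Qed.

(** The inverse of [leaf_angle] in its label, with default value 0; it is relied upon for 0 < c <
    pi, where [leaf_labelP] shows that the set is inhabited. *)
Definition leaf_label t c : R := xget 0 [set h | (t * h) ^+ 2 <= 1 /\ LA h t = c].

Lemma leaf_labelP t c : 0 < c < pi ->
  (t * leaf_label t c) ^+ 2 < 1 /\ LA (leaf_label t c) t = c.
Proof.
move=> c0.
have [th hc] : (t * leaf_label t c) ^+ 2 <= 1 /\ LA (leaf_label t c) t = c.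
  apply: (@xgetPex _ 0 [set h | (t * h) ^+ 2 <= 1 /\ LA h t = c]).
  have cs : sin c ^+ 2 > 0 by rewrite exprn_gt0// sin_gt0_pi.
  have c1 : -1 < cos c < 1 by apply: sqr_lt1; rewrite cos2sin2; lra.
  have c2 : -1 <= cos c <= 1 by rewrite cos_geN1 cos_le1.
  have tc : t != 0 \/ -1 < cos c < 1 by right.
  have [h th hc] := leaf_angle_onto al_gt0 e_gt0 al_e e_artanh c2 tc.
  have hI := leaf_angle_itv al_gt0 e_gt0 al_e e_artanh th.
  exists h; split=> //; apply: cos_inj => //; rewrite in_itv//=.
  by case/andP: c0 => /ltW -> /ltW ->.
by split=> //; apply: leaf_angle_slope_lt1 => //; rewrite hc.
Qed.

Lemma leaf_labelK t h : (t * h) ^+ 2 < 1 -> leaf_label t (LA h t) = h.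
Proof.
move=> th; have [th' E] :=
  leaf_labelP t (leaf_angle_itvo al_gt0 e_gt0 al_e e_artanh th).
exact: (leaf_angle_inj al_gt0 e_gt0 al_e e_artanh (ltW th') (ltW th) E).
Qed.

(** An implicit function theorem by monotonicity, since the derivative in h may vanish: the label is
    squeezed between h0 - d and h0 + d, where the strict inequalities on the angle persist for
    nearby slopes and levels. *)
Lemma cts_leaf_label (T : topologicalType) (x : T) (f g : T -> R) :
  continuous_at x f -> continuous_at x g -> 0 < g x < pi ->
  continuous_at x (fun y => leaf_label (f y) (g y)).
Proof.
move=> cf cg gx; have [th0 hE] := leaf_labelP (f x) gx.
set h0 := leaf_label (f x) (g x) in th0 hE *.
have near_lt (d d' : T -> R) : continuous_at x d -> continuous_at x d' ->
    d x < d' x -> \forall y \near x, d y < d' y.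
  move=> cd cd' dd'; have c := ctsD cd' (ctsN cd).
  have H : \forall y \near d' x - d x, 0 < y by apply: lt_nbhsr; rewrite subr_gt0.
  have n : \forall y \near x, 0 < d' y - d y by exact: c _ H.
  by apply: filterS n => y; rewrite subr_gt0.
apply/cvgrPdist_lt => eps eps0.
(* The labels h0 - d and h0 + d must also stay off the edge, so that [leaf_angle] is continuous
   there. *)
have [d [d0 deps tm tp]] : exists d, [/\ 0 < d, d <= eps,
    (f x * (h0 - d)) ^+ 2 < 1 & (f x * (h0 + d)) ^+ 2 < 1].
  have c1 : continuous_at (0 : R) (fun d => (f x * (h0 + d)) ^+ 2) by cts.
  have c2 : continuous_at (0 : R) (fun d => (f x * (h0 - d)) ^+ 2) by cts.
  have H : \forall y \near (f x * h0) ^+ 2, y < 1 by apply: lt_nbhsl.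
  have n1 : \forall d \near (0 : R), (f x * (h0 + d)) ^+ 2 < 1.
    by have := c1; rewrite /continuous_at addr0 => /(_ _ H).
  have n2 : \forall d \near (0 : R), (f x * (h0 - d)) ^+ 2 < 1.
    by have := c2; rewrite /continuous_at subr0 => /(_ _ H).
  have /nbhs_ballP[r /= r0 rH] : \forall d \near (0 : R),
      (f x * (h0 + d)) ^+ 2 < 1 /\ (f x * (h0 - d)) ^+ 2 < 1.
    by near=> d; split; near: d.
  exists (Num.min eps (r / 2)).
  have m0 : 0 < Num.min eps (r / 2) by rewrite lt_min eps0 divr_gt0.
  have mr : Num.min eps (r / 2) <= r / 2 by rewrite ge_min lexx orbT.
  have [|? ?] := rH (Num.min eps (r / 2)).
    by rewrite /ball/= sub0r normrN gtr0_norm//; lra.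
  by split=> //; rewrite ge_min lexx.
have lt1 : LA (h0 + d) (f x) < g x.
  rewrite -hE; apply: leaf_angle_decr => //; [exact: ltW|exact: ltW|lra].
have lt2 : g x < LA (h0 - d) (f x).
  rewrite -hE; apply: leaf_angle_decr => //; [exact: ltW|exact: ltW|lra].
have cp : continuous_at x (fun y => LA (h0 + d) (f y)).
  by apply: cts_leaf_angle => //; exact: cts_cst.
have cm : continuous_at x (fun y => LA (h0 - d) (f y)).
  by apply: cts_leaf_angle => //; exact: cts_cst.
have n1 := near_lt _ _ cp cg lt1.
have n2 := near_lt _ _ cg cm lt2.
have n3 : \forall y \near x, (f y * (h0 + d)) ^+ 2 < 1.
  apply: (near_lt (fun y => (f y * (h0 + d)) ^+ 2) (fun=> 1)) => //.
    by cts.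
  exact: cts_cst.
have n4 : \forall y \near x, (f y * (h0 - d)) ^+ 2 < 1.
  apply: (near_lt (fun y => (f y * (h0 - d)) ^+ 2) (fun=> 1)) => //.
    by cts.
  exact: cts_cst.
have n5 := near_lt _ _ (@cts_cst _ _ x 0) cg (proj1 (andP gx)).
have n6 := near_lt _ _ cg (@cts_cst _ _ x pi) (proj2 (andP gx)).
near=> y.
have g1 : 0 < g y < pi by apply/andP; split; near: y; [exact: n5|exact: n6].
have [ty yE] := leaf_labelP (f y) g1.
set h := leaf_label (f y) (g y) in ty yE *.
have a1 : LA (h0 + d) (f y) < g y by near: y; exact: n1.
have a2 : g y < LA (h0 - d) (f y) by near: y; exact: n2.
have b1 : (f y * (h0 + d)) ^+ 2 < 1 by near: y; exact: n3.
have b2 : (f y * (h0 - d)) ^+ 2 < 1 by near: y; exact: n4.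
have l1 : h < h0 + d.
  rewrite ltNge le_eqVlt; apply/negP => /predU1P[hh|hh].
    by move: a1; rewrite -yE hh ltxx.
  have := leaf_angle_decr al_gt0 e_gt0 al_e e_artanh (ltW b1) (ltW ty) hh.
  by rewrite yE => hh'; move: (lt_trans a1 hh'); rewrite ltxx.
have l2 : h0 - d < h.
  rewrite ltNge le_eqVlt; apply/negP => /predU1P[hh|hh].
    by move: a2; rewrite -yE hh ltxx.
  have := leaf_angle_decr al_gt0 e_gt0 al_e e_artanh (ltW ty) (ltW b2) hh.
  by rewrite yE => hh'; move: (lt_trans a2 hh'); rewrite ltxx.
change (`|h0 - h| < eps); rewrite ltr_norml; clear - l1 l2 deps.
by apply/andP; split; lra.
Unshelve. all: by end_near. Qed.

End LeafLabel.

Section EquatorChart.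
Variables (R : realType) (kappa a th0 sg : R).
Hypotheses (kappa_gt0 : 0 < kappa) (a_neq0 : a != 0) (sg2 : sg ^+ 2 = 1 :> R).
Local Notation ambient := (Defs.space R).
Local Notation k := (Num.sqrt kappa).
Local Notation al := (coecc kappa a).
Local Notation e := (ecc kappa a).
Hypothesis e_artanh : e * artanh e <= 1.

Let al_gt0 : 0 < al := coecc_gt0 kappa_gt0 a_neq0.
Let e_gt0 : 0 < e := ecc_gt0 a kappa_gt0.
Let al_e : al ^+ 2 + e ^+ 2 = 1 := coecc2_ecc2 a kappa_gt0.
Let k0 : 0 < k := sqrt_kappa_gt0 kappa_gt0.
Let k2 : k ^+ 2 = kappa := sqr_sqrt_kappa kappa_gt0.

Definition rot_x (q : ambient) : R := q.1.1.1 * cos th0 + q.1.1.2 * sin th0.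
Definition rot_y (q : ambient) : R := q.1.1.2 * cos th0 - q.1.1.1 * sin th0.
(** A continuous branch of theta on the half-space [rot_x] > 0 facing the direction th0. *)
Definition eq_angle (q : ambient) : R := th0 + atan (rot_y q / rot_x q).
(** The helical angle, with sg = +- 1 choosing the sheet on which it is beta. *)
Definition eq_level (q : ambient) : R := sg * (q.2 / a - eq_angle q).
Definition eq_slope (q : ambient) : R := q.1.2 / radial q.

Definition eq_domain : set ambient :=
  [set q | 0 < rot_x q /\ 0 < eq_level q < pi].

Definition eq_label (q : ambient) : R := leaf_label al e (eq_slope q) (eq_level q).

(** The first coordinate stretches the slopes with |t h| < 1 onto the whole line, so that every
    plaque is a full plane; [eq_t] undoes it. *)
Definition eq_phi (q : ambient) : (R * R) * R :=
  ((eq_slope q / Num.sqrt (1 - (eq_slope q * eq_label q) ^+ 2),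
    rot_y q / rot_x q), eq_label q).

Definition eq_t (tau h : R) : R := tau / Num.sqrt (1 + (tau * h) ^+ 2).
Definition eq_scale (t : R) : R := (k * Num.sqrt (1 + t ^+ 2))^-1.

Definition eq_psi (y : (R * R) * R) : ambient :=
  let t := eq_t y.1.1 y.2 in let c := eq_scale t in let u := th0 + atan y.1.2 in
  ((c * cos u, c * sin u, t * c), a * (u + sg * leaf_angle al e y.2 t)).

Lemma sqr_rot q : rot_x q ^+ 2 + rot_y q ^+ 2 = radial q ^+ 2.
Proof. by rewrite radial2 /rot_x /rot_y; have c2 := cos2sin2 th0; ring: c2. Qed.

Lemma rot_radial_gt0 q : 0 < rot_x q -> 0 < radial q.
Proof.
move=> x0; rewrite lt_def radial_ge0 andbT -sqrf_eq0 -sqr_rot gt_eqF//.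
by rewrite ltr_wpDr ?sqr_ge0 ?exprn_gt0.
Qed.

Lemma sin_atan (x : R) : sin (atan x) = x / Num.sqrt (1 + x ^+ 2).
Proof.
rewrite -cos_atan -[X in X * cos _]atanK /tan divfK// cos_atan invr_neq0//.
by rewrite gt_eqF ?sqrt1D_gt0.
Qed.

Lemma rot_sqrt q : 0 < rot_x q ->
  Num.sqrt (1 + (rot_y q / rot_x q) ^+ 2) = radial q / rot_x q.
Proof.
move=> x0; have r0 := rot_radial_gt0 x0; have r2 := sqr_rot q.
rewrite -[RHS]ger0_norm; last by rewrite divr_ge0 ?ltW.
rewrite -[RHS]sqrtr_sqr; congr Num.sqrt.
by rewrite expr_div_n [RHS]expr_div_n -r2; field; rewrite gt_eqF.
Qed.

Lemma eq_angle_x q : 0 < rot_x q -> q.1.1.1 = radial q * cos (eq_angle q).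
Proof.
move=> x0; have r0 := rot_radial_gt0 x0.
rewrite /eq_angle cosD cos_atan sin_atan rot_sqrt//.
have -> : radial q * (cos th0 * (radial q / rot_x q)^-1 -
    sin th0 * (rot_y q / rot_x q / (radial q / rot_x q))) =
    cos th0 * rot_x q - sin th0 * rot_y q by field; rewrite !gt_eqF.
by rewrite /rot_x /rot_y; have c2 := cos2sin2 th0; ring: c2.
Qed.

Lemma eq_angle_y q : 0 < rot_x q -> q.1.1.2 = radial q * sin (eq_angle q).
Proof.
move=> x0; have r0 := rot_radial_gt0 x0.
rewrite /eq_angle sinD cos_atan sin_atan rot_sqrt//.
have -> : radial q * (sin th0 * (radial q / rot_x q)^-1 +
    cos th0 * (rot_y q / rot_x q / (radial q / rot_x q))) =
    sin th0 * rot_x q + cos th0 * rot_y q by field; rewrite !gt_eqF.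
by rewrite /rot_x /rot_y; have c2 := cos2sin2 th0; ring: c2.
Qed.

Let sqrt1D2_gt0 (x : R) : 0 < Num.sqrt (1 + x ^+ 2).
Proof. exact: sqrt1D_gt0. Qed.

Lemma eq_scale_gt0 t : 0 < eq_scale t.
Proof. by rewrite invr_gt0 mulr_gt0. Qed.

Lemma eq_t_slope tau h : 1 - (eq_t tau h * h) ^+ 2 = (Num.sqrt (1 + (tau * h) ^+ 2))^-1 ^+ 2.
Proof.
rewrite /eq_t; have n0 := sqrt1D2_gt0 (tau * h); have n2 := sqr_sqrt1D (tau * h).
by field: n2; rewrite gt_eqF.
Qed.

Lemma eq_t_lt1 tau h : (eq_t tau h * h) ^+ 2 < 1.
Proof. by rewrite -subr_gt0 eq_t_slope exprn_gt0// invr_gt0. Qed.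

Lemma eq_tK tau h : eq_t tau h / Num.sqrt (1 - (eq_t tau h * h) ^+ 2) = tau.
Proof.
rewrite eq_t_slope sqrtr_sqr gtr0_norm ?invr_gt0// invrK /eq_t divfK//.
by rewrite gt_eqF.
Qed.

Lemma eq_tE t h : (t * h) ^+ 2 < 1 -> eq_t (t / Num.sqrt (1 - (t * h) ^+ 2)) h = t.
Proof.
move=> th; have s0 : 0 < 1 - (t * h) ^+ 2 by rewrite subr_gt0.
have n0 : 0 < Num.sqrt (1 - (t * h) ^+ 2) by rewrite sqrtr_gt0.
have n2 := sqr_sqrtr (ltW s0); rewrite /eq_t.
set n := Num.sqrt (1 - _) in n0 n2 *.
have -> : 1 + (t / n * h) ^+ 2 = n^-1 ^+ 2.
  by field: n2; rewrite gt_eqF.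
by rewrite sqrtr_sqr gtr0_norm ?invr_gt0// invrK divfK// gt_eqF.
Qed.

Section PsiValues.
Variable y : (R * R) * R.
Let t := eq_t y.1.1 y.2.
Let c := eq_scale t.
Let LA := leaf_angle al e y.2 t.

Lemma eq_psi_rot_x : rot_x (eq_psi y) = c * cos (atan y.1.2).
Proof.
rewrite /rot_x /eq_psi /= -/t -/c cosD sinD.
by have c2 := cos2sin2 th0; ring: c2.
Qed.

Lemma eq_psi_rot_y : rot_y (eq_psi y) = c * sin (atan y.1.2).
Proof.
rewrite /rot_y /eq_psi /= -/t -/c cosD sinD.
by have c2 := cos2sin2 th0; ring: c2.
Qed.

Lemma eq_psi_rot_x_gt0 : 0 < rot_x (eq_psi y).
Proof. by rewrite eq_psi_rot_x mulr_gt0 ?eq_scale_gt0// cos_atan invr_gt0. Qed.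

Lemma eq_psi_radial : radial (eq_psi y) = c.
Proof.
apply/eqP; rewrite -(eqrXn2 (n := 2)) ?radial_ge0 ?(ltW (eq_scale_gt0 _))//.
rewrite radial2 /eq_psi /= -/t -/c; apply/eqP.
by have c2 := cos2sin2 (th0 + atan y.1.2); ring: c2.
Qed.

Lemma eq_psi_ratio : rot_y (eq_psi y) / rot_x (eq_psi y) = y.1.2.
Proof.
rewrite eq_psi_rot_x eq_psi_rot_y -mulf_div divff ?gt_eqF ?eq_scale_gt0// mul1r.
exact: atanK.
Qed.

Lemma eq_psi_slope : eq_slope (eq_psi y) = t.
Proof.
by rewrite /eq_slope eq_psi_radial /= -/t -/c mulfK// gt_eqF ?eq_scale_gt0.
Qed.

Lemma eq_psi_level : eq_level (eq_psi y) = LA.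
Proof.
rewrite /eq_level /eq_angle eq_psi_ratio /eq_psi /= -/t -/LA.
have -> : a * (th0 + atan y.1.2 + sg * LA) / a = th0 + atan y.1.2 + sg * LA.
  by rewrite mulrC mulKf.
by rewrite addrAC subrr add0r mulrA -expr2 sg2 mul1r.
Qed.

Lemma eq_psi_level_itv : 0 < eq_level (eq_psi y) < pi.
Proof.
by rewrite eq_psi_level; apply: (leaf_angle_itvo al_gt0 e_gt0 al_e e_artanh);
  exact: eq_t_lt1.
Qed.

Lemma eq_psi_label : eq_label (eq_psi y) = y.2.
Proof.
rewrite /eq_label eq_psi_slope eq_psi_level.
by apply: (leaf_labelK al_gt0 e_gt0 al_e e_artanh); exact: eq_t_lt1.
Qed.

Lemma eq_psiK : eq_phi (eq_psi y) = y.
Proof.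
rewrite /eq_phi eq_psi_label eq_psi_ratio eq_psi_slope eq_tK.
by case: y => -[].
Qed.

Lemma eq_psi_leaf : leaf kappa a y.2 (eq_psi y).
Proof.
have c0 := eq_scale_gt0 t; have t1 := eq_t_lt1 y.1.1 y.2.
split.
- apply/S2xRE; rewrite eq_psi_radial /= -/t -/c exprMn.
  have n0 := sqrt1D2_gt0 t; have n2 := sqr_sqrt1D t.
  have -> : kappa^-1 = (k ^+ 2)^-1 by rewrite k2.
  by rewrite /c /eq_scale; field: n2; rewrite !gt_eqF.
- rewrite eq_psi_radial /= -/t -/c mulrAC exprMn.
  by rewrite ler_piMl ?sqr_ge0// ltW.
- rewrite -/(eq_slope _) eq_psi_slope eq_psi_radial -/t -/LA.
  rewrite /cosd /eq_psi /= -/t -/c -/LA.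
  rewrite [a * _ / a]mulrC mulKf// -!mulrA -mulrDr; congr (_ * _).
  rewrite -cosB opprD addNKr cosN.
  move/eqP: sg2; rewrite sqrf_eq1 => /orP[/eqP ->|/eqP ->]; first by rewrite mul1r.
  by rewrite mulN1r cosN.
Qed.

End PsiValues.

Lemma eq_labelP q : eq_domain q -> (eq_slope q * eq_label q) ^+ 2 < 1 /\
  leaf_angle al e (eq_label q) (eq_slope q) = eq_level q.
Proof.
by move=> [x0 c0]; exact: (leaf_labelP al_gt0 e_gt0 al_e e_artanh _ c0).
Qed.

Lemma eq_phiK p : S2xR kappa p -> eq_domain p -> eq_psi (eq_phi p) = p.
Proof.
move=> /S2xRE Mp Dp; have [t1 LE] := eq_labelP Dp; case: Dp => x0 _.
have r0 := rot_radial_gt0 x0.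
rewrite /eq_psi /eq_phi; cbn [fst snd]; rewrite eq_tE// LE -/(eq_angle p).
have cE : eq_scale (eq_slope p) = radial p.
  rewrite /eq_scale.
  have -> : 1 + eq_slope p ^+ 2 = (k * radial p)^-1 ^+ 2.
    have rE : radial p ^+ 2 + p.1.2 ^+ 2 = (k ^+ 2)^-1 by rewrite k2.
    have zE : p.1.2 ^+ 2 = (k ^+ 2)^-1 - radial p ^+ 2 by rewrite -rE addrC addKr.
    rewrite /eq_slope expr_div_n zE; move: (radial p) r0 => r r0.
    by field; rewrite !gt_eqF.
  rewrite sqrtr_sqr gtr0_norm ?invr_gt0 ?mulr_gt0//.
  by move: (radial p) r0 => r r0; field; rewrite !gt_eqF.
rewrite cE -eq_angle_x// -eq_angle_y// /eq_level mulrA -expr2 sg2 mul1r subrKC.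
have -> : a * (p.2 / a) = p.2 by rewrite mulrC divfK.
have -> : eq_slope p * radial p = p.1.2 by rewrite /eq_slope divfK// gt_eqF.
by case: p {Mp t1 LE x0 r0 cE} => -[[]].
Qed.

Lemma cts_eq_data q : 0 < rot_x q ->
  [/\ continuous_at q rot_x, continuous_at q (fun q => rot_y q / rot_x q),
      continuous_at q eq_level & continuous_at q eq_slope].
Proof.
move=> x0; have r0 := rot_radial_gt0 x0; have [c1 c2 c3 c4] := cts_coord q.
have cx : continuous_at q rot_x.
  exact: (ctsD (ctsM c1 (@cts_cst _ _ q _)) (ctsM c2 (@cts_cst _ _ q _))).
have cy : continuous_at q rot_y.
  exact: (ctsD (ctsM c2 (@cts_cst _ _ q _)) (ctsN (ctsM c1 (@cts_cst _ _ q _)))).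
have cT : continuous_at q (fun q => rot_y q / rot_x q).
  by apply: ctsM => //; apply: ctsV => //; rewrite gt_eqF.
split=> //.
- apply: ctsM; first exact: cts_cst.
  apply: ctsD; first exact: (ctsM c4 (@cts_cst _ _ q _)).
  apply: ctsN; apply: ctsD; first exact: cts_cst.
  exact: cts_atan.
- apply: ctsM => //; apply: ctsV; first by rewrite gt_eqF.
  by apply: cts_sqrt; apply: ctsD; apply: ctsX.
Qed.

Lemma cts_eq_phi q : eq_domain q -> {for q, continuous eq_phi}.
Proof.
move=> Dq; have [t1 _] := eq_labelP Dq; case: Dq => x0 c0.
have [_ cT cl cs] := cts_eq_data x0.
have ch : continuous_at q eq_label.
  exact: (cts_leaf_label al_gt0 e_gt0 al_e e_artanh cs cl c0).
have cq : continuous_at q (fun q =>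
    eq_slope q / Num.sqrt (1 - (eq_slope q * eq_label q) ^+ 2)).
  apply: ctsM => //; apply: ctsV; first by rewrite gt_eqF// sqrtr_gt0 subr_gt0.
  apply: cts_sqrt; apply: ctsD; first exact: cts_cst.
  by apply: ctsN; apply: ctsX; exact: ctsM.
exact: (cts_pair (cts_pair cq cT) ch).
Qed.

Lemma continuous_eq_psi : continuous eq_psi.
Proof.
move=> y.
have cy : continuous_at y (fun y : (R * R) * R => y.1) by exact: cvg_fst.
have cw : continuous_at y (fun y : (R * R) * R => y.1.1).
  exact: (cts_compT (h := fst) cy cvg_fst).
have cz : continuous_at y (fun y : (R * R) * R => y.1.2).
  exact: (cts_compT (h := snd) cy cvg_snd).
have ch : continuous_at y (fun y : (R * R) * R => y.2) by exact: cvg_snd.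
have ct : continuous_at y (fun y : (R * R) * R => eq_t y.1.1 y.2).
  apply: ctsM => //; apply: ctsV; first by rewrite gt_eqF.
  apply: cts_sqrt; apply: ctsD; first exact: cts_cst.
  by apply: ctsX; exact: ctsM.
have cc : continuous_at y (fun y : (R * R) * R => eq_scale (eq_t y.1.1 y.2)).
  apply: ctsV; first by rewrite gt_eqF// mulr_gt0.
  apply: ctsM; first exact: cts_cst.
  by apply: cts_sqrt; apply: ctsD; [exact: cts_cst|exact: ctsX].
have cu : continuous_at y (fun y : (R * R) * R => th0 + atan y.1.2).
  by apply: ctsD; [exact: cts_cst|exact: cts_atan].
have cl : continuous_at y (fun y : (R * R) * R =>
  leaf_angle al e y.2 (eq_t y.1.1 y.2)).
  by apply: cts_leaf_angle => //; exact: eq_t_lt1.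
exact: (cts_pair (cts_pair (cts_pair (ctsM cc (cts_cos cu)) (ctsM cc (cts_sin cu)))
  (ctsM ct cc)) (ctsM (@cts_cst _ _ y a) (ctsD cu (ctsM (@cts_cst _ _ y sg) cl)))).
Qed.

Lemma eq_domain_open : open eq_domain.
Proof.
rewrite openE => q [x0 /andP[c0 c1]].
have [cx _ cl _] := cts_eq_data x0.
have n1 : \forall y \near q, 0 < rot_x y.
  have H : \forall z \near rot_x q, 0 < z by apply: lt_nbhsr.
  exact: cx _ H.
have n2 : \forall y \near q, 0 < eq_level y.
  have H : \forall z \near eq_level q, 0 < z by apply: lt_nbhsr.
  exact: cl _ H.
have n3 : \forall y \near q, eq_level y < pi.
  have H : \forall z \near eq_level q, z < pi by apply: lt_nbhsl.
  exact: cl _ H.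
rewrite /interior /nbhs/=; near=> y; split; first by near: y; exact: n1.
by apply/andP; split; near: y; [exact: n2|exact: n3].
Unshelve. all: by end_near. Qed.

Lemma eq_chart : chart (S2xR kappa) (S2xR kappa `&` eq_domain) eq_phi.
Proof.
apply: (chart_open (psi := eq_psi)).
- exact: eq_domain_open.
- by move=> q _; exact: cts_eq_phi.
- exact: continuous_eq_psi.
- exact: eq_phiK.
- move=> y; split; first by have [] := eq_psi_leaf y.
  by split; [exact: eq_psi_rot_x_gt0|exact: eq_psi_level_itv].
- exact: eq_psiK.
Qed.

Lemma eq_leaf q : (S2xR kappa `&` eq_domain) q -> leaf kappa a (eq_phi q).2 q.
Proof.
by move=> [Mq Oq]; have := eq_psi_leaf (eq_phi q); rewrite eq_phiK.
Qed.

End EquatorChart.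

(** * The theorem *)

Section Foliation.
Variables (R : realType) (kappa a : R).
Hypotheses (kappa_gt0 : 0 < kappa) (a_neq0 : a != 0).
Local Notation ambient := (Defs.space R).
Local Notation k := (Num.sqrt kappa).
Local Notation al := (coecc kappa a).
Local Notation e := (ecc kappa a).
Local Notation M := (S2xR kappa).
Hypothesis e_artanh : e * artanh e <= 1.

Let k0 : 0 < k := sqrt_kappa_gt0 kappa_gt0.
Let k2 : k ^+ 2 = kappa := sqr_sqrt_kappa kappa_gt0.

Definition on_limit (p : ambient) : Prop :=
  p.1.2 = 0 /\ cosd a p ^+ 2 = radial p ^+ 2.

Lemma leaf_chart p : M p -> ~ on_limit p ->
  exists V phi, [/\ chart M V phi, V p & forall q, V q -> leaf kappa a (phi q).2 q].
Proof.
move=> Mp Lp; have [Z|Z|Z] := ltgtP p.1.2 0.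
- have sg2 : (-1) ^+ 2 = 1 :> R by rewrite sqrrN expr1n.
  exists (M `&` pole_domain (-1)),
    (pole_phi (-1) kappa_gt0 a_neq0 e_artanh); split.
  + exact: pole_chart.
  + by split=> //; rewrite /pole_domain /= mulN1r oppr_gt0.
  + exact: pole_leaf.
- have sg2 : 1 ^+ 2 = 1 :> R by rewrite expr1n.
  exists (M `&` pole_domain 1), (pole_phi 1 kappa_gt0 a_neq0 e_artanh); split.
  + exact: pole_chart.
  + by split=> //; rewrite /pole_domain /= mul1r.
  + exact: pole_leaf.
have r0 : 0 < radial p.
  rewrite lt_def radial_ge0 andbT; apply/eqP => /(radial0_alt kappa_gt0 Mp).
  by rewrite Z eqxx.
have r2 : 0 < radial p ^+ 2 by exact: exprn_gt0.
have cs := cosd2_sind2 a p.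
have c1 : (cosd a p / radial p) ^+ 2 < 1.
  rewrite expr_div_n ltr_pdivrMr// mul1r lt_neqAle; apply/andP; split.
    by apply/eqP => E; apply: Lp.
  by rewrite -cs lerDl sqr_ge0.
have /andP[c2 c3] := sqr_lt1 c1.
have c1' : -1 <= cosd a p / radial p <= 1 by rewrite (ltW c2) (ltW c3).
pose chi := acos (cosd a p / radial p).
have chi0 : 0 < chi < pi by rewrite acos_gt0 ?acos_ltpi ?c2 ?c3 ?(ltW c2) ?(ltW c3).
have cchi : cos chi = cosd a p / radial p by rewrite acosK.
have schi : sin chi = `|sind a p| / radial p.
  rewrite sin_acos// -[RHS]ger0_norm ?divr_ge0 ?(ltW r0)//.
  rewrite -[RHS]sqrtr_sqr; congr Num.sqrt;
    rewrite !expr_div_n real_normK ?num_real//.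
  have -> : sind a p ^+ 2 = radial p ^+ 2 - cosd a p ^+ 2 by rewrite -cs addrC addKr.
  by field; rewrite gt_eqF.
have [sg [sg2 sgE]] : exists sg : R, sg ^+ 2 = 1 /\ sg * `|sind a p| = sind a p.
  have [s0|s0] := ger0P (sind a p); first by exists 1; rewrite expr1n mul1r.
  by exists (-1); rewrite sqrrN expr1n mulN1r opprK.
have sschi : sin (sg * chi) = sind a p / radial p.
  rewrite -sgE -mulrA -schi.
  by move/eqP: sg2; rewrite sqrf_eq1 => /orP[] /eqP ->;
    rewrite ?mul1r// !mulN1r sinN.
have cschi : cos (sg * chi) = cosd a p / radial p.
  rewrite -cchi.
  by move/eqP: sg2; rewrite sqrf_eq1 => /orP[] /eqP ->;
    rewrite ?mul1r// mulN1r cosN.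
(* With this direction p lies at the centre of the chart: [rot_y] is 0 and the level is chi, the
   helical angle of p without its sign. *)
pose th0 := p.2 / a - sg * chi.
have xE : rot_x th0 p = radial p.
  rewrite /rot_x /th0 cosB sinB cschi sschi.
  transitivity ((cosd a p ^+ 2 + sind a p ^+ 2) / radial p).
    by rewrite /cosd /sind; field; rewrite gt_eqF.
  by rewrite cs expr2 mulfK// gt_eqF.
have yE : rot_y th0 p = 0.
  rewrite /rot_y /th0 cosB sinB cschi sschi.
  by rewrite /cosd /sind; field; rewrite gt_eqF.
exists (M `&` eq_domain a th0 sg), (eq_phi kappa a th0 sg); split.
- exact: eq_chart.
- split=> //; split; first by rewrite xE.
  rewrite /eq_level /eq_angle yE mul0r atan0 addr0 /th0 opprB [_ + (_ - _)]addrC subrK.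
  by rewrite mulrA -expr2 sg2 mul1r.
- exact: eq_leaf.
Qed.

Lemma limit_geodesicE p : M p ->
  limit_geodesic kappa a p <-> (p.1.2 = 0 /\ cosd a p = radial p).
Proof.
move=> Mp.
have snE : sn kappa (pi / (2 * k)) = k^-1.
  rewrite /sn (_ : k * (pi / (2 * k)) = pi / 2) ?sin_pihalf ?mul1r//.
  by field; rewrite gt_eqF.
have csE : cs kappa (pi / (2 * k)) = 0.
  rewrite /cs (_ : k * (pi / (2 * k)) = pi / 2) ?cos_pihalf//.
  by field; rewrite gt_eqF.
split.
  move=> [s _ <-]; rewrite /cyl snE csE mul0r /=; split=> //.
  rewrite /cosd /radial /=; have -> : a * s / a = s by rewrite mulrC mulKf.
  have -> : (k^-1 * cos s) ^+ 2 + (k^-1 * sin s) ^+ 2 = k^-1 ^+ 2.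
    by have c2 := cos2sin2 s; ring: c2.
  rewrite sqrtr_sqr gtr0_norm ?invr_gt0//.
  by have c2 := cos2sin2 s; ring: c2.
move=> [Z C]; exists (p.2 / a) => //.
have s0 : sind a p = 0.
  have /eqP := cosd2_sind2 a p; rewrite C -subr_eq0 addrAC subrr add0r sqrf_eq0.
  by move/eqP.
have rE : radial p = k^-1.
  apply/eqP; rewrite -(eqrXn2 (n := 2)) ?radial_ge0 ?invr_ge0 ?(ltW k0)//.
  by have /S2xRE := Mp; rewrite Z expr0n/= addr0 => ->; rewrite exprVn k2.
rewrite /cyl snE csE mul0r.
case: p Mp Z C s0 rE => -[[x y] z] w Mp Z C s0 rE.
rewrite /= in Z; rewrite Z; congr (_, _, _, _).
- by rewrite [RHS](x_cosd a (x, y, z, w)) s0 C rE mul0r addr0.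
- by rewrite [RHS](y_cosd a (x, y, z, w)) s0 C rE mul0r subr0.
- by rewrite /= mulrC divfK.
Qed.

Lemma opposite_limit_geodesicE p :
  opposite_limit_geodesic kappa a p <->
  limit_geodesic kappa a (p.1, p.2 - pi * `|a|).
Proof.
split=> -[s _ sE]; exists s => //.
  by rewrite -sE /cyl /= addrK.
by case: p sE => p w [<- swE]; rewrite /cyl swE /= subrK.
Qed.

Lemma limits_on_limit p : M p ->
  (limit_geodesic kappa a p \/ opposite_limit_geodesic kappa a p) <-> on_limit p.
Proof.
move=> Mp; rewrite opposite_limit_geodesicE !limit_geodesicE//.
have cN : cosd a (p.1, p.2 - pi * `|a|) = - cosd a p.
  have cc : cos (pi * `|a| / a) = -1 /\ sin (pi * `|a| / a) = 0.
    rewrite -mulrA; case: (normr_div_self a_neq0) => ->;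
      by rewrite ?mulr1 ?mulrN1 ?cosN ?sinN cospi sinpi ?oppr0.
  rewrite /cosd /= mulrBl cosB sinB; case: cc => -> ->; ring.
have rN : radial (p.1, p.2 - pi * `|a|) = radial p by [].
rewrite cN rN /on_limit /=; split.
  by move=> [] [-> cE]; split=> //; rewrite -cE ?sqrrN.
move=> [-> /eqP]; rewrite eqf_sqr => /orP[/eqP ->|/eqP ->]; first by left.
by right; rewrite opprK.
Qed.

Let L (H : R) : set ambient := leaf kappa a (2 * H / k).

Let half_scale (h : R) : 2 * (h * k / 2) / k = h.
Proof. by field; rewrite gt_eqF. Qed.

Let L_disjoint H H' p : L H p -> L H' p -> H = H'.
Proof.
move=> h1 h2; have := leaf_disjoint kappa_gt0 a_neq0 e_artanh h1 h2.
move=> /(congr1 (fun x => x * k / 2)).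
have E (x : R) : 2 * x / k * k / 2 = x by field; rewrite gt_eqF.
by rewrite !E.
Qed.

Lemma foliates_tubes :
  foliates M ([set p | M p /\ 0 < cosd a p] `\` limit_geodesic kappa a)
    (tubes kappa a).
Proof.
apply: (foliates_labelled (L := L)).
- by move=> H H0; exact: (support_tube kappa_gt0 a_neq0 H0).
- by move=> H H0; exact: (immersion_tube a kappa_gt0 H0).
- move=> H H0; rewrite /L -(support_tube kappa_gt0 a_neq0 H0).
  by apply: connected_support; exact: continuous_tube.
- exact: L_disjoint.
- move=> p; split=> [[[Mp c0] Gp]|[H H0 Lp]].
    have nl : ~ on_limit p.
      move=> [Z /eqP]; rewrite eqf_sqr => /orP[/eqP cE|/eqP cE].
        by apply: Gp; apply/limit_geodesicE.
      by move: c0; rewrite cE oppr_gt0 ltNge radial_ge0.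
    have [h Lh] := leaf_cover kappa_gt0 a_neq0 e_artanh Mp nl.
    exists (h * k / 2); last by rewrite /L half_scale.
    have h0 := (leaf_sign kappa_gt0 a_neq0 e_artanh Lh).2 c0.
    by rewrite /= divr_gt0// mulr_gt0.
  have h0 : 0 < 2 * H / k by rewrite divr_gt0// mulr_gt0.
  have Mp : M p by case: Lp.
  split; first by split=> //; exact: (leaf_sign kappa_gt0 a_neq0 e_artanh Lp).1.
  move/(limit_geodesicE Mp) => [Z cE].
  by apply: (leaf_off_limits kappa_gt0 a_neq0 e_artanh Lp); rewrite cE.
- move=> p [[Mp c0] Gp].
  have nl : ~ on_limit p.
    move=> [Z /eqP]; rewrite eqf_sqr => /orP[/eqP cE|/eqP cE].
      by apply: Gp; apply/limit_geodesicE.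
    by move: c0; rewrite cE oppr_gt0 ltNge radial_ge0.
  have [V [phi [cV Vp VL]]] := leaf_chart Mp nl.
  (* The transverse coordinate is now l = ln h, so the curvature is recovered as expR l * k / 2. *)
  exists (V `&` [set q | 0 < (phi q).2]), (fun q => ((phi q).1, ln (phi q).2)),
    (fun l => expR l * k / 2); split.
  + exact: chart_half.
  + split=> //; exact: (leaf_sign kappa_gt0 a_neq0 e_artanh (VL _ Vp)).2.
  + move=> q [Vq /= q0]; have Lq := VL _ Vq; have Mq : M q by case: Lq.
    split; first by split=> //; exact: (leaf_sign kappa_gt0 a_neq0 e_artanh Lq).1.
    move/(limit_geodesicE Mq) => [Z cE].
    by apply: (leaf_off_limits kappa_gt0 a_neq0 e_artanh Lq); rewrite cE.
  + move=> x y /(mulIf _) E; apply: expR_inj; apply: (mulIf (lt0r_neq0 k0)).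
    by apply: E; rewrite invr_neq0.
  + by move=> q [Vq /= q0]; rewrite /L half_scale lnK ?posrE//; exact: VL.
Qed.

(** The required neighbourhood of the limit geodesic is the side [cosd] > 0 of the helicoid. *)
Lemma produces_foliation_tubes :
  produces_foliation M (tubes kappa a) (limit_geodesic kappa a).
Proof.
exists [set p | M p /\ 0 < cosd a p]; split.
- by move=> p [].
- rewrite (_ : [set p | M p /\ 0 < cosd a p] = M `&` [set p | 0 < cosd a p])//.
  rewrite open_subspaceTI; apply: open_subspaceW; rewrite openE => q q0.
  have H : \forall z \near cosd a q, 0 < z by apply: lt_nbhsr.
  exact: (@cts_cosd _ a q _ H).
- move=> p [s _ sE].
  have Mp : M p.
    rewrite -sE /S2xR /cyl /= -(sqr_sn_cs kappa_gt0 (pi / (2 * k))).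
    by have c2 := cos2sin2 s; ring: c2.
  have /(limit_geodesicE Mp)[Z cE] : limit_geodesic kappa a p by exists s.
  split=> //; rewrite cE lt_def radial_ge0 andbT.
  by apply/eqP => /(radial0_alt kappa_gt0 Mp); rewrite Z eqxx.
- exact: foliates_tubes.
Qed.

Lemma support_ext_tube (H : R) : support_of (ext_tube kappa a H) = L H.
Proof.
rewrite /ext_tube /L; case: ifPn => [H0|H0]; first exact: support_tube.
case: eqVneq => [->|H1]; first by rewrite mulr0 mul0r support_helicoid.
have H2 : 0 < - H by rewrite oppr_gt0 lt_neqAle H1 leNgt.
have E := support_tube kappa_gt0 a_neq0 H2.
by rewrite (support_opposite kappa_gt0 a_neq0 E) mulrN mulNr opprK.
Qed.

Lemma extended_tubesE : extended_tubes kappa a = range (ext_tube kappa a).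
Proof.
apply/seteqP; split=> S.
  move=> [[[H H0 <-]|->]|[_ [H H0 <-] <-]].
  - by exists H => //; rewrite /ext_tube H0.
  - by exists 0 => //; rewrite /ext_tube ltxx eqxx.
  - exists (- H) => //; rewrite /ext_tube oppr_gt0 oppr_eq0 opprK.
    by rewrite ltNge (ltW H0) gt_eqF.
move=> [H _ <-]; rewrite /ext_tube; case: ifPn => [H0|H0].
  by left; left; exists H.
case: eqVneq => [_|H1]; first by left; right.
right; exists (tube kappa a (- H)) => //; exists (- H) => //=.
by rewrite oppr_gt0 lt_neqAle H1 leNgt.
Qed.

Lemma foliates_extended_tubes :
  foliates M (M `\` (limit_geodesic kappa a `|` opposite_limit_geodesic kappa a))
    (extended_tubes kappa a).
Proof.
rewrite extended_tubesE; apply: (foliates_labelled (L := L)).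
- by move=> H _; exact: support_ext_tube.
- move=> H _; rewrite /ext_tube; case: ifPn => [H0|H0]; first exact: immersion_tube.
  case: eqVneq => [_|H1]; first exact: immersion_helicoid.
  by apply: immersion_opposite_tube => //; rewrite oppr_gt0 lt_neqAle H1 leNgt.
- move=> H _; rewrite -support_ext_tube; apply: connected_support.
  rewrite /ext_tube; case: ifPn => [H0|H0]; first exact: continuous_tube.
  case: eqVneq => [_|H1]; first exact: continuous_helicoid.
  by apply: continuous_opposite_tube => //; rewrite oppr_gt0 lt_neqAle H1 leNgt.
- exact: L_disjoint.
- move=> p; split=> [[Mp Gp]|[H _ Lp]].
    have nl : ~ on_limit p by move/(limits_on_limit Mp).
    have [h Lh] := leaf_cover kappa_gt0 a_neq0 e_artanh Mp nl.
    by exists (h * k / 2) => //; rewrite /L half_scale.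
  have Mp : M p by case: Lp.
  split=> // /(limits_on_limit Mp).
  exact: (leaf_off_limits kappa_gt0 a_neq0 e_artanh Lp).
- move=> p [Mp Gp]; have nl : ~ on_limit p by move/(limits_on_limit Mp).
  have [V [phi [cV Vp VL]]] := leaf_chart Mp nl.
  exists V, phi, (fun h => h * k / 2); split=> //.
  + move=> q Vq; have Lq := VL _ Vq; have Mq : M q by case: Lq.
    split=> // /(limits_on_limit Mq).
    exact: (leaf_off_limits kappa_gt0 a_neq0 e_artanh Lq).
  + move=> x y /(mulIf _) E; apply: (mulIf (lt0r_neq0 k0)).
    by apply: E; rewrite invr_neq0.
  + by move=> q Vq; rewrite /L half_scale; exact: VL.
Qed.

End Foliation.

(** * Necessity of the pitch condition *)

Section Necessity.
Variables (R : realType) (kappa a : R).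
Hypothesis kappa_gt0 : 0 < kappa.
Local Notation k := (Num.sqrt kappa).
Local Notation al := (coecc kappa a).
Local Notation e := (ecc kappa a).

Let k0 : 0 < k := sqrt_kappa_gt0 kappa_gt0.
Let e_gt0 : 0 < e := ecc_gt0 a kappa_gt0.
Let al_e : al ^+ 2 + e ^+ 2 = 1 :> R := coecc2_ecc2 a kappa_gt0.

Lemma ecc_le1 : e <= 1.
Proof. by have := al_e; have := e_gt0; have := sqr_ge0 al; nra. Qed.

(* On the equator the height increases with h as long as
   e / sqrt (1 + h^2) > x0, and decreases afterwards. *)
Lemma profile_top_not_inj (x0 : R) : 0 < x0 < 1 -> x0 * artanh x0 = 1 -> x0 < e ->
  exists h1 h2, [/\ 0 < h1, h1 < h2 & profile al e h1 h1^-1 = profile al e h2 h2^-1].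
Proof.
move=> /andP[x0_gt0 x0_lt1] x0E x0e.
pose f h := profile al e h h^-1.
pose g (h : R) := e / Num.sqrt (1 + h ^+ 2).
pose df h := (g h * artanh (g h) - 1) / (1 + h ^+ 2).
have hf (h : R) : 0 < h -> is_derive h (1 : R) f (df h).
  by move=> h0; exact: derive_profile_top.
have cf (h : R) : 0 < h -> {for h, continuous f}.
  by move=> h0; exact: is_derive1_continuous (hf h h0).
have m0 : 0 < (e / x0) ^+ 2 - 1.
  rewrite subr_gt0 expr_gt1 ?divr_ge0 ?ltW//.
  by rewrite ltr_pdivlMr// mul1r.
(* The critical label, at which e / sqrt (1 + m^2) = x0; f has its maximum there. *)
pose m := Num.sqrt ((e / x0) ^+ 2 - 1).
have m_gt0 : 0 < m by rewrite sqrtr_gt0.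
have gm : g m = x0.
  rewrite /g sqr_sqrtr ?ltW// addrC subrK sqrtr_sqr gtr0_norm ?divr_gt0//.
  by rewrite invf_div mulrC divfK// gt_eqF.
have g_gt0 (h : R) : 0 < g h by exact: modulus_gt0.
have g_decr (h h' : R) : 0 <= h -> h < h' -> g h' < g h.
  move=> h0 hh'; rewrite /g ltr_pM2l// ltf_pV2 ?posrE ?sqrt1D_gt0//.
  rewrite ltr_sqrt; last by have := sqr_ge0 h'; lra.
  by rewrite ltrD2l ltr_sqr ?nnegrE// ltW// (le_lt_trans h0).
have g_lt1 (h : R) : 0 < h -> g h < 1.
  by move=> h0; apply: lt_le_trans ecc_le1; apply: modulus_lt => //;
    exact: lt0r_neq0.
have q_gt0 (h : R) : 0 < 1 + h ^+ 2 by have := sqr_ge0 h; lra.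
have up : f (m / 2) < f m.
  apply: (derive_lt (f := f) (df := df)); first lra.
  - by move=> h hI; apply: cf; lra.
  - by move=> h hI; apply: hf; lra.
  - move=> h hI; rewrite divr_gt0// subr_gt0 -x0E.
    apply: mul_artanh_lt; [exact: ltW| |apply: g_lt1; lra].
    by rewrite -gm; apply: g_decr; lra.
have down : f (2 * m) < f m.
  rewrite -ltrN2.
  apply: (derive_lt (f := fun h => - f h) (df := fun h => - df h)); first lra.
  - by move=> h hI; apply: ctsN; apply: cf; lra.
  - by move=> h hI; apply: derN; apply: hf; lra.
  - move=> h hI; rewrite oppr_gt0 pmulr_llt0 ?invr_gt0// subr_lt0 -x0E.
    apply: mul_artanh_lt => //; first exact: ltW.
    by rewrite -gm; apply: g_decr; lra.
(* A value below the maximum that f takes on either side of m, between m / 2 and 2 m. *)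
have [v [vm v1 v2]] : exists v, [/\ v < f m, f (m / 2) <= v & f (2 * m) <= v].
  exists (Num.max (f (m / 2)) (f (2 * m))).
  by rewrite gt_max up down !le_max !lexx orbT.
have c1 : {within `[m / 2, m], continuous f}.
  by apply: continuous_in_subspaceT => h; rewrite inE/= in_itv/= => hI;
    apply: cf; lra.
have c2 : {within `[m, 2 * m], continuous f}.
  by apply: continuous_in_subspaceT => h; rewrite inE/= in_itv/= => hI;
    apply: cf; lra.
have m1 : m / 2 <= m by lra.
have m2 : m <= 2 * m by lra.
have [|h1] := IVT (f := f) (v := v) m1 c1.
  by rewrite (min_idPl (le_trans v1 (ltW vm))) v1 (max_idPr (le_trans v1 (ltW vm))) ltW.
rewrite in_itv/= => h1I f1.
have [|h2] := IVT (f := f) (v := v) m2 c2.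
  by rewrite (min_idPr (le_trans v2 (ltW vm))) v2 (max_idPl (le_trans v2 (ltW vm))) ltW.
rewrite in_itv/= => h2I f2.
exists h1, h2; split; first lra.
  rewrite lt_neqAle; apply/andP; split; last by lra.
  apply/eqP => E; have hm : h1 = m by lra.
  by move: vm; rewrite -f1 hm ltxx.
by rewrite -/(f h1) -/(f h2) f1 f2.
Qed.

(** Equal values of [profile] give two tubes through one point over the equator; [trivIset] then
    makes the two surfaces equal, which the altitudes at sigma = pi / 2 refute. *)
Lemma tubes_cross (x0 : R) : 0 < x0 < 1 -> x0 * artanh x0 = 1 -> x0 < e ->
  ~ trivIset (tubes kappa a) (@support_of R).
Proof.
move=> x01 x0E x0e triv.
have [h1 [h2 [h10 h12 E]]] := profile_top_not_inj x01 x0E x0e.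
have h20 := lt_trans h10 h12.
have HE (h : R) : 2 * (h * k / 2) / k = h by field; rewrite gt_eqF.
have Hgt0 (h : R) : 0 < h -> 0 < h * k / 2 by move=> h0;
  rewrite divr_gt0// mulr_gt0.
have top (h : R) : 0 < h -> tube kappa a (h * k / 2) 0 0 =
    ((k^-1, 0, 0), - (slant kappa a / k) * profile al e h h^-1).
  move=> h0; rewrite tubeE ?Hgt0// HE /screw.
  have nE : tube_norm h 0 = h by rewrite /tube_norm sin0 expr0n/= addr0 sqrtr_sqr gtr0_norm.
  rewrite /tube_profile_radius /tube_profile_alt /tube_profile_height nE.
  rewrite cos0 sin0 oppr0 mul0r !mulr0 mulr1 !addr0 expr0n/= mulr0 addr0 sqrtr_sqr.
  rewrite gtr0_norm// mul1r; congr (_, _, _, _).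
  by field; rewrite !gt_eqF.
have eqT : tube kappa a (h1 * k / 2) = tube kappa a (h2 * k / 2).
  apply: triv; [by exists (h1 * k / 2) => //; exact: Hgt0|
                by exists (h2 * k / 2) => //; exact: Hgt0|].
  exists (tube kappa a (h1 * k / 2) 0 0); split; first by exists 0, 0.
  by exists 0, 0; rewrite !top// E.
(* This altitude is - 1 / (k sqrt (h^2 + 1)), which determines h > 0. *)
have := congr1 (fun S : surface R => (S (pi / 2) 0).1.2) eqT.
rewrite !tubeE ?Hgt0// !HE /screw /= /tube_profile_alt sin_pihalf => /eqP.
have n0 (h : R) : 0 < h -> k * tube_norm h (pi / 2) != 0.
  by move=> h0; rewrite gt_eqF// (mulr_gt0 k0)// tube_norm_gt0.
rewrite eqr_div ?n0// !mulN1r eqr_opp => /eqP.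
move=> /(mulfI (lt0r_neq0 k0)) N.
have := congr1 (fun x => x ^+ 2) N; rewrite /= !tube_norm2// sin_pihalf.
move=> /addIr/eqP; rewrite eqrXn2 ?ltW// => /eqP hh.
by move: h12; rewrite hh ltxx.
Qed.

(** Squared, both sides say that x0^2 (1 + a^2 kappa) >= 1. *)
Lemma ecc_le_pitch (x0 : R) : 0 < x0 < 1 ->
  (Num.sqrt ((1 - x0 ^+ 2) / (x0 ^+ 2 * kappa)) <= `|a|) = (e <= x0).
Proof.
move=> /andP[x0_gt0 x0_lt1]; have D0 := slant_gt0 a kappa_gt0.
have D2 := slant2E a kappa_gt0; have x2 : 0 < x0 ^+ 2 by exact: exprn_gt0.
rewrite -sqrtr_sqr ler_sqrt ?sqr_ge0// ler_pdivrMr ?mulr_gt0//.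
rewrite /ecc -[_ <= x0](@ler_sqr R) ?nnegrE ?invr_ge0 ?(ltW D0) ?(ltW x0_gt0)//.
rewrite exprVn -(div1r (slant kappa a ^+ 2)) ler_pdivrMr ?exprn_gt0// D2.
rewrite mulrDr mulr1 lerBlDl; congr (_ <= _ + _); ring.
Qed.

End Necessity.

Theorem theorem5p1 (R : realType) (kappa a : R) (kappa_gt0 : 0 < kappa) :
  exists x0 : R,
    [/\ unique (fun x : R => 0 < x < 1 /\ x * artanh x = 1) x0,
        `|x0 - (833 / 10 ^+ 3 + 56 / 10 ^+ 5)| <= 5 / 10 ^+ 6,
        produces_foliation (S2xR kappa) (tubes kappa a)
            (limit_geodesic kappa a)
          <-> Num.sqrt ((1 - x0 ^+ 2) / (x0 ^+ 2 * kappa)) <= `|a|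
      & produces_foliation (S2xR kappa) (tubes kappa a)
            (limit_geodesic kappa a) ->
          extended_tubes kappa a = range (ext_tube kappa a) /\
          foliates (S2xR kappa)
            (S2xR kappa `\`
              (limit_geodesic kappa a `|` opposite_limit_geodesic kappa a))
            (extended_tubes kappa a)].
Proof.
have [x0 [x01 x0E x0lo x0hi]] := artanh_root R.
have foliation_ecc : produces_foliation (S2xR kappa) (tubes kappa a)
    (limit_geodesic kappa a) -> ecc kappa a <= x0.
  move=> [W [_ _ _ [_ triv _ _]]]; rewrite leNgt; apply/negP => x0e.
  exact: (tubes_cross kappa_gt0 x01 x0E x0e).
have ecc_pitch : ecc kappa a <= x0 ->
    a != 0 /\ ecc kappa a * artanh (ecc kappa a) <= 1.
  move=> ex0; split.
    (* Pitch 0 gives e = 1 > x0. *)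
    apply: contraTneq ex0 => ->.
    rewrite -ltNge /ecc /slant expr0n/= mul0r addr0 sqrtr1 invr1.
    by case/andP: x01.
  move: ex0; rewrite le_eqVlt => /predU1P[->|ex0]; first by rewrite x0E.
  rewrite -x0E ltW// mul_artanh_lt ?(ltW (ecc_gt0 _ _))//.
  by case/andP: x01.
exists x0; split.
- split=> // y [y01 yE].
  case/andP: (x01) => x0_gt0 x0_lt1; case/andP: (y01) => y_gt0 y_lt1.
  have [xy|yx|//] := ltgtP x0 y.
    by have := mul_artanh_lt (ltW x0_gt0) xy y_lt1; rewrite x0E yE ltxx.
  by have := mul_artanh_lt (ltW y_gt0) yx x0_lt1; rewrite x0E yE ltxx.
- by rewrite ler_norml; apply/andP; split; lra.
- rewrite ecc_le_pitch//; split; first exact: foliation_ecc.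
  by move=> /ecc_pitch[a0 ea]; exact: produces_foliation_tubes.
- move=> /foliation_ecc/ecc_pitch[a0 ea]; split; first exact: extended_tubesE.
  exact: foliates_extended_tubes.
Qed.
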